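(* Assume that there is a $P$ which is non-zero in $\mathsf{D}^{\mathrm{c}}(R^{\mathrm{o}})$ and satisfies $\sup P < \infty$. Set $$d = \operatorname{pcd} P - \sup P.$$ If $M$ is in $\mathsf{D}^{\mathrm{c}}(R)$ and satisfies $\sup M < \infty$, then $$\operatorname{pcd} M = \sup M + d.$$
   Context: $k$ is a field and $R$ is a cochain Differential Graded (DG) algebra over $k$ (cohomologically graded) of the form $\cdots \to 0 \to k \to 0 \to R^2 \to R^3 \to \cdots$, i.e. $R^j = 0$ for $j<0$, $R^0 = k$, $R^1 = 0$, with $\dim_k \mathrm{H}^j(R) < \infty$ for each $j$. $\mathsf{D}(R)$ and $\mathsf{D}(R^{\mathrm{o}})$ are the derived categories of DG left-$R$-modules and DG right-$R$-modules, and $\otimes^{\mathrm{L}}_R$ is the left derived tensor product. $k$ is viewed as a DG bi-$R$-module concentrated in degree $0$. A DG left-$R$-module is in $\mathsf{D}^{\mathrm{c}}(R)$ (compact) precisely if it is finitely built from $R$ in $\mathsf{D}(R)$ using distinguished triangles, (de)suspensions, finite direct sums and direct summands; $\mathsf{D}^{\mathrm{c}}(R^{\mathrm{o}})$ is defined similarly for DG right-$R$-modules. ''Non-zero'' means not isomorphic to $0$ in the derived category. For a DG module (or complex) $N$: $\sup N = \sup\{ j \mid \mathrm{H}^j(N)\neq 0\}$, with the convention $\sup\varnothing = -\infty$. The projective codimension of a DG left-$R$-module $M$ is $\operatorname{pcd} M = \sup(k \otimes^{\mathrm{L}}_R M)$, and that of a DG right-$R$-module $P$ is $\operatorname{pcd}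 P = \sup(P \otimes^{\mathrm{L}}_R k)$. *)

(* Defs.v *)
From HB Require Import structures.
From mathcomp Require Import all_boot all_order all_algebra.
From mathcomp Require Import boolp classical_sets constructive_ereal.
From mathcomp Require Import ring zify.

Set Implicit Arguments.
Unset Strict Implicit.
Unset Printing Implicit Defensive.

Import Order.TTheory GRing.Theory.

Local Open Scope ring_scope.
Local Open Scope quotient_scope.

(******************************************************************************)
(* Graded objects are families indexed by int. An operation landing in degree *)
(* n takes a proof of the equation that n must satisfy (such as i + j = n)    *)
(* instead of landing in a degree computed by the operation; this avoids      *)
(* transport along equalities of degrees. These proofs are irrelevant since   *)
(* int has decidable equality.                                                *)
(******************************************************************************)

Definition sgn (k : fieldType) (i : int) : k := (-1) ^ i.

Lemma sgnD (k : fieldType) i j : sgn k (i + j) = sgn k i * sgn k j.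
Proof. by rewrite /sgn expfzDr // oppr_eq0 oner_eq0. Qed.

Lemma sgn1 (k : fieldType) : sgn k 1 = -1.
Proof. by rewrite /sgn expr1z. Qed.

Lemma sgn_sq (k : fieldType) i : sgn k i * sgn k i = 1.
Proof. by rewrite /sgn -exprzMl ?unitrN1 // mulrNN mulr1 exp1rz. Qed.

Lemma sgnMC (k : fieldType) i j : sgn k (i * j) = sgn k (j * i).
Proof. by rewrite mulrC. Qed.

Section Complexes.
Variable k : fieldType.

Record complex := Complex {
  cgr :> int -> lmodType k;
  diff : forall i j : int, i + 1 = j -> cgr i -> cgr j;
  diff_linear : forall i j (h : i + 1 = j), linear (diff h);
  diff_diff : forall i j l (h : i + 1 = j) (h' : j + 1 = l) (x : cgr i),
    diff h' (diff h x) = 0 }.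

HB.instance Definition _ (C : complex) i j (h : i + 1 = j) :=
  GRing.isLinear.Build k (C i) (C j) *:%R (@diff C i j h)
    (@diff_linear C i j h).

Definition cocycle (C : complex) n (z : C n) : Prop :=
  diff (erefl (n + 1)) z = 0.

Definition boundary (C : complex) n (z : C n) : Prop :=
  exists (m : int) (h : m + 1 = n) (y : C m), diff h y = z.

Definition H_nonzero (C : complex) (n : int) : Prop :=
  exists2 z : C n, cocycle z & ~ boundary z.

Definition acyclic (C : complex) : Prop := forall n, ~ H_nonzero C n.

Definition H_findim (C : complex) (n : int) : Prop :=
  exists (b : nat) (z : 'I_b -> C n), (forall l, cocycle (z l)) /\
    forall x : C n, cocycle x ->
      exists c : 'I_b -> k, boundary (x - \sum_(l < b) c l *: z l).

(* The supremum is taken in the extended integers; it is -oo on the empty     *)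
(* set and +oo if the cohomology is not bounded above.                        *)
Definition csup (C : complex) : \bar int :=
  supremum -oo%E [set n%:E%E | n in H_nonzero C].

End Complexes.

Section DGAlgebras.
Variable k : fieldType.

Record dgalg := DGAlg {
  dga_complex :> complex k;
  mul : forall i j n : int, i + j = n ->
    dga_complex i -> dga_complex j -> dga_complex n;
  one : dga_complex 0;
  mul_linearl : forall i j n (h : i + j = n) b, linear (fun a => mul h a b);
  mul_linearr : forall i j n (h : i + j = n) a, linear (mul h a);
  mul_assoc : forall i j l ij jl n (h1 : i + j = ij) (h2 : ij + l = n)
    (h3 : j + l = jl) (h4 : i + jl = n) a b c,
    mul h2 (mul h1 a b) c = mul h4 a (mul h3 b c);
  mul_1l : forall i (h : 0 + i = i) a, mul h one a = a;
  mul_1r : forall i (h : i + 0 = i) a, mul h a one = a;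
  mul_leibniz : forall i j n i' j' n' (hi : i + 1 = i') (hj : j + 1 = j')
    (hn : n + 1 = n') (h : i + j = n) (h1 : i' + j = n') (h2 : i + j' = n')
    a b, diff hn (mul h a b) =
         mul h1 (diff hi a) b + sgn k i *: mul h2 a (diff hj b) }.

Section Opposite.
Variable R : dgalg.

Definition op_mul i j n (h : i + j = n) (a : R i) (b : R j) : R n :=
  sgn k (i * j) *: mul (etrans (addrC j i) h) b a.

Lemma op_mul_linearl i j n (h : i + j = n) b :
  linear (fun a => op_mul h a b).
Proof.
by move=> c x y; rewrite /op_mul mul_linearr scalerDr !scalerA mulrC.
Qed.

Lemma op_mul_linearr i j n (h : i + j = n) a : linear (op_mul h a).
Proof.
by move=> c x y; rewrite /op_mul mul_linearl scalerDr !scalerA mulrC.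
Qed.

Lemma mulZl i j n (h : i + j = n) c (a : R i) (b : R j) :
  mul h (c *: a) b = c *: mul h a b.
Proof.
pose f := GRing.isLinear.Build k _ _ *:%R _ (mul_linearl h b).
pose F : {linear _ -> _} := HB.pack (fun a => mul h a b) f.
exact: (linearZ_LR F).
Qed.

Lemma mulZr i j n (h : i + j = n) c (a : R i) (b : R j) :
  mul h a (c *: b) = c *: mul h a b.
Proof.
pose f := GRing.isLinear.Build k _ _ *:%R _ (mul_linearr h a).
pose F : {linear _ -> _} := HB.pack (mul h a) f.
exact: (linearZ_LR F).
Qed.

Lemma op_mul_assoc i j l ij jl n (h1 : i + j = ij) (h2 : ij + l = n)
    (h3 : j + l = jl) (h4 : i + jl = n) (a : R i) (b : R j) (c : R l) :
  op_mul h2 (op_mul h1 a b) c = op_mul h4 a (op_mul h3 b c).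
Proof.
rewrite /op_mul mulZl mulZr !scalerA -!sgnD.
rewrite (mul_assoc (etrans (addrC l j) h3) _ (etrans (addrC j i) h1)
                   (etrans (addrC l ij) h2)).
by congr (sgn k _ *: _); rewrite -h1 -h3; ring.
Qed.

Lemma op_mul_1l i (h : 0 + i = i) (a : R i) : op_mul h (one R) a = a.
Proof. by rewrite /op_mul mul0r mul_1r /sgn expr0z scale1r. Qed.

Lemma op_mul_1r i (h : i + 0 = i) (a : R i) : op_mul h a (one R) = a.
Proof. by rewrite /op_mul mulr0 mul_1l /sgn expr0z scale1r. Qed.

Lemma op_mul_leibniz i j n i' j' n' (hi : i + 1 = i') (hj : j + 1 = j')
    (hn : n + 1 = n') (h : i + j = n) (h1 : i' + j = n') (h2 : i + j' = n')
    (a : R i) (b : R j) :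
  diff hn (op_mul h a b) =
  op_mul h1 (diff hi a) b + sgn k i *: op_mul h2 a (diff hj b).
Proof.
rewrite /op_mul linearZ /=.
rewrite (mul_leibniz hj hi hn _ (etrans (addrC j' i) h2)
                     (etrans (addrC j i') h1)).
rewrite scalerDr !scalerA [LHS]addrC.
congr (_ + _).
  by rewrite -sgnD; congr (sgn k _ *: _); rewrite -hi; ring.
congr (_ *: _).
have -> : sgn k (i * j') = sgn k i * sgn k (i * j).
  by rewrite -sgnD; congr (sgn k _); rewrite -hj; ring.
by rewrite mulrA sgn_sq mul1r.
Qed.

Definition op_dgalg : dgalg :=
  DGAlg op_mul_linearl op_mul_linearr op_mul_assoc op_mul_1l op_mul_1r
        op_mul_leibniz.

End Opposite.

(* R has the form ... -> 0 -> k -> 0 -> R^2 -> R^3 -> ... and cohomology of   *)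
(* finite dimension in each degree.                                           *)
Record simply_connected (R : dgalg) : Prop := SimplyConnected {
  sc_neg : forall j : int, (j < 0)%R -> forall a : R j, a = 0;
  sc_zero : bijective (fun c : k => c *: one R);
  sc_one : forall a : R 1, a = 0;
  sc_findim : forall j : int, H_findim R j }.

End DGAlgebras.

Notation "R ^op" := (op_dgalg R) (at level 1, format "R ^op") : dg_scope.
Delimit Scope dg_scope with DG.
Local Open Scope dg_scope.

Section DGModules.
Variables (k : fieldType) (R : dgalg k).

(* DG left-R-modules. DG right-R-modules are by definition the DG left-       *)
(* modules over R^op; see ract below.                                         *)
Record dgmod := DGMod {
  dgm_complex :> complex k;
  act : forall i j n : int, i + j = n -> R i -> dgm_complex j -> dgm_complex n;
  act_linearl : forall i j n (h : i + j = n) m, linear (fun a => act h a m);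
  act_linearr : forall i j n (h : i + j = n) a, linear (act h a);
  act_assoc : forall i j l ij jl n (h1 : i + j = ij) (h2 : ij + l = n)
    (h3 : j + l = jl) (h4 : i + jl = n) a b m,
    act h2 (mul h1 a b) m = act h4 a (act h3 b m);
  act_1 : forall i (h : 0 + i = i) m, act h (one R) m = m;
  act_leibniz : forall i j n i' j' n' (hi : i + 1 = i') (hj : j + 1 = j')
    (hn : n + 1 = n') (h : i + j = n) (h1 : i' + j = n') (h2 : i + j' = n')
    a m, diff hn (act h a m) =
         act h1 (diff hi a) m + sgn k i *: act h2 a (diff hj m) }.

HB.instance Definition _ (M : dgmod) i j n (h : i + j = n) (a : R i) :=
  GRing.isLinear.Build k (M j) (M n) *:%R (act h a) (@act_linearr M i j n h a).

Lemma actZl (M : dgmod) i j n (h : i + j = n) c (a : R i) (m : M j) :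
  act h (c *: a) m = c *: act h a m.
Proof.
pose f := GRing.isLinear.Build k _ _ *:%R _ (act_linearl h m).
pose F : {linear _ -> _} := HB.pack (fun a => act h a m) f.
exact: (linearZ_LR F).
Qed.

Lemma act0l (M : dgmod) i j n (h : i + j = n) (m : M j) :
  act h (0 : R i) m = 0.
Proof. by rewrite -(scale0r (0 : R i)) actZl scale0r. Qed.

Lemma actDl (M : dgmod) i j n (h : i + j = n) (a b : R i) (m : M j) :
  act h (a + b) m = act h a m + act h b m.
Proof. by have := act_linearl h m 1 a b; rewrite !scale1r. Qed.

Record dghom (M N : dgmod) := DGHom {
  hom :> forall i : int, M i -> N i;
  hom_linear : forall i, linear (@hom i);
  hom_diff : forall i j (h : i + 1 = j) m, hom (diff h m) = diff h (hom m);
  hom_act : forall i j n (h : i + j = n) a m,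
    hom (act h a m) = act h a (hom m) }.
Arguments hom {M N} f i m : rename.

HB.instance Definition _ (M N : dgmod) (f : dghom M N) i :=
  GRing.isLinear.Build k (M i) (N i) *:%R (@hom M N f i) (@hom_linear M N f i).

(* The first condition says that H^n(f) is injective and the second one that  *)
(* it is surjective.                                                          *)
Definition quasi_iso (M N : dgmod) (f : dghom M N) : Prop :=
  forall n : int,
    (forall z : M n, cocycle z -> boundary (f n z) -> boundary z) /\
    (forall w : N n, cocycle w ->
       exists2 z : M n, cocycle z & boundary (w - f n z)).

(* Isomorphism in D(R): a morphism of D(R) is a roof M <- L -> N whose left   *)
(* leg is a quasi-isomorphism, and it is invertible exactly if its right leg  *)
(* is also a quasi-isomorphism.                                               *)
Definition Diso (M N : dgmod) : Prop :=
  exists (L : dgmod) (f : dghom L M) (g : dghom L N),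
    quasi_iso f /\ quasi_iso g.

Section Zero.

Definition zero_complex : complex k.
Proof.
refine (@Complex k (fun=> 'rV[k]_0) (fun _ _ _ _ => 0) _ _) => // *.
by move=> c x y; rewrite scaler0 addr0.
Defined.

Definition zero_dgmod : dgmod.
Proof.
refine (@DGMod zero_complex (fun _ _ _ _ _ _ => 0) _ _ _ _ _) => // *.
- by move=> c x y; rewrite scaler0 addr0.
- by move=> c x y; rewrite scaler0 addr0.
- by rewrite [RHS]thinmx0.
- by rewrite scaler0 addr0.
Defined.

End Zero.

Definition regular_dgmod : dgmod :=
  DGMod (@mul_linearl k R) (@mul_linearr k R) (@mul_assoc k R) (@mul_1l k R)
        (@mul_leibniz k R).

Section DirectSum.
Variables M N : dgmod.

Definition sum_complex : complex k.
Proof.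
refine (@Complex k (fun n => (M n * N n)%type)
          (fun i j h x => (diff h x.1, diff h x.2)) _ _).
- by move=> i j h c x y /=; rewrite !linearP.
- by move=> i j l h h' x /=; rewrite !diff_diff.
Defined.

Definition sum_dgmod : dgmod.
Proof.
refine (@DGMod sum_complex
          (fun i j n h a x => (act h a x.1, act h a x.2)) _ _ _ _ _) => /=.
- by move=> i j n h m c x y /=; rewrite !act_linearl.
- by move=> i j n h a c x y /=; rewrite !linearP.
- move=> i j l ij jl n h1 h2 h3 h4 a b m /=.
  by rewrite !(act_assoc h1 h2 h3 h4).
- by move=> i h [x y] /=; rewrite !act_1.
- move=> i j n i' j' n' hi hj hn h h1 h2 a m /=.
  by rewrite !(act_leibniz hi hj hn h h1 h2).
Defined.

End DirectSum.

(* The s-fold suspension: degree n of it is degree n + s of M, and both the   *)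
(* differential and the action acquire the Koszul sign for moving past a      *)
(* symbol of degree s.                                                        *)
Section Shift.
Variables (s : int) (M : dgmod).

Lemma shift_eq1 i j : i + 1 = j -> (i + s) + 1 = j + s.
Proof. by move=> <-; rewrite addrAC. Qed.

Lemma shift_eqD i j n : i + j = n -> i + (j + s) = n + s.
Proof. by move=> <-; rewrite addrA. Qed.

Definition shift_complex : complex k.
Proof.
refine (@Complex k (fun n => M (n + s))
          (fun i j h x => sgn k s *: diff (shift_eq1 h) x) _ _).
- by move=> i j h c x y; rewrite linearP scalerDr !scalerA mulrC.
- by move=> i j l h h' x; rewrite linearZ /= diff_diff !scaler0.
Defined.

Definition shift_dgmod : dgmod.
Proof.
refine (@DGMod shift_complex
          (fun i j n h a x => sgn k (i * s) *: act (shift_eqD h) a x)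
          _ _ _ _ _) => /=.
- move=> i j n h m c x y /=.
  by rewrite act_linearl scalerDr !scalerA mulrC.
- by move=> i j n h a c x y /=; rewrite linearP scalerDr !scalerA mulrC.
- move=> i j l ij jl n h1 h2 h3 h4 a b m /=.
  rewrite linearZ /= !scalerA -sgnD -mulrDl h1.
  by rewrite (act_assoc h1 _ (shift_eqD h3) (shift_eqD h4)).
- by move=> i h x /=; rewrite mul0r /sgn expr0z scale1r act_1.
- move=> i j n i' j' n' hi hj hn h h1 h2 a m /=.
  rewrite !linearZ /= (act_leibniz hi (shift_eq1 hj) _ _
    (shift_eqD h1) (shift_eqD h2)).
  rewrite !scalerDr !scalerA -!sgnD.
  by congr (sgn k _ *: _ + sgn k _ *: _); rewrite -?hi; ring.
Defined.

End Shift.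

(* The mapping cone of f : A -> B, with A^(n+1) + B^n in degree n,            *)
(* differential (a, b) |-> (- d a, f a + d b), and the suspended action on    *)
(* the first summand.                                                         *)
Section Cone.
Variables (A B : dgmod) (f : dghom A B).

Definition cone_gr (n : int) : lmodType k := (A (n + 1)%R * B n)%type.

Definition cone_diff (i j : int) (h : i + 1 = j) : cone_gr i -> cone_gr j :=
  match h in _ = j return cone_gr i -> cone_gr j with
  | erefl => fun x => (- diff (erefl (i + 1 + 1)) x.1,
                       f (i + 1) x.1 + diff (erefl (i + 1)) x.2)
  end.

Definition cone_complex : complex k.
Proof.
refine (@Complex k cone_gr cone_diff _ _).
- move=> i j; case: j / => c x y /=.
  by rewrite !linearP /= addrACA -scalerDr.
- move=> i j l h; case: l /; case: j / h => x /=.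
  rewrite linearN /= diff_diff !oppr0 linearN /= linearD /= diff_diff addr0.
  by rewrite hom_diff addNr.
Defined.

Definition cone_act i j n (h : i + j = n) (a : R i)
    (x : cone_gr j) : cone_gr n :=
  (sgn k i *: act (shift_eqD 1 h) a x.1, act h a x.2).

Definition cone_dgmod : dgmod.
Proof.
refine (@DGMod cone_complex cone_act _ _ _ _ _); rewrite /cone_act.
- move=> i j n h m c x y /=.
  by rewrite !act_linearl scalerDr scalerA mulrC -scalerA.
- move=> i j n h a c x y /=.
  by rewrite !act_linearr scalerDr scalerA mulrC -scalerA.
- move=> i j l ij jl n h1 h2 h3 h4 a b m /=; congr (_, _).
    rewrite linearZ /= !scalerA -sgnD h1.
    by rewrite (act_assoc h1 _ (shift_eqD 1 h3) (shift_eqD 1 h4)).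
  exact: act_assoc.
- by move=> i h [x y] /=; rewrite /sgn expr0z scale1r !act_1.
- move=> i j n i' j' n' hi hj hn h h1 h2 a x /=.
  case: i' / hi h1; case: j' / hj h2; case: n' / hn => h2 h1 /=.
  congr (_, _).
    rewrite linearZ /= linearN /=.
    rewrite (act_leibniz erefl erefl _ _ (shift_eqD 1 h1) (shift_eqD 1 h2)).
    rewrite sgnD sgn1 mulrN1 scalerDr opprD scaleNr; congr (_ + _).
    by rewrite scalerN scalerN.
  rewrite (act_leibniz erefl erefl _ _ h1 h2) /= linearD /= scalerDr.
  rewrite linearZ /= hom_act addrCA; congr (_ + (_ + _)).
  by rewrite (eq_irrelevance (shift_eqD 1 h) h2).
Defined.

End Cone.

(* X -> Y -> Z -> is part of a distinguished triangle of D(R): up to          *)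
(* isomorphism in D(R), Z is the mapping cone of a morphism of DG modules     *)
(* from X to Y.                                                               *)
Definition dist_triangle (X Y Z : dgmod) : Prop :=
  exists (A B : dgmod) (f : dghom A B),
    [/\ Diso X A, Diso Y B & Diso Z (cone_dgmod f)].

(* Finitely built from R in D(R). As the class is closed under all            *)
(* suspensions, the clause on triangles also gives the first or second vertex *)
(* of a triangle from the other two, by rotation.                             *)
Inductive Dcompact : dgmod -> Prop :=
| Dcompact_regular : Dcompact regular_dgmod
| Dcompact_iso M N : Diso M N -> Dcompact M -> Dcompact N
| Dcompact_shift s M : Dcompact M -> Dcompact (shift_dgmod s M)
| Dcompact_zero : Dcompact zero_dgmod
| Dcompact_sum M N : Dcompact M -> Dcompact N -> Dcompact (sum_dgmod M N)
| Dcompact_triangle X Y Z :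
    dist_triangle X Y Z -> Dcompact X -> Dcompact Y -> Dcompact Z
| Dcompact_summand M N : Dcompact (sum_dgmod M N) -> Dcompact M.

Definition null_homotopic (M N : dgmod) (f : dghom M N) : Prop :=
  exists s : forall i j : int, j + 1 = i -> M i -> N j,
    [/\ forall i j (h : j + 1 = i), linear (s i j h),
        forall i j n j' n' (hj : j' + 1 = j) (hn : n' + 1 = n)
          (h : i + j = n) (h' : i + j' = n') (a : R i) (x : M j),
          s n n' hn (act h a x) = sgn k i *: act h' a (s j j' hj x)
      & forall i j l (hl : i + 1 = l) (hj : j + 1 = i) (x : M i),
          f i x = diff hj (s i j hj x) + s l i hl (diff hl x)].

(* As N may be replaced by its suspensions, this says that the complex        *)
(* Hom_R(F, N) is acyclic for every acyclic N.                                *)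
Definition K_projective (F : dgmod) : Prop :=
  forall (N : dgmod) (f : dghom F N), acyclic N -> null_homotopic f.

Definition is_Kproj_resolution (M F : dgmod) : Prop :=
  K_projective F /\ exists f : dghom F M, quasi_iso f.

(* Every DG module has a K-projective resolution, so the second branch never  *)
(* occurs; it only makes the definition independent of a proof of that fact.  *)
Definition Kproj_resolution (M : dgmod) : dgmod :=
  if pselect (exists F, is_Kproj_resolution M F) is left ex
  then projT1 (cid ex) else M.

End DGModules.

Section Tensor.
Variables (k : fieldType) (R : dgalg k).

(* The right action on a DG left-R^op-module: p r = (-1)^(|p||r|) r p.        *)
Definition ract (P : dgmod R^op) i j n (h : i + j = n) (p : P i) (a : R j) :
    P n :=
  sgn k (i * j) *: act (etrans (addrC j i) h) (a : R^op j) p.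

Lemma ract_leibniz (P : dgmod R^op) i j n i' j' n' (hi : i + 1 = i')
    (hj : j + 1 = j') (hn : n + 1 = n') (h : i + j = n) (h1 : i' + j = n')
    (h2 : i + j' = n') (p : P i) (a : R j) :
  diff hn (ract h p a) =
  ract h1 (diff hi p) a + sgn k i *: ract h2 p (diff hj a).
Proof.
rewrite /ract linearZ /=.
rewrite (act_leibniz (hj : j + 1 = j') hi hn _ (etrans (addrC j' i) h2)
                     (etrans (addrC j i') h1)).
rewrite scalerDr !scalerA [LHS]addrC; congr (_ + _).
  by rewrite -sgnD; congr (sgn k _ *: _); rewrite -hi; ring.
congr (_ *: _).
have -> : sgn k (i * j') = sgn k i * sgn k (i * j).
  by rewrite -sgnD; congr (sgn k _); rewrite -hj; ring.
by rewrite mulrA sgn_sq mul1r.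
Qed.

Variables (P : dgmod R^op) (M : dgmod R).

Record pure_tensor (n : int) := PureTensor {
  pt_l : int; pt_r : int; pt_eq : pt_l + pt_r = n;
  pt_p : P pt_l; pt_m : M pt_r }.

HB.instance Definition _ n := gen_eqMixin (pure_tensor n).
HB.instance Definition _ n := gen_choiceMixin (pure_tensor n).

Record balanced n (V : lmodType k)
    (b : forall i j : int, i + j = n -> P i -> M j -> V) : Prop := Balanced {
  balanced_linearl : forall i j (h : i + j = n) m,
    linear (fun p => b i j h p m);
  balanced_linearr : forall i j (h : i + j = n) p, linear (b i j h p);
  balanced_act : forall i r j ir rj (h1 : i + r = ir) (h2 : r + j = rj)
    (h : ir + j = n) (h' : i + rj = n) p a m,
    b ir j h (ract h1 p a) m = b i rj h' p (act h2 a m) }.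

Definition eval_tensor n (V : lmodType k)
    (b : forall i j : int, i + j = n -> P i -> M j -> V)
    (s : seq (pure_tensor n)) : V :=
  \sum_(x <- s) b _ _ (pt_eq x) (pt_p x) (pt_m x).

(* The degree n part of P (x)_R M consists of formal sums of pure tensors,    *)
(* two of them being identified if no balanced map into a vector space        *)
(* separates them. The universal property is tens_lift below.                 *)
Definition tens_eqv n (s t : seq (pure_tensor n)) : bool :=
  `[< forall (V : lmodType k) b, @balanced n V b ->
        eval_tensor b s = eval_tensor b t >].

Lemma tens_eqv_refl n : reflexive (@tens_eqv n).
Proof. by move=> s; apply/asboolP. Qed.

Lemma tens_eqv_sym n : symmetric (@tens_eqv n).
Proof.
by move=> s t; apply/asboolP/asboolP => e V b hb; rewrite (e V b hb).
Qed.

Lemma tens_eqv_trans n : transitive (@tens_eqv n).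
Proof.
move=> t s u /asboolP e1 /asboolP e2; apply/asboolP => V b hb.
by rewrite e1 // e2.
Qed.

Canonical tens_equiv n :=
  EquivRel (@tens_eqv n) (@tens_eqv_refl n) (@tens_eqv_sym n)
           (@tens_eqv_trans n).

Definition tens n := {eq_quot @tens_eqv n}.
HB.instance Definition _ n := Choice.on (tens n).
HB.instance Definition _ n := EqQuotient.on (tens n).

Definition ptens i j n (h : i + j = n) (p : P i) (m : M j) : tens n :=
  \pi_(tens n) [:: PureTensor h p m].

Definition pt_scale n (c : k) (x : pure_tensor n) : pure_tensor n :=
  PureTensor (pt_eq x) (c *: pt_p x) (pt_m x).

Definition tens_zero n : tens n := \pi_(tens n) [::].
Definition tens_add n (x y : tens n) : tens n :=
  \pi_(tens n) (repr x ++ repr y).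
Definition tens_scale n (c : k) (x : tens n) : tens n :=
  \pi_(tens n) (map (pt_scale c) (repr x)).
Definition tens_opp n (x : tens n) : tens n := tens_scale (-1) x.

Definition tens_ev n (V : lmodType k)
    (b : forall i j : int, i + j = n -> P i -> M j -> V) (x : tens n) : V :=
  eval_tensor b (repr x).

Section Evaluation.
Variables (n : int) (V : lmodType k).
Variable b : forall i j : int, i + j = n -> P i -> M j -> V.
Hypothesis hb : balanced b.

Lemma tens_ev_pi s : tens_ev b (\pi_(tens n) s) = eval_tensor b s.
Proof.
have /eqmodP/asboolP e : repr (\pi_(tens n) s) = s %[mod tens n].
  by rewrite reprK.
exact: e.
Qed.

Lemma eval_scale c s :
  eval_tensor b (map (pt_scale c) s) = c *: eval_tensor b s.
Proof.
rewrite /eval_tensor big_map scaler_sumr; apply: eq_bigr => x _ /=.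
pose f := GRing.isLinear.Build k _ _ *:%R _
            (balanced_linearl hb (pt_eq x) (pt_m x)).
pose F : {linear _ -> _} := HB.pack (fun p => b (pt_eq x) p (pt_m x)) f.
exact: (linearZ_LR F).
Qed.

Lemma tens_ev0 : tens_ev b (tens_zero n) = 0.
Proof. by rewrite tens_ev_pi /eval_tensor big_nil. Qed.

Lemma tens_evD x y :
  tens_ev b (tens_add x y) = tens_ev b x + tens_ev b y.
Proof. by rewrite tens_ev_pi /eval_tensor big_cat. Qed.

Lemma tens_evZ c x : tens_ev b (tens_scale c x) = c *: tens_ev b x.
Proof. by rewrite tens_ev_pi eval_scale. Qed.

Lemma tens_ev_pure i j (h : i + j = n) p m : tens_ev b (ptens h p m) = b h p m.
Proof. by rewrite tens_ev_pi /eval_tensor big_seq1. Qed.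

End Evaluation.

Lemma tens_ext n (x y : tens n) :
  (forall (V : lmodType k) b, @balanced n V b -> tens_ev b x = tens_ev b y) ->
  x = y.
Proof.
move=> e; rewrite -[x]reprK -[y]reprK; apply/eqmodP/asboolP; exact: e.
Qed.

Section Instances.
Variable n : int.

Let tensE := (tens_evD, tens_evZ, tens_ev0).

Lemma tens_addA : associative (@tens_add n).
Proof.
by move=> x y z; apply: tens_ext => V b hb; rewrite !tens_evD // addrA.
Qed.
Lemma tens_addC : commutative (@tens_add n).
Proof.
by move=> x y; apply: tens_ext => V b hb; rewrite !tens_evD // addrC.
Qed.
Lemma tens_add0 : left_id (tens_zero n) (@tens_add n).
Proof.
by move=> x; apply: tens_ext => V b hb; rewrite !tens_evD // tens_ev0 // add0r.
Qed.
Lemma tens_addN : left_inverse (tens_zero n) (@tens_opp n) (@tens_add n).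
Proof.
move=> x; apply: tens_ext => V b hb.
by rewrite tens_evD // tens_evZ // tens_ev0 // scaleN1r addNr.
Qed.

HB.instance Definition _ :=
  GRing.isZmodule.Build (tens n) tens_addA tens_addC tens_add0 tens_addN.

Lemma tens_scaleA c e (x : tens n) :
  tens_scale c (tens_scale e x) = tens_scale (c * e) x.
Proof. by apply: tens_ext => V b hb; rewrite !tens_evZ // scalerA. Qed.
Lemma tens_scale1 : left_id 1 (@tens_scale n).
Proof. by move=> x; apply: tens_ext => V b hb; rewrite tens_evZ // scale1r. Qed.
Lemma tens_scaleDr : right_distributive (@tens_scale n) +%R.
Proof.
move=> c x y; apply: tens_ext => V b hb.
by rewrite tens_evZ // !tens_evD // !tens_evZ // scalerDr.
Qed.
Lemma tens_scaleDl (x : tens n) :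
  {morph (@tens_scale n)^~ x : c e / c + e >-> c + e}.
Proof.
move=> c e; apply: tens_ext => V b hb.
by rewrite tens_evD // !tens_evZ // scalerDl.
Qed.

HB.instance Definition _ :=
  GRing.Zmodule_isLmodule.Build k (tens n)
    tens_scaleA tens_scale1 tens_scaleDr tens_scaleDl.

End Instances.

Lemma tens_ev_linear n (V : lmodType k) b (hb : @balanced n V b) :
  linear (tens_ev b).
Proof. by move=> c x y; rewrite [LHS]tens_evD // tens_evZ. Qed.

Lemma ptens_balanced n : balanced (fun i j h => @ptens i j n h).
Proof.
split.
- move=> i j h m c x y; apply: tens_ext => V b hb.
  rewrite [RHS]tens_evD // tens_evZ // !tens_ev_pure //.
  exact: (balanced_linearl hb).
- move=> i j h m c x y; apply: tens_ext => V b hb.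
  rewrite [RHS]tens_evD // tens_evZ // !tens_ev_pure //.
  exact: (balanced_linearr hb).
- move=> i r j ir rj h1 h2 h h' p a m; apply: tens_ext => V b hb.
  rewrite !tens_ev_pure //; exact: (balanced_act hb).
Qed.

Lemma tens_ind n (Q : tens n -> Prop) :
  Q 0 -> (forall i j (h : i + j = n) p m x, Q x -> Q (ptens h p m + x)) ->
  forall x, Q x.
Proof.
move=> Q0 QD; elim/quotW; elim=> [//|[i j h p m] s IHs].
have -> : \pi_(tens n) (PureTensor h p m :: s) = ptens h p m + \pi_(tens n) s.
  apply: tens_ext => V b hb; rewrite [RHS]tens_evD // !tens_ev_pi //.
  by rewrite /eval_tensor !big_cons big_nil addr0.
exact: QD.
Qed.

Lemma tens_lift n (V : lmodType k) b : @balanced n V b ->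
  exists2 g : tens n -> V,
    linear g /\ (forall i j (h : i + j = n) p m, g (ptens h p m) = b i j h p m)
  & forall g' : tens n -> V, linear g' ->
      (forall i j (h : i + j = n) p m, g' (ptens h p m) = b i j h p m) ->
      g' =1 g.
Proof.
move=> hb; exists (tens_ev b).
  by split=> [|*]; [exact: tens_ev_linear | exact: tens_ev_pure].
move=> g' g'_lin g'E; have g'D x y : g' (x + y) = g' x + g' y.
  by have := g'_lin 1 x y; rewrite !scale1r.
elim/tens_ind=> [|i j h p m x IHx].
  by rewrite [RHS](tens_ev0 hb); apply: (addrI (g' 0)); rewrite -g'D !addr0.
by rewrite g'D g'E IHx [RHS]tens_evD // tens_ev_pure.
Qed.

Definition tens_diff_pure n n' (hn : n + 1 = n') i j (h : i + j = n)
    (p : P i) (m : M j) : tens n' :=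
  ptens (etrans (addrAC i 1 j) (etrans (congr1 (+%R^~ 1) h) hn))
        (diff erefl p) m +
  sgn k i *:
  ptens (etrans (addrA i j 1) (etrans (congr1 (+%R^~ 1) h) hn))
        p (diff erefl m).

Lemma ptensDl i j n (h : i + j = n) (p q : P i) (m : M j) :
  ptens h (p + q) m = ptens h p m + ptens h q m.
Proof.
by have := balanced_linearl (ptens_balanced n) h m 1 p q; rewrite !scale1r.
Qed.

Lemma ptensDr i j n (h : i + j = n) (p : P i) (m m' : M j) :
  ptens h p (m + m') = ptens h p m + ptens h p m'.
Proof.
by have := balanced_linearr (ptens_balanced n) h p 1 m m'; rewrite !scale1r.
Qed.

Lemma ptens0l i j n (h : i + j = n) (m : M j) : ptens h (0 : P i) m = 0.
Proof. by apply: (addrI (ptens h (0 : P i) m)); rewrite -ptensDl !addr0. Qed.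

Lemma ptens0r i j n (h : i + j = n) (p : P i) : ptens h p (0 : M j) = 0.
Proof. by apply: (addrI (ptens h p (0 : M j))); rewrite -ptensDr !addr0. Qed.

Lemma ptensZl i j n (h : i + j = n) c (p : P i) (m : M j) :
  ptens h (c *: p) m = c *: ptens h p m.
Proof.
have := balanced_linearl (ptens_balanced n) h m c p 0.
by rewrite addr0 ptens0l addr0.
Qed.

Lemma ptensZr i j n (h : i + j = n) c (p : P i) (m : M j) :
  ptens h p (c *: m) = c *: ptens h p m.
Proof.
have := balanced_linearr (ptens_balanced n) h p c m 0.
by rewrite addr0 ptens0r addr0.
Qed.

Lemma ptens_act i r j ir rj n (h1 : i + r = ir) (h2 : r + j = rj)
    (h : ir + j = n) (h' : i + rj = n) (p : P i) (a : R r) (m : M j) :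
  ptens h (ract h1 p a) m = ptens h' p (act h2 a m).
Proof. exact: (balanced_act (ptens_balanced n)). Qed.

Lemma tens_diff_balanced n n' (hn : n + 1 = n') :
  balanced (fun i j h => @tens_diff_pure n n' hn i j h).
Proof.
rewrite /tens_diff_pure; split.
- move=> i j h m c x y.
  rewrite linearP !ptensDl !ptensZl [in RHS]scalerDr [RHS]addrACA scalerDr.
  by rewrite !scalerA mulrC.
- move=> i j h m c x y.
  rewrite linearP !ptensDr !ptensZr [in RHS]scalerDr [RHS]addrACA scalerDr.
  by rewrite !scalerA mulrC.
- move=> i r j ir rj h1 h2 h h' p a m.
  case: ir / h1 h => h; case: rj / h2 h' => h'.
  rewrite (ract_leibniz erefl erefl _ _ (addrAC i 1 r) (addrA i r 1)).
  rewrite (act_leibniz erefl erefl _ _ (addrAC r 1 j) (addrA r j 1)).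
  rewrite ptensDl (ptensZl _ (sgn k i)) ptensDr (ptensZr _ (sgn k r)).
  rewrite [in RHS]scalerDr [in RHS]scalerA -sgnD [RHS]addrA.
  by congr (_ + _ *: _ + _ *: _); apply: ptens_act.
Qed.

Definition tens_diff n n' (hn : n + 1 = n') : tens n -> tens n' :=
  tens_ev (tens_diff_pure hn).

Lemma tens_diff_linear n n' (hn : n + 1 = n') : linear (tens_diff hn).
Proof. exact: tens_ev_linear (tens_diff_balanced hn). Qed.

Lemma tens_diff_ptens n n' (hn : n + 1 = n') i j i' j' (hi : i + 1 = i')
    (hj : j + 1 = j') (h : i + j = n) (h1 : i' + j = n') (h2 : i + j' = n')
    (p : P i) (m : M j) :
  tens_diff hn (ptens h p m) =
  ptens h1 (diff hi p) m + sgn k i *: ptens h2 p (diff hj m).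
Proof.
case: i' / hi h1 => h1; case: j' / hj h2 => h2.
rewrite /tens_diff (tens_ev_pure (tens_diff_balanced hn)) /tens_diff_pure.
set e1 := etrans _ _; set e2 := etrans (addrA _ _ _) _.
by rewrite (eq_irrelevance e1 h1) (eq_irrelevance e2 h2).
Qed.

Lemma tens_diff_diff n n' n'' (hn : n + 1 = n') (hn' : n' + 1 = n'')
  (x : tens n) : tens_diff hn' (tens_diff hn x) = 0.
Proof.
have dD l l' (hl : l + 1 = l') (y z : tens l) :
    tens_diff hl (y + z) = tens_diff hl y + tens_diff hl z.
  by have := tens_diff_linear hl 1 y z; rewrite !scale1r.
have d0 l l' (hl : l + 1 = l') : tens_diff hl 0 = 0.
  by apply: (addrI (tens_diff hl 0)); rewrite -dD !addr0.
have dZ l l' (hl : l + 1 = l') c (y : tens l) :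
    tens_diff hl (c *: y) = c *: tens_diff hl y.
  by have := tens_diff_linear hl c y 0; rewrite !addr0 d0 addr0.
elim/tens_ind: x => [|i j h p m x IHx]; first by rewrite !d0.
rewrite !dD IHx addr0.
case: n' / hn hn' x IHx => hn' x _; case: n'' / hn'; case: n / h x => x.
rewrite (tens_diff_ptens _ erefl erefl _ (addrAC i 1 j) (addrA i j 1)) dD dZ.
have e1 : i + 1 + 1 + j = i + j + 1 + 1 by ring.
have e2 : i + 1 + (j + 1) = i + j + 1 + 1 by ring.
have e3 : i + (j + 1 + 1) = i + j + 1 + 1 by ring.
rewrite (tens_diff_ptens _ erefl erefl _ e1 e2).
rewrite (tens_diff_ptens _ erefl erefl _ e2 e3).
rewrite !diff_diff ptens0l ptens0r scaler0 add0r addr0 -scalerDl.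
by rewrite sgnD sgn1 mulrN1 addNr scale0r.
Qed.

Definition tens_complex : complex k :=
  Complex tens_diff_linear tens_diff_diff.

End Tensor.

(* K-projective DG modules are K-flat, so resolving both arguments gives the  *)
(* same object of D(k) as resolving either one of them.                       *)
Definition Ltens (k : fieldType) (R : dgalg k) (P : dgmod R^op) (M : dgmod R) :
    complex k :=
  tens_complex (Kproj_resolution P) (Kproj_resolution M).

(* k as a DG module concentrated in degree 0, on which R acts through the     *)
(* augmentation R -> R^0 = k. In degree n it is the space of row vectors of   *)
(* length 1 if n = 0 and of length 0 otherwise.                               *)
Section Residue.
Variables (k : fieldType) (R : dgalg k) (scR : simply_connected R).

Lemma deg0_scalar (a : R 0) : exists c : k, a = c *: one R.
Proof. by case: (sc_zero scR) => g _ gK; exists (g a); rewrite gK. Qed.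

Lemma scale_one_inj : injective (fun c : k => c *: one R).
Proof. exact: bij_inj (sc_zero scR). Qed.

Definition aug0 (a : R 0) : k := projT1 (cid (deg0_scalar a)).

Definition aug (i : int) : R i -> k :=
  match i with Posz 0 => aug0 | _ => fun=> 0 end.

Lemma aug0K (a : R 0) : aug0 a *: one R = a.
Proof. by rewrite /aug0; case: cid. Qed.

Lemma aug0_linear : linear (aug0 : R 0 -> k^o).
Proof.
move=> c x y; apply: scale_one_inj.
by rewrite /= scalerDl -scalerA !aug0K.
Qed.

Lemma aug_out i (a : R i) : i != 0 -> aug a = 0.
Proof. by case: i a => [[|n]|n]. Qed.

Lemma aug_linear i : linear (aug (i := i) : R i -> k^o).
Proof.
case: i => [[|n]|n]; first exact: aug0_linear.
all: by move=> c x y /=; rewrite scaler0 addr0.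
Qed.

Lemma aug_zero i : aug (0 : R i) = 0.
Proof.
have /eqP := aug_linear 1 (0 : R i) (0 : R i).
by rewrite !scale1r addr0 -subr_eq subrr => /eqP.
Qed.

Lemma mul0l_dg i j n (h : i + j = n) (b : R j) : mul h (0 : R i) b = 0.
Proof. by rewrite -(scale0r (0 : R i)) mulZl scale0r. Qed.

Lemma mulr0_dg i j n (h : i + j = n) (a : R i) : mul h a (0 : R j) = 0.
Proof. by rewrite -(scale0r (0 : R j)) mulZr scale0r. Qed.

Lemma aug_mul i j n (h : i + j = n) (a : R i) (b : R j) :
  aug (mul h a b) = aug a * aug b.
Proof.
have [n0|n0] := eqVneq n 0; last first.
  rewrite aug_out //; have [i0|i0] := eqVneq i 0; last first.
    by rewrite (aug_out a i0) mul0r.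
  by rewrite (aug_out b) ?mulr0 //; lia.
have [i0|i0] := eqVneq i 0; last first.
  rewrite (aug_out a i0) mul0r; have [ilt|ige] := boolP (i < 0)%R.
    by rewrite (sc_neg scR ilt a) mul0l_dg aug_zero.
  have jlt : (j < 0)%R by lia.
  by rewrite (sc_neg scR jlt b) mulr0_dg aug_zero.
have j0 : j = 0 by lia.
subst i j n; apply: scale_one_inj => /=.
rewrite aug0K -[in LHS](aug0K a) mulZl -[in LHS](aug0K b) mulZr scalerA.
by rewrite mul_1l.
Qed.

Lemma aug_diff i j (h : i + 1 = j) (a : R i) : aug (diff h a) = 0.
Proof.
have [j0|j0] := eqVneq j 0; last exact: aug_out.
have ilt : (i < 0)%R by lia.
by rewrite (sc_neg scR ilt a) linear0 aug_zero.
Qed.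

Lemma ord_deg0 (n : int) (l : 'I_(n == 0)) : n = 0.
Proof. by apply/eqP; case: (n == 0) l => // -[]. Qed.

Definition residue_gr (n : int) : lmodType k := 'rV[k]_(n == 0).

Definition residue_complex : complex k.
Proof.
refine (@Complex k residue_gr (fun _ _ _ _ => 0) _ _) => // *.
by move=> c x y; rewrite scaler0 addr0.
Defined.

Definition residue_coef n (v : residue_gr n) : k := \sum_l v 0 l.

Definition residue_act i j n (h : i + j = n) (a : R i) (v : residue_gr j) :
    residue_gr n :=
  const_mx (aug a * residue_coef v).

Lemma residue_coef_linear n : linear (@residue_coef n : _ -> k^o).
Proof.
move=> c x y; rewrite /residue_coef scaler_sumr -big_split.
by apply: eq_bigr => l _; rewrite !mxE.
Qed.

Lemma residue_coef_const n (c : k) :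
  residue_coef (const_mx c : residue_gr n) = c *+ (n == 0).
Proof.
rewrite /residue_coef (eq_bigr (fun=> c)) => [|l _]; last by rewrite mxE.
by rewrite sumr_const card_ord.
Qed.

Lemma residue_coef_out n (v : residue_gr n) : n != 0 -> residue_coef v = 0.
Proof.
by move/eqP=> n0; apply: big1 => l; case: n0; exact: ord_deg0 l.
Qed.

Definition residue_dgmod : dgmod R.
Proof.
refine (@DGMod k R residue_complex residue_act _ _ _ _ _); rewrite /residue_act.
- move=> i j n h m c x y; apply/matrixP => u l; rewrite !mxE aug_linear.
  by rewrite mulrDl; congr (_ + _); rewrite /GRing.scale /= mulrA.
- move=> i j n h a c x y; apply/matrixP => u l; rewrite !mxE.
  rewrite residue_coef_linear mulrDr; congr (_ + _); exact: mulrCA.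
- move=> i j l ij jl n h1 h2 h3 h4 a b m; apply/matrixP => u v; rewrite !mxE.
  have n0 := ord_deg0 v.
  rewrite aug_mul residue_coef_const -mulrA.
  have [jl0|jl0] := eqVneq jl 0; first by [].
  by rewrite (aug_out a) ?mul0r //; lia.
- move=> i h m; apply/matrixP => u l; rewrite !mxE.
  have -> : aug (one R) = 1.
    by apply: scale_one_inj; rewrite /= aug0K scale1r.
  rewrite mul1r /residue_coef (bigD1 l) //= big1 ?addr0 => [|l' ll'].
    by rewrite (ord1 u).
  by case/eqP: ll'; case: (i == 0) l l' => l l'; [rewrite !ord1 | case: l].
- move=> i j n i' j' n' hi hj hn h h1 h2 a m; apply/matrixP => u l.
  rewrite !mxE aug_diff mul0r add0r residue_coef_const.
  by rewrite mul0rn !mulr0.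
Defined.

End Residue.

Lemma op_simply_connected (k : fieldType) (R : dgalg k) :
  simply_connected R -> simply_connected R^op.
Proof. by case=> *; split. Qed.

Definition pcd (k : fieldType) (R : dgalg k) (scR : simply_connected R)
    (M : dgmod R) : \bar int :=
  csup (Ltens (residue_dgmod (op_simply_connected scR)) M).

Definition pcd_right (k : fieldType) (R : dgalg k) (scR : simply_connected R)
    (P : dgmod R^op) : \bar int :=
  csup (Ltens P (residue_dgmod scR)).

(* Main.v *)
Require Import Defs.
From HB Require Import structures.
From mathcomp Require Import all_boot all_order all_algebra.
From mathcomp Require Import boolp classical_sets functions constructive_ereal.
From mathcomp Require Import ring zify.

(** Let [P] and [M] be compact and not acyclic, with cohomology bounded above. The
    theorem is the equality of the two sides of

      sup P + pcd M = sup (P (x)^L M) = sup M + pcd P,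

    and the two equations are mirror images of each other. So let [F] be a K-projective
    resolution of a compact module, [N] a module on the other side whose highest
    cohomology is in degree [s], and [c] the highest degree of the cohomology of
    [k (x) F]. The claim is that the highest cohomology of [N (x) F] is in degree
    [s + c]; the case [N = k] identifies [c] with the projective codimension.

    Dualizing over [k] removes the tensor product. Functionals on degree [n] of [N (x) F]
    that kill the boundaries are homomorphisms from [F] to the module [D] with
    [D^i = Hom (N^{n-i}, k)], and
    [H^n(N (x) F)] vanishes if and only if all homomorphisms from [F] to [D] are
    null-homotopic ([vanish_of_null], [null_of_vanish]). As [H^i(D)] is dual to
    [H^{n-i}(N)], the question becomes which modules [X] receive a homomorphism from [F]
    that is not null-homotopic, depending on the lowest degree of the cohomology
    of [X].

    Say that [F] satisfies [proj_below c] if it has only null-homotopic maps to modules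
    with cohomology above [c]. A finitely built module has a resolution of this kind
    for some [c] ([compact_resolved]): the property holds for [R] and passes to
    suspensions and cones, and a direct summand is a cone by an Eilenberg swindle
    ([swindle_proj_quasi_iso]). Now suppose that the cohomology of [X] starts in
    degree [c]. Because [R^0 = k] and [R^1 = 0], the two groups [H^c(X)] and
    [H^{c+1}(X)] do not interact: after a truncation ([truncate]), [X] maps to a module
    on which [R] acts through [k], so that the cone has no cohomology up to degree [c]
    ([test_module]), and [F] does not see the difference. Maps from [F] to modules with
    such an action only depend on the complex [k (x) F]. Hence if [H^c(k (x) F) = 0], then
    [F] satisfies [proj_below (c - 1)] ([proj_below_pred]), and otherwise every such [X]
    receives a map from [F] that is not null-homotopic ([nonnull_hom]). The first
    alternative cannot go on forever, since the cohomology of [F] is bounded below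
    ([exists_top]); where it stops, [c] is the degree in question, and the
    claim follows. *)

Set Implicit Arguments.
Unset Strict Implicit.
Unset Printing Implicit Defensive.

Import Order.TTheory GRing.Theory.

Local Open Scope dg_scope.
Local Open Scope ring_scope.

(** * Extending linear maps between vector spaces *)
Section LinearExtension.
Variables (k : fieldType) (B V : lmodType k).

(** Partial linear maps are encoded as their graphs: linear extension, retraction
    onto a subspace, factorization and separating functionals all become
    the single question whether a single-valued linear relation is contained in
    the graph of a linear map. *)
Definition lin_rel (G : B -> V -> Prop) : Prop :=
  G 0 0 /\ forall c x y v w, G x v -> G y w -> G (c *: x + y) (c *: v + w).

Definition single_valued (G : B -> V -> Prop) : Prop :=
  forall v, G 0 v -> v = 0.

(** By the lemma of Zorn there is a maximal single-valued linear relation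
    containing [G]; if it were not defined at [x], it could be enlarged by
    sending [x] to [0]. *)
Lemma lin_ext (G : B -> V -> Prop) : lin_rel G -> single_valued G ->
  exists2 f : B -> V, linear f & forall x v, G x v -> f x = v.
Proof.
move=> linG svG.
pose good (A : set (B * V)) :=
  lin_rel (fun x v => A (x, v)) /\ single_valued (fun x v => A (x, v)).
pose G' : set (B * V) := fun p => G p.1 p.2.
pose S A := A = set0 \/ (good A /\ (G' `<=` A)%classic).
(* The empty relation is admitted in [S] because the empty chain has an empty
   union. *)
have [] := @Zorn_bigcup _ S.
  move=> F FS totF.
  have [[A0 A0F A0n0]|F0] := pselect (exists2 A, F A & A <> set0); last first.
    left; rewrite -subset0 => x [A FA Ax]; apply: F0; exists A => // An0.
    by rewrite An0 in Ax.
  have FSn A x : F A -> A x -> good A /\ (G' `<=` A)%classic.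
    by move=> FA Ax; case: (FS _ FA) => // An0; rewrite An0 in Ax.
  have A0x : exists x, A0 x.
    by apply/set0P/eqP.
  case: A0x => a0 A0a0; have [[[A00 A0l] A0s] GA0] := FSn _ _ A0F A0a0.
  right; split; last by move=> x Gx; exists A0 => //; exact: GA0.
  split; first split; first by exists A0.
    move=> c x y v w [A FA Axv] [A' FA' Ayw].
    have [[[_ Al] _] _] := FSn _ _ FA Axv.
    have [[[_ A'l] _] _] := FSn _ _ FA' Ayw.
    have [AA'|A'A] := totF _ _ FA FA'.
      by exists A' => //; apply: A'l => //; exact: AA'.
    by exists A => //; apply: Al => //; exact: A'A.
  move=> v [A FA Av]; have [[_ As] _] := FSn _ _ FA Av.
  exact: As.
move=> A [SA Amax].
have SG : S G' by right; split=> //; exact: subset_refl.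
have [[[A0 Al] As] GA] : good A /\ (G' `<=` A)%classic.
  case: SA => // A0; exfalso; have AG : (A `<` G')%classic.
    split; first by rewrite A0.
    by move=> /(_ (0, 0) linG.1); rewrite A0.
  exact: Amax AG SG.
have Auniq x v w : A (x, v) -> A (x, w) -> v = w.
  move=> Av Aw; apply/eqP; rewrite -subr_eq0; apply/eqP; apply: As.
  by have := Al (-1) _ _ _ _ Aw Av; rewrite !scaleN1r addNr addrC.
have Atot x : exists v, A (x, v).
  apply: contrapT => nx.
  pose A' : set (B * V) :=
    fun p => exists c y v, A (y, v) /\ p = (c *: x + y, v).
  have AA' : (A `<=` A')%classic.
    by move=> [y v] Ay; exists 0, y, v; rewrite scale0r add0r.
  apply: (Amax A').
    split=> // /(_ (x, 0)) A'A; apply: nx; exists 0; apply: A'A.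
    by exists 1, 0, 0; rewrite scale1r addr0.
  right; split; last exact: subset_trans AA'.
  split; first split; first exact: AA'.
    move=> c _ _ _ _ [e [y' [v [Ay [-> ->]]]]] [g [z' [w [Az [-> ->]]]]].
    exists (c * e + g), (c *: y' + z'), (c *: v + w); split; first exact: Al.
    by congr (_, _); rewrite scalerDr scalerDl scalerA addrACA.
  move=> _ [c [y [v [Ay [e ->]]]]].
  have [c0|c0] := eqVneq c 0.
    by apply: As; move: e Ay; rewrite c0 scale0r add0r => <-.
  exfalso; apply: nx; exists (- c^-1 *: v).
  have := Al (- c^-1) _ _ _ _ Ay A0; rewrite !addr0.
  suff -> : - c^-1 *: y = x by [].
  have -> : y = - (c *: x) by apply/eqP; rewrite -addr_eq0 addrC e.
  by rewrite scaleNr scalerN opprK scalerA mulVf // scale1r.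
have [f fA] := choice Atot; exists f.
  by move=> c x y; apply: Auniq (fA _) _; exact: Al.
by move=> x v Gxv; apply: Auniq (fA x) _; exact: GA.
Qed.

End LinearExtension.

Section Subspaces.
Variables (k : fieldType) (V : lmodType k).

(** Subspaces are predicates with values in [Prop], since cocycles, boundaries and
    kernels are not decidable; [sub_lmod] turns one into a vector space. *)
Record subspace := Subspace {
  subspace_pred :> V -> Prop;
  subspace0 : subspace_pred 0;
  subspaceP : forall c x y,
    subspace_pred x -> subspace_pred y -> subspace_pred (c *: x + y) }.

Variable S : subspace.

Lemma subspaceD x y : S x -> S y -> S (x + y).
Proof. by move=> Sx Sy; rewrite -[x]scale1r; exact: subspaceP. Qed.

Lemma subspaceZ c x : S x -> S (c *: x).
Proof. by move=> Sx; rewrite -[_ *: _]addr0; apply: subspaceP => //; exact: subspace0. Qed.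

Lemma subspaceN x : S x -> S (- x).
Proof. by move=> Sx; rewrite -scaleN1r; exact: subspaceZ. Qed.

Lemma subspaceB x y : S x -> S y -> S (x - y).
Proof. by move=> Sx Sy; apply: subspaceD => //; exact: subspaceN. Qed.

Definition subspace_mem : {pred V} := [pred x | `[< S x >]].

Fact subspace_mem_closed : submod_closed subspace_mem.
Proof.
split; first by apply/asboolP; exact: subspace0.
by move=> c x y /asboolP Sx /asboolP Sy; apply/asboolP; exact: subspaceP.
Qed.

HB.instance Definition _ :=
  GRing.isSubmodClosed.Build k V subspace_mem subspace_mem_closed.

Record sub_type := SubType { sub_val :> V; sub_mem : sub_val \in subspace_mem }.
HB.instance Definition _ := [isSub for sub_val].
HB.instance Definition _ := [Choice of sub_type by <:].
HB.instance Definition _ := [SubChoice_isSubLmodule of sub_type by <:].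

Definition sub_lmod : lmodType k := sub_type.

Definition to_sub (x : V) (Sx : S x) : sub_lmod := SubType (asboolT Sx).

Lemma sub_valP (x : sub_lmod) : S (sub_val x).
Proof. by case: x => x /= /asboolP. Qed.

Lemma sub_val_inj : injective (sub_val : sub_lmod -> V).
Proof. exact: val_inj. Qed.

Lemma sub_val_linear : linear (sub_val : sub_lmod -> V).
Proof. exact: (linearP (val : {linear sub_type -> V})). Qed.

Lemma sub_val0 : sub_val (0 : sub_lmod) = 0.
Proof. exact: (linear0 (val : sub_type -> V)). Qed.

End Subspaces.
Arguments sub_val {k V S} _.

HB.instance Definition _ (k : fieldType) (V : lmodType k) (S : subspace V) :=
  GRing.isLinear.Build k (sub_lmod S) V *:%R (@sub_val k V S) (@sub_val_linear k V S).

Section LinearMaps.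
Variables (k : fieldType) (U V : lmodType k).
Variables (f : U -> V) (fl : linear f).

Lemma linear_fun0 : f 0 = 0.
Proof. by have /eqP := fl 1 0 0; rewrite !scale1r addr0 -subr_eq subrr => /eqP. Qed.

Lemma linear_funD x y : f (x + y) = f x + f y.
Proof. by rewrite -{1}[x]scale1r fl scale1r. Qed.

Lemma linear_funZ c x : f (c *: x) = c *: f x.
Proof. by rewrite -[_ *: x]addr0 fl linear_fun0 addr0. Qed.

Lemma linear_funN x : f (- x) = - f x.
Proof. by rewrite -scaleN1r linear_funZ scaleN1r. Qed.

Lemma linear_funB x y : f (x - y) = f x - f y.
Proof. by rewrite linear_funD linear_funN. Qed.

End LinearMaps.

Section Kernels.
Variables (k : fieldType) (U V : lmodType k) (f : U -> V) (fl : linear f).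

Fact kernelP c x y : f x = 0 -> f y = 0 -> f (c *: x + y) = 0.
Proof. by move=> fx fy; rewrite fl fx fy scaler0 addr0. Qed.

Definition kernel : subspace U :=
  @Subspace k U (fun x => f x = 0) (linear_fun0 fl) kernelP.

End Kernels.

Definition zero_space (k : fieldType) (V : lmodType k) : subspace V :=
  @kernel k V V id (fun _ _ _ => erefl).

Section Extensions.
Variables (k : fieldType) (V : lmodType k).

Lemma sub_retraction (S : subspace V) :
  exists2 r : V -> sub_lmod S, linear r & forall x, S x -> sub_val (r x) = x.
Proof.
have [||r rl rS] := @lin_ext _ V (sub_lmod S) (fun x v => x = sub_val v).
- by split=> [|c x y v w -> ->]; rewrite ?linear0 ?linearP.
- by move=> v v0; apply: sub_val_inj; rewrite -v0 linear0.
by exists r => // x Sx; rewrite (rS x (to_sub Sx)).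
Qed.

(** A linear map [f] on [A] that vanishes wherever [d] lands in [S] factors through
    the composite of [d] with the quotient map of [B] by [S]. It is what produces
    homotopies below, [d] being a differential. *)
Lemma linear_factor (A B : lmodType k) (d : A -> B) (f : A -> V)
    (S : subspace B) : linear d -> linear f -> (forall a, S (d a) -> f a = 0) ->
  exists g : B -> V,
    [/\ linear g, forall b, S b -> g b = 0 & forall a, g (d a) = f a].
Proof.
move=> dl fl fS.
have [||g gl gE] :=
  @lin_ext _ B V (fun b v => exists2 a, S (b - d a) & v = f a).
- split.
    exists 0; last by rewrite (linear_fun0 fl).
    by rewrite (linear_fun0 dl) subr0; exact: subspace0.
  move=> c x y _ _ [a Sa ->] [b Sb ->]; exists (c *: a + b); last by rewrite fl.
  by rewrite dl opprD addrACA -scalerBr; exact: subspaceP.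
- move=> _ [a Sa ->]; apply: fS.
  by move/subspaceN: Sa; rewrite sub0r opprK.
exists g; split=> // [b Sb|a].
  by apply: gE; exists 0; rewrite ?(linear_fun0 dl) ?subr0 ?(linear_fun0 fl).
by apply: gE; exists a; rewrite // subrr; exact: subspace0.
Qed.

End Extensions.

Lemma separating_functional (k : fieldType) (V : lmodType k) (S : subspace V)
    (z : V) : ~ S z ->
  exists f : V -> k^o, [/\ linear f, forall x, S x -> f x = 0 & f z = 1].
Proof.
move=> Sz.
have [|||g [gl gS gE]] :=
  @linear_factor k k^o k^o V (fun c : k^o => c *: z) id S.
- by move=> c x y /=; rewrite scalerDl scalerA.
- by [].
- move=> c Sc; apply: contrapT => /eqP c0; apply: Sz.
  by rewrite -[z]scale1r -(mulVf c0) -scalerA; exact: subspaceZ.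
by exists g; split=> //; rewrite -[z]scale1r gE.
Qed.

(** * Transport between equal degrees *)
Definition recast (k : fieldType) (C : int -> lmodType k) i j (e : i = j) :
  C i -> C j := let: erefl := e in id.

Section Casts.
Variable k : fieldType.

Lemma recast_linear (C : int -> lmodType k) i j (e : i = j) : linear (recast (C := C) e).
Proof. by case: j / e. Qed.

HB.instance Definition _ (C : int -> lmodType k) i j (e : i = j) :=
  GRing.isLinear.Build k (C i) (C j) *:%R (recast e) (recast_linear e).

Lemma recast_id (C : int -> lmodType k) i (e : i = i) (x : C i) : recast e x = x.
Proof. by rewrite (eq_irrelevance e erefl). Qed.

Lemma recast_recast (C : int -> lmodType k) i j l (e : i = j) (e' : j = l) (x : C i) :
  recast e' (recast e x) = recast (etrans e e') x.
Proof. by case: l / e'; case: j / e. Qed.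

Lemma recastK (C : int -> lmodType k) i j (e : i = j) (e' : j = i) :
  cancel (recast (C := C) e) (recast e').
Proof. by move=> x; rewrite recast_recast recast_id. Qed.

Lemma diff_recast (C : complex k) i j l (e : i = j) (h : j + 1 = l) (h' : i + 1 = l)
    (x : C i) : diff h (recast e x) = diff h' x.
Proof. by case: j / e h => h; rewrite (eq_irrelevance h h'). Qed.

Lemma recast_diff (C : complex k) i j l (h : i + 1 = j) (e : j = l) (h' : i + 1 = l)
    (x : C i) : recast e (diff h x) = diff h' x.
Proof. by case: l / e h' => h'; rewrite (eq_irrelevance h h'). Qed.

Lemma act_recast (R : dgalg k) (M : dgmod R) i j l n (e : j = l) (h : i + l = n)
    (h' : i + j = n) (a : R i) (x : M j) : act h a (recast e x) = act h' a x.
Proof. by case: l / e h => h; rewrite (eq_irrelevance h h'). Qed.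

Lemma recast_act (R : dgalg k) (M : dgmod R) i j l n (e : n = l) (h : i + j = n)
    (h' : i + j = l) (a : R i) (x : M j) : recast e (act h a x) = act h' a x.
Proof. by case: l / e h' => h'; rewrite (eq_irrelevance h h'). Qed.

Lemma hom_recast (R : dgalg k) (M N : dgmod R) (f : dghom M N) i j (e : i = j)
    (x : M i) : f j (recast e x) = recast e (f i x).
Proof. by case: j / e. Qed.

End Casts.

(** * Cohomology and homotopies *)
Section Cohomology.
Variables (k : fieldType) (C : complex k).

Lemma cocycle_diff n (z : C n) : cocycle z -> forall j (h : n + 1 = j), diff h z = 0.
Proof. by move=> cz j h; case: j / h. Qed.

Lemma diff_cocycle n j (h : n + 1 = j) (z : C n) : diff h z = 0 -> cocycle z.
Proof. by case: j / h. Qed.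

Lemma boundary_diff m n (h : m + 1 = n) (y : C m) : boundary (diff h y).
Proof. by exists m, h, y. Qed.

Lemma boundaryE n (z : C n) : boundary z ->
  forall m (h : m + 1 = n), exists y, diff h y = z.
Proof.
move=> [m' [h' [y <-]]] m h.
have e : m' = m by lia.
by exists (recast e y); rewrite (diff_recast _ _ h').
Qed.

Lemma boundary_cocycle n (z : C n) : boundary z -> cocycle z.
Proof. by move=> [m [h [y <-]]]; rewrite /cocycle diff_diff. Qed.

Lemma cocycleP n c (x y : C n) : cocycle x -> cocycle y -> cocycle (c *: x + y).
Proof. by rewrite /cocycle => cx cy; rewrite linearP /= cx cy scaler0 addr0. Qed.

Lemma cocycle0 n : cocycle (0 : C n).
Proof. by rewrite /cocycle linear0. Qed.

Definition cocycles n := Subspace (cocycle0 n) (@cocycleP n).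

Lemma boundary0 n : boundary (0 : C n).
Proof.
have h : n - 1 + 1 = n by rewrite subrK.
by exists (n - 1), h, 0; rewrite linear0.
Qed.

Lemma boundaryP n c (x y : C n) :
  boundary x -> boundary y -> boundary (c *: x + y).
Proof.
have h : n - 1 + 1 = n by rewrite subrK.
move=> /boundaryE /(_ _ h) [x' <-] /boundaryE /(_ _ h) [y' <-].
by exists (n - 1), h, (c *: x' + y'); rewrite linearP.
Qed.

Definition boundaries n := Subspace (boundary0 n) (@boundaryP n).

Lemma boundaryD n (x y : C n) : boundary x -> boundary y -> boundary (x + y).
Proof. exact: (@subspaceD _ _ (boundaries n)). Qed.

Lemma boundaryZ n c (x : C n) : boundary x -> boundary (c *: x).
Proof. exact: (@subspaceZ _ _ (boundaries n)). Qed.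

Lemma boundaryN n (x : C n) : boundary x -> boundary (- x).
Proof. exact: (@subspaceN _ _ (boundaries n)). Qed.

Lemma boundaryB n (x y : C n) : boundary x -> boundary y -> boundary (x - y).
Proof. exact: (@subspaceB _ _ (boundaries n)). Qed.

Lemma cocycleB n (x y : C n) : cocycle x -> cocycle y -> cocycle (x - y).
Proof. exact: (@subspaceB _ _ (cocycles n)). Qed.

Definition H_vanish n := forall z : C n, cocycle z -> boundary z.

Lemma H_vanishP n : H_vanish n <-> ~ H_nonzero C n.
Proof.
split=> [v [z cz []]|nz z cz]; first exact: v.
by apply: contrapT => bz; apply: nz; exists z.
Qed.

Lemma H_nonvanishP n : ~ H_vanish n <-> H_nonzero C n.
Proof. by rewrite H_vanishP; split=> [/contrapT|z]; [|apply]. Qed.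

End Cohomology.

Section Homs.
Variables (k : fieldType) (R : dgalg k).
Implicit Types M N L X Y : dgmod R.

Definition id_hom M : dghom M M.
Proof. by refine (@DGHom k R M M (fun _ => id) _ _ _). Defined.

Definition comp_hom L M N (g : dghom M N) (f : dghom L M) : dghom L N.
Proof.
refine (@DGHom k R L N (fun i x => g i (f i x)) _ _ _).
- by move=> i c x y; rewrite !linearP.
- by move=> i j h m; rewrite !hom_diff.
- by move=> i j n h a m; rewrite !hom_act.
Defined.

Definition zero_hom M N : dghom M N.
Proof.
refine (@DGHom k R M N (fun _ _ => 0) _ _ _).
- by move=> i c x y; rewrite scaler0 addr0.
- by move=> i j h m; rewrite linear0.
- by move=> i j n h a m; rewrite linear0.
Defined.

Definition lincomb_hom (c : k) M N (f g : dghom M N) : dghom M N.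
Proof.
refine (@DGHom k R M N (fun i x => c *: f i x + g i x) _ _ _).
- move=> i e x y; rewrite !(linear_funD (@hom_linear _ _ _ _ _ i)) !(linear_funZ (@hom_linear _ _ _ _ _ i)).
  by rewrite !scalerDr !scalerA mulrC addrACA.
- by move=> i j h m; rewrite !hom_diff linearP.
- by move=> i j n h a m; rewrite !hom_act linearP.
Defined.

Definition sub_hom M N (f g : dghom M N) := lincomb_hom (-1) g f.

Lemma sub_homE M N (f g : dghom M N) i x : sub_hom f g i x = f i x - g i x.
Proof. by rewrite /= scaleN1r addrC. Qed.

Definition homotopic M N (f g : dghom M N) := null_homotopic (sub_hom f g).

Lemma null_homotopic_eq M N (f g : dghom M N) :
  (forall i x, f i x = g i x) -> null_homotopic f -> null_homotopic g.
Proof. by move=> e [s [sl sa sd]]; exists s; split=> // *; rewrite -e; exact: sd. Qed.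

Lemma null_zero M N : null_homotopic (zero_hom M N).
Proof.
exists (fun _ _ _ _ => 0); split=> [i j h c x y|i j n j' n' hj hn h h' a x|i j l hl hj x] /=.
- by rewrite scaler0 addr0.
- by rewrite linear0 scaler0.
- by rewrite linear0 addr0.
Qed.

Lemma null_lincomb c M N (f g : dghom M N) :
  null_homotopic f -> null_homotopic g -> null_homotopic (lincomb_hom c f g).
Proof.
move=> [s [sl sa sd]] [t [tl ta td]].
exists (fun i j h x => c *: s i j h x + t i j h x); split.
- by move=> i j h e x y; rewrite sl tl !scalerDr !scalerA mulrC addrACA.
- move=> i j n j' n' hj hn h h' a x; rewrite (sa _ _ _ _ _ hj hn h h') (ta _ _ _ _ _ hj hn h h').
  by rewrite linearP scalerDr !scalerA mulrC.
- move=> i j l hl hj x /=; rewrite (sd i j l hl hj) (td i j l hl hj) linearP.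
  by rewrite scalerDr addrACA.
Qed.

(** Null-homotopic maps form an ideal, on the left here and on the right in
    [null_compr]. *)
Lemma null_compl L M N (g : dghom M N) (f : dghom L M) :
  null_homotopic f -> null_homotopic (comp_hom g f).
Proof.
move=> [s [sl sa sd]]; exists (fun i j h x => g j (s i j h x)); split.
- by move=> i j h c x y; rewrite sl linearP.
- by move=> i j n j' n' hj hn h h' a x; rewrite (sa _ _ _ _ _ hj hn h h') linearZ /= hom_act.
- by move=> i j l hl hj x /=; rewrite (sd i j l hl hj) linearD /= hom_diff.
Qed.

Lemma null_compr L M N (g : dghom M N) (f : dghom L M) :
  null_homotopic g -> null_homotopic (comp_hom g f).
Proof.
move=> [s [sl sa sd]]; exists (fun i j h x => s i j h (f i x)); split.
- by move=> i j h c x y; rewrite linearP sl.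
- by move=> i j n j' n' hj hn h h' a x; rewrite hom_act (sa _ _ _ _ _ hj hn h h').
- by move=> i j l hl hj x /=; rewrite (sd i j l hl hj) hom_diff.
Qed.

Lemma null_homotopic_homotopic M N (f g : dghom M N) :
  homotopic f g -> null_homotopic g -> null_homotopic f.
Proof.
move=> fg ng; apply: null_homotopic_eq (null_lincomb 1 fg ng) => i x /=.
by rewrite scale1r scaleN1r addrAC addNr add0r.
Qed.

Lemma homotopic_sym M N (f g : dghom M N) : homotopic f g -> homotopic g f.
Proof.
move=> fg; apply: null_homotopic_eq (null_lincomb (-1) fg (null_zero M N)) => i x /=.
by rewrite addr0 scalerDr scalerA mulrNN mul1r scale1r addrC.
Qed.

Lemma null_homotopic_cocycle M N (f : dghom M N) : null_homotopic f ->
  forall n (z : M n), cocycle z -> boundary (f n z).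
Proof.
move=> [s [sl sa sd]] n z cz; have h : n - 1 + 1 = n by rewrite subrK.
rewrite (sd n (n - 1) (n + 1) erefl h) (cocycle_diff cz) (linear_fun0 (sl _ _ _)) addr0.
exact: boundary_diff.
Qed.

Lemma null_id_acyclic M : null_homotopic (id_hom M) -> acyclic M.
Proof. by move=> nid n; apply/H_vanishP => z /(null_homotopic_cocycle nid). Qed.

Lemma hom_cocycle M N (f : dghom M N) n (z : M n) : cocycle z -> cocycle (f n z).
Proof. by rewrite /cocycle -hom_diff => ->; rewrite linear0. Qed.

Lemma hom_boundary M N (f : dghom M N) n (z : M n) : boundary z -> boundary (f n z).
Proof. by move=> [m [h [y <-]]]; rewrite hom_diff; exact: boundary_diff. Qed.

Lemma quasi_iso_vanish M N (f : dghom M N) n : quasi_iso f ->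
  H_vanish M n <-> H_vanish N n.
Proof.
move=> qf; have [fi fs] := qf n; split=> v z cz; last first.
  by apply: fi => //; apply/v/hom_cocycle.
have [w cw bw] := fs z cz; rewrite -(subrK (f n w) z).
by apply: boundaryD => //; apply/hom_boundary/v.
Qed.

Lemma quasi_iso_nonzero M N (f : dghom M N) n : quasi_iso f ->
  H_nonzero M n <-> H_nonzero N n.
Proof.
move=> qf; rewrite -!H_nonvanishP.
by split=> h /(quasi_iso_vanish n qf).
Qed.

Lemma quasi_iso_id M : quasi_iso (id_hom M).
Proof.
move=> n; split=> // w cw; exists w => //=; rewrite subrr.
exact: boundary0.
Qed.

Lemma quasi_iso_comp L M N (g : dghom M N) (f : dghom L M) :
  quasi_iso f -> quasi_iso g -> quasi_iso (comp_hom g f).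
Proof.
move=> qf qg n; have [fi fs] := qf n; have [gi gs] := qg n; split=> [z cz|w cw].
  move=> /gi b; apply: fi => //; apply: b; exact: hom_cocycle.
have [y cy bwy] := gs w cw; have [x cx byx] := fs y cy; exists x => //=.
rewrite -(subrK (g n y) w) -addrA -linearB.
by apply: boundaryD => //; apply: hom_boundary.
Qed.

Lemma acyclic_Diso_zero M : acyclic M -> Diso M (zero_dgmod R).
Proof.
move=> aM; exists M, (id_hom M), (zero_hom _ _); split; first exact: quasi_iso_id.
move=> n; split=> [z cz _|w cw]; first by apply: (H_vanishP M n).2 => //; exact: aM.
exists 0; first exact: cocycle0.
rewrite [_ - _]thinmx0; exact: boundary0.
Qed.

End Homs.

(** * Mapping cones *)
Section Cones.
Variables (k : fieldType) (R : dgalg k).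
Implicit Types A B F M N L X Y Q : dgmod R.

Lemma eq_of_addN (V : zmodType) (u v : V) : 0 = - u + v -> v = u.
Proof. by move/esym/eqP; rewrite addrC subr_eq0 => /eqP. Qed.

Lemma cone_diffE A B (f : dghom A B) i j (h : i + 1 = j) (x : cone_dgmod f i) :
  diff h x = (- diff (shift_eq1 1 h) x.1, recast h (f (i + 1) x.1) + diff h x.2).
Proof. by case: j / h => /=; rewrite (eq_irrelevance (shift_eq1 1 _) erefl). Qed.

Lemma cone_cocycle A B (f : dghom A B) n (x : cone_dgmod f n) :
  cocycle x -> cocycle x.1 /\ f (n + 1) x.1 + diff erefl x.2 = 0.
Proof. by move=> [/eqP]; rewrite oppr_eq0 => /eqP. Qed.

(** The part of the long exact sequence of a cone that is needed: [H^n] of the cone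
    sits between the cokernel of [H^n(f)] and the kernel of [H^(n+1)(f)]. *)
Lemma cone_vanish A B (f : dghom A B) n :
  (forall z : A (n + 1), cocycle z -> boundary (f _ z) -> boundary z) ->
  (forall w : B n, cocycle w -> exists2 z : A n, cocycle z & boundary (w - f _ z)) ->
  H_vanish (cone_dgmod f) n.
Proof.
have [m h] : exists m, m + 1 = n by exists (n - 1); rewrite subrK.
case: n / h => inj surj [a b] /cone_cocycle [/= ca fab].
have /boundaryE /(_ _ erefl) [a' da'] : boundary a.
  apply: inj => //; have -> : f _ a = - diff erefl b by apply/eqP; rewrite -addr_eq0; apply/eqP.
  exact/boundaryN/boundary_diff.
have [|z cz /boundaryE /(_ _ erefl) [y dy]] := surj (b + f _ a').
  by rewrite /cocycle linearD /= -hom_diff da' [LHS]addrC; exact: fab.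
exists m, erefl, (z - a', y); rewrite cone_diffE /=.
rewrite (eq_irrelevance (shift_eq1 1 _) erefl) linearB /= cz da' sub0r opprK.
by congr (_, _); rewrite dy linearB /= [LHS]addrC addrA subrK addrK.
Qed.

Definition cone_in A B (f : dghom A B) : dghom B (cone_dgmod f).
Proof.
refine (@DGHom k R B (cone_dgmod f) (fun _ y => (0, y)) _ _ _).
- by move=> i c x y; congr (_, _); rewrite /= scaler0 addr0.
- by move=> i j h m; rewrite cone_diffE /= !linear0 ?oppr0 add0r.
- by move=> i j n h a m; congr (_, _); rewrite /= linear0 scaler0.
Defined.

(** The components of a null-homotopy of [F -> Q -> cone p] are a homomorphism
    [f : F -> X] and a homotopy from [p f] to [g]: the cone is built so that [g] lifts
    up to homotopy if it dies in the cone. *)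
Lemma lift_of_null F X Q (p : dghom X Q) (g : dghom F Q) :
  null_homotopic (comp_hom (cone_in p) g) ->
  exists f : dghom F X, homotopic (comp_hom p f) g.
Proof.
move=> [s [sl sa sd]].
(* The value at [i] of the homotopy lies in degree [i - 1 + 1] of [X]. *)
pose f i (x : F i) : X i := recast (subrK 1 i) (s i (i - 1) (subrK 1 i) x).1.
have fE i j (h : j + 1 = i) x : f i x = recast h (s i j h x).1.
  rewrite /f; have e : j = i - 1 by rewrite -h addrK.
  by case: _ / (esym e) h => h; rewrite (eq_irrelevance h (subrK 1 i)).
have s1 i j h c x y : (s i j h (c *: x + y)).1 = c *: (s i j h x).1 + (s i j h y).1.
  by rewrite sl.
have s2 i j h c x y : (s i j h (c *: x + y)).2 = c *: (s i j h x).2 + (s i j h y).2.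
  by rewrite sl.
have fl i : linear (f i).
  by move=> c x y; rewrite /f s1 linearP.
have fd i j (h : i + 1 = j) x : f j (diff h x) = diff h (f i x).
  have h' := subrK 1 i.
  rewrite (fE j i h) (fE i (i - 1) h').
  have := sd i (i - 1) j h h' x; rewrite cone_diffE => /(congr1 fst) /= /eq_of_addN ->.
  have e : i - 1 + 1 + 1 = j by rewrite h'.
  by rewrite (recast_diff _ _ e) (diff_recast _ _ e).
have fa i j n (h : i + j = n) a x : f n (act h a x) = act h a (f j x).
  have h' : i + (j - 1) = n - 1 by rewrite addrA h.
  rewrite /f (sa i j n (j - 1) (n - 1) (subrK 1 j) (subrK 1 n) h h') /=.
  have e : i + (j - 1 + 1) = n by rewrite subrK.
  by rewrite scalerA sgn_sq scale1r (recast_act _ _ e) (act_recast _ _ e).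
exists (DGHom fl fd fa).
apply: homotopic_sym; exists (fun i j h x => (s i j h x).2); split.
- by move=> i j h c x y; rewrite s2.
- by move=> i j n j' n' hj hn h h' a x; rewrite (sa _ _ _ _ _ hj hn h h').
- move=> i j l hl hj x; rewrite sub_homE /=.
  have := sd i j l hl hj x; rewrite cone_diffE => /(congr1 snd) /= ->.
  rewrite (fE i j hj) (hom_recast p).
  by rewrite [LHS]addrC -!addrA addKr.
Qed.

(** The companion of [lift_of_null] one step to the left in the triangle: a
    null-homotopy of [q f] and [f] itself are the two components of a homomorphism
    from the suspension of [F] to the cone, and a null-homotopy of that one contains
    a null-homotopy of [f]. *)
Lemma null_of_null_shift F X Y (q : dghom X Y) (f : dghom F X) :
  null_homotopic (comp_hom q f) ->
  (forall u : dghom (shift_dgmod 1 F) (cone_dgmod q), null_homotopic u) ->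
  null_homotopic f.
Proof.
move=> [s [sl sa sd]] nu.
pose u n (x : shift_dgmod 1 F n) : cone_dgmod q n :=
  (f (n + 1) x, - s (n + 1) n erefl x).
have ul n : linear (u n).
  by move=> c x y; congr (_, _); [rewrite linearP | rewrite /= sl opprD scalerN].
have ud i j (h : i + 1 = j) x : u j (diff h x) = diff h (u i x).
  case: j / h; rewrite cone_diffE /u /= sgn1 !scaleN1r !linearN /= hom_diff.
  congr (_, _).
  rewrite (eq_irrelevance (shift_eq1 1 _) erefl); have /= -> := sd (i + 1) i _ erefl erefl x.
  by rewrite (linear_funN (sl _ _ _)) opprK [RHS]addrAC subrr add0r.
have ua i j n (h : i + j = n) a x : u n (act h a x) = act h a (u j x).
  rewrite /u /= !mulr1 linearZ /= hom_act (linear_funZ (sl _ _ _)).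
  rewrite (sa i (j + 1) (n + 1) j n erefl erefl (shift_eqD 1 h) h).
  by rewrite scalerA sgn_sq scale1r /cone_act /= linearN.
have [t [tl ta td]] := nu (DGHom ul ud ua).
have t1 i j h : linear (fun x => (t i j h x).1) by move=> c x y; rewrite tl.
have tE i j (h : j + 1 = i) y :
    recast (subrK 1 i) (t i (i - 1) (subrK 1 i) y).1 = recast h (t i j h y).1.
  have e : j = i - 1 by rewrite -h addrK.
  by case: _ / (esym e) h => h; rewrite (eq_irrelevance h (subrK 1 i)).
exists (fun i j h x =>
  - recast (subrK 1 j) (t j (j - 1) (subrK 1 j) (@recast k F _ _ (esym h) x)).1); split.
- by move=> i j h c x y; rewrite !linearP t1 linearP opprD scalerN.
- move=> i j n j' n' hj hn h h' a x.
  case: j / hj h x => h x; case: n / hn h => h; rewrite !recast_id.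
  have h'' : i + (j' - 1) = n' - 1 by rewrite addrA h'.
  have := ta i j' n' (j' - 1) (n' - 1) (subrK 1 j') (subrK 1 n') h' h'' a x.
  rewrite /= mulr1 (eq_irrelevance (shift_eqD 1 h') h).
  move=> /(congr1 fst) /= /(congr1 (GRing.scale (sgn k i))).
  rewrite -(linear_funZ (t1 _ _ _)) !scalerA sgn_sq !scale1r => ->.
  rewrite linearZ /= linearN /= scalerN mul1r; congr (- (_ *: _)).
  have e : i + (j' - 1 + 1) = n' by rewrite subrK.
  by rewrite /= (recast_act _ _ e) (act_recast _ _ e).
- move=> i j l hl hj x.
  case: i / hj x hl => x hl; case: l / hl; rewrite !recast_id.
  have := td j (j - 1) (j + 1) erefl (subrK 1 j) x.
  rewrite cone_diffE => /(congr1 fst) /= ->.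
  rewrite (tE _ j erefl) sgn1 scaleN1r (linear_funN (t1 _ _ _)) linearN /=.
  rewrite (eq_irrelevance (shift_eq1 1 erefl) erefl).
  by rewrite (diff_recast _ _ (shift_eq1 1 (subrK 1 j))).
Qed.

End Cones.

(** * Identities in abelian groups *)
Lemma addrDK (V : zmodType) (a b c : V) : a + (b + c) - b = a + c.
Proof. by rewrite addrCA addrAC subrr add0r. Qed.

Lemma addr_shuffle (V : zmodType) (a b c d e : V) :
  a + b + c + (d + e) = a + d + (b + (c + e)).
Proof. by rewrite -!addrA; congr (a + _); rewrite [RHS]addrCA; congr (b + _); rewrite addrCA. Qed.

(** [cancel_pairs] proves an identity of abelian groups by collecting everything on
    one side and cancelling opposite terms; the identities after it are the ones met
    in the diagram chases. *)
Ltac move_last a := try rewrite [a + _]addrC; repeat (progress rewrite (addrAC _ a)).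
Ltac cancel_pairs :=
  apply/eqP; rewrite -subr_eq0; apply/eqP; rewrite ?(opprD, opprK, oppr0, addr0, add0r) ?addrA;
  repeat match goal with |- ?S = 0 => match S with context [ @Algebra.opp _ ?a ] =>
    move_last a; move_last (- a); rewrite ?addrK ?subrr end end; rewrite ?addr0; reflexivity.

Section ZmodIdentities.
Variable V : zmodType.
Implicit Types a b c d e : V.

Lemma addr_shuffle2 a b c d : a + (b + c) + d - c = a + (d + b).
Proof. cancel_pairs. Qed.

Lemma addrDK2 a b c : a + (b + c) - a - c = b.
Proof. cancel_pairs. Qed.

Lemma addr_chase1 a b c d e (f g : V) :
  a + b - c + (d - e - b) + (c + e - f) - (g - f) = a + d - g.
Proof. cancel_pairs. Qed.

Lemma addr_chase2 a b c : a - b + (c + b - a) = c.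
Proof. cancel_pairs. Qed.

Lemma addr_chase3 a b c : a + (- a - b) + (b + (c + 0)) - c = 0.
Proof. cancel_pairs. Qed.

Lemma addr_chase4 a b c d e : - a + (b + a + c - d - e) = b - (e - c + d).
Proof. cancel_pairs. Qed.

End ZmodIdentities.

(** * Projective dimension of a DG module *)
Section ProjectiveBelow.
Variables (k : fieldType) (R : dgalg k).
Implicit Types A B F M N L X Y Q : dgmod R.

(** For an iterated extension of suspensions of [R] this bounds from above the degrees of
    the generators: [F] sees only cohomology in degrees up to [c]. It refines
    K-projectivity, which is the case of acyclic targets. *)
Definition proj_below (c : int) F : Prop :=
  forall N (f : dghom F N), (forall i, i <= c -> H_vanish N i) -> null_homotopic f.

Lemma proj_below_mono c c' F : c <= c' -> proj_below c F -> proj_below c' F.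
Proof. by move=> cc pF N f vN; apply: pF => i ic; apply: vN; lia. Qed.

Lemma proj_below_Kproj c F : proj_below c F -> K_projective F.
Proof. by move=> pF N f aN; apply: pF => i _; apply/H_vanishP/aN. Qed.

Lemma shift_cocycle s M n (z : M (n + s)) :
  @cocycle k (shift_dgmod s M) n z <-> @cocycle k M (n + s) z.
Proof.
split=> cz; last by rewrite /cocycle /= (cocycle_diff cz) scaler0.
apply: (@diff_cocycle _ _ _ _ (shift_eq1 s erefl)).
by rewrite -[LHS]scale1r -(sgn_sq k s) -scalerA [X in _ *: X]cz scaler0.
Qed.

Lemma shift_boundary s M n (z : M (n + s)) :
  @boundary k (shift_dgmod s M) n z <-> @boundary k M (n + s) z.
Proof.
have h : n - 1 + 1 = n by rewrite subrK.
split=> [/boundaryE /(_ _ h) [y <-]|/boundaryE /(_ _ (shift_eq1 s h)) [y dy]].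
  by rewrite /=; apply: boundaryZ; exact: boundary_diff.
exists (n - 1), h, (sgn k s *: y : M (n - 1 + s)).
by rewrite /= linearZ /= scalerA sgn_sq scale1r.
Qed.

Lemma shift_vanish s M n : H_vanish M (n + s) -> H_vanish (shift_dgmod s M) n.
Proof. by move=> v z /shift_cocycle /v /shift_boundary. Qed.

Definition shift_hom s M N (f : dghom M N) : dghom (shift_dgmod s M) (shift_dgmod s N).
Proof.
refine (@DGHom k R (shift_dgmod s M) (shift_dgmod s N)
          (fun n (x : M (n + s)) => f (n + s) x) _ _ _).
- by move=> n c x y; exact: (hom_linear f).
- by move=> i j h x; rewrite /= linearZ /= hom_diff.
- by move=> i j n h a x; rewrite /= linearZ /= hom_act.
Defined.

Lemma shift_hom_quasi_iso s M N (f : dghom M N) :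
  quasi_iso f -> quasi_iso (shift_hom s f).
Proof.
move=> qf n; have [fi fs] := qf (n + s).
split=> [z /shift_cocycle cz /shift_boundary bz|w /shift_cocycle cw].
  by apply/shift_boundary; exact: fi.
have [z cz bz] := fs w cw; exists z; first exact/shift_cocycle.
exact/shift_boundary.
Qed.

Lemma shift_recast s M i j (e : i = j) (e' : i + s = j + s) (x : shift_dgmod s M i) :
  @recast k (shift_dgmod s M) i j e x = @recast k M _ _ e' x.
Proof. by case: j / e e' => e'; rewrite !recast_id. Qed.

(** Homomorphisms from a suspension of [F] to [N] are homomorphisms from [F] to the
    opposite suspension of [N], up to signs. *)
Lemma shift_null s F N : (forall g : dghom F (shift_dgmod (- s) N), null_homotopic g) ->
  forall f : dghom (shift_dgmod s F) N, null_homotopic f.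
Proof.
move=> nF f.
have e0 n : n = n - s + s by rewrite subrK.
have sN : sgn k (- s) = sgn k s.
  by rewrite -[LHS]mul1r -(sgn_sq k s) -mulrA -sgnD subrr /sgn expr0z mulr1.
have sNM i : sgn k (i * - s) = sgn k (i * s).
  by rewrite -[LHS]mul1r -(sgn_sq k (i * s)) -mulrA -sgnD mulrN subrr /sgn expr0z mulr1.
pose g n (x : F n) : shift_dgmod (- s) N n := f (n - s) (recast (e0 n) x).
have gl n : linear (g n).
  move=> c x y; rewrite /g linearP; exact: (hom_linear f).
have gd i j (h : i + 1 = j) x : g j (diff h x) = diff h (g i x).
  rewrite /g /= -hom_diff /= sN linearZ /= scalerA sgn_sq scale1r; congr (f _ _).
  have e : i + 1 = j - s + s by rewrite -e0.
  by rewrite (recast_diff _ _ e) (diff_recast _ _ e).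
have ga i j n (h : i + j = n) a x : g n (act h a x) = act h a (g j x).
  rewrite /g /= -hom_act /= sNM linearZ /= scalerA sgn_sq scale1r; congr (f _ _).
  have e : i + j = n - s + s by rewrite -e0.
  by rewrite (recast_act _ _ e) (act_recast _ _ e).
have [t [tl ta td]] := nF (DGHom gl gd ga).
have e1 j : j + s - s = j by rewrite addrK.
exists (fun i j h x =>
  sgn k s *: @recast k N _ _ (e1 j) (t (i + s) (j + s) (shift_eq1 s h) x)); split.
- move=> i j h c x y; rewrite tl linearP scalerDr !scalerA; congr (_ + _).
  by rewrite mulrC.
- move=> i j n j' n' hj hn h h' a x.
  rewrite /= (linear_funZ (tl _ _ _)).
  rewrite (ta i (j + s) (n + s) (j' + s) (n' + s) (shift_eq1 s hj) (shift_eq1 s hn)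
    (shift_eqD s h) (shift_eqD s h')) /= sNM.
  rewrite !linearZ /= !scalerA.
  have e : i + (j' + s - s) = n' by rewrite e1.
  rewrite (recast_act _ _ e) (act_recast _ _ e); congr (_ *: _).
  transitivity (sgn k (i * s) * sgn k (i * s) * (sgn k i * sgn k s)); first by ring.
  by rewrite sgn_sq; ring.
- move=> i j l hl hj x.
  have := td (i + s) (j + s) (l + s) (shift_eq1 s hl) (shift_eq1 s hj) x.
  move=> /(congr1 (@recast k N _ _ (e1 i))) /=.
  have -> : g (i + s) x = @recast k N _ _ (esym (e1 i)) (f i x).
    by rewrite -hom_recast /g (shift_recast _ (e0 (i + s))).
  rewrite recastK linearD /= sN => ->.
  rewrite linearZ /= (recast_diff _ _ (etrans (congr1 (+%R^~ 1) (e1 j)) hj)).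
  congr (_ + _).
    by rewrite [RHS]linearZ /= (diff_recast _ _ (etrans (congr1 (+%R^~ 1) (e1 j)) hj)).
  by rewrite (linear_funZ (tl _ _ _)) linearZ /= scalerA sgn_sq scale1r.
Qed.

Lemma proj_below_shift c s F : proj_below c F -> proj_below (c - s) (shift_dgmod s F).
Proof.
move=> pF N f vN; apply: shift_null => g; apply: pF => i ic.
by apply: shift_vanish; apply: vN; lia.
Qed.

Lemma quasi_iso_cone_acyclic X Y (q : dghom X Y) :
  quasi_iso q -> forall n, H_vanish (cone_dgmod q) n.
Proof. by move=> qq n; apply: cone_vanish; [exact: (qq _).1 | exact: (qq n).2]. Qed.

Lemma lift_quasi_iso F X Q (p : dghom X Q) (g : dghom F Q) :
  K_projective F -> quasi_iso p -> exists f : dghom F X, homotopic (comp_hom p f) g.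
Proof.
move=> KF qp; apply: lift_of_null; apply: KF => n.
by apply/H_vanishP; exact: quasi_iso_cone_acyclic.
Qed.

Lemma null_of_quasi_iso F X Y (q : dghom X Y) (f : dghom F X) :
  K_projective F -> quasi_iso q -> null_homotopic (comp_hom q f) -> null_homotopic f.
Proof.
move=> KF qq nqf; apply: null_of_null_shift nqf _.
apply: shift_null => g; apply: KF => n; apply/H_vanishP.
by apply: shift_vanish; exact: quasi_iso_cone_acyclic.
Qed.

Lemma quasi_iso_homotopic X Y (f g : dghom X Y) :
  homotopic f g -> quasi_iso f -> quasi_iso g.
Proof.
move=> fg qf n; have [fi fs] := qf n.
have fgb z : cocycle z -> boundary (f n z - g n z).
  by move=> cz; rewrite -sub_homE; apply: null_homotopic_cocycle.
split=> [z cz bz|w cw].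
  by apply: fi => //; rewrite -(subrK (g n z) (f n z)); apply: boundaryD => //; exact: fgb.
have [z cz bz] := fs w cw; exists z => //.
by rewrite -(subrK (f n z) w) -addrA; apply: boundaryD => //; exact: fgb.
Qed.

Lemma quasi_iso_cancel X Y Z (q : dghom Y Z) (f : dghom X Y) :
  quasi_iso q -> quasi_iso (comp_hom q f) -> quasi_iso f.
Proof.
move=> qq qf n; have [qi qs] := qq n; have [fi fs] := qf n; split=> [z cz bz|w cw].
  by apply: fi => //=; exact: hom_boundary.
have [z cz bz] := fs _ (hom_cocycle q cw); exists z => //; apply: qi; last by rewrite linearB.
by apply: cocycleB => //; exact: hom_cocycle.
Qed.

Lemma resolution_lift F X Y (p : dghom X Y) (g : dghom F Y) :
  K_projective F -> quasi_iso p -> quasi_iso g -> exists f : dghom F X, quasi_iso f.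
Proof.
move=> KF qp qg; have [f pf] := lift_quasi_iso g KF qp; exists f.
by apply: (quasi_iso_cancel qp); apply: quasi_iso_homotopic qg; exact: homotopic_sym.
Qed.

(** Two K-projective resolutions of [M] are homotopy equivalent, so that they receive
    the same bound. *)
Lemma proj_below_transfer c F F' M (q : dghom F M) (q' : dghom F' M) :
  K_projective F -> quasi_iso q -> proj_below c F' -> quasi_iso q' -> proj_below c F.
Proof.
move=> KF qq pF' qq' N f vN.
have [g q'g] := lift_quasi_iso q KF qq'.
have [h qh] := lift_quasi_iso q' (proj_below_Kproj pF') qq.
have hg : homotopic (comp_hom h g) (id_hom F).
  apply: null_of_quasi_iso KF qq _; have n1 := null_compr g qh.
  apply: null_homotopic_eq (null_lincomb 1 n1 q'g) => i x /=.
  by rewrite !scaleN1r scale1r linearD linearN /= [LHS]addrC addrA addrK.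
have nfh : null_homotopic (comp_hom f h) by exact: pF'.
have n1 := null_compr g nfh; have n2 := null_compl f hg.
apply: null_homotopic_eq (null_lincomb (-1) n2 n1) => i x /=.
by rewrite linearD /= linearZ /= !scaleN1r opprD opprK subrK.
Qed.

(** A homomorphism out of the cone is made to vanish on [B] by a homotopy; what remains
    is a homomorphism from the suspension of [A]. *)
Lemma proj_below_cone c A B (f : dghom A B) :
  proj_below (c + 1) A -> proj_below c B -> proj_below c (cone_dgmod f).
Proof.
move=> pA pB N h vN.
have [s [sl sa sd]] : null_homotopic (comp_hom h (cone_in f)) by exact: pB.
pose v n (x : shift_dgmod 1 A n) : N n :=
  h n (x, 0) - s (n + 1) n erefl (f (n + 1) x).
have vl n : linear (v n).
  move=> c' x y; rewrite /v.
  have -> : ((c' *: x + y, 0) : cone_dgmod f n) = c' *: (x, 0) + (y, 0).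
    by congr (_, _); rewrite /= scaler0 addr0.
  rewrite (hom_linear h) (hom_linear f) sl scalerBr opprD addrACA.
  by [].
have hE n (x : A (n + 1)) (y : B n) : h n (x, y) = h n (x, 0) + h n (0, y).
  have -> : ((x, y) : cone_dgmod f n) = 1 *: (x, 0) + (0, y).
    by congr (_, _); rewrite /= scale1r ?addr0 ?add0r.
  by rewrite (hom_linear h) scale1r.
have vd i j (e : i + 1 = j) x : v j (diff e x) = diff e (v i x).
  case: j / e; rewrite /v linearB /= -(hom_diff h) cone_diffE /= linear0 addr0.
  rewrite hE /= (_ : h _ (0, f _ x) = comp_hom h (cone_in f) _ (f _ x)) //.
  rewrite (sd (i + 1) i _ erefl erefl) sgn1 scaleN1r linearN /= hom_diff.
  rewrite (linear_funN (sl _ _ _)) opprK (eq_irrelevance (shift_eq1 1 _) erefl).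
  by rewrite addrDK.
have va i j n (e : i + j = n) a x : v n (act e a x) = act e a (v j x).
  rewrite /v linearB /= -(hom_act h) mulr1; congr (h _ _ - _).
    by congr (_, _); rewrite /= linear0.
  rewrite (linear_funZ (@hom_linear _ _ _ _ f _)) hom_act (linear_funZ (sl _ _ _)).
  rewrite (sa i (j + 1) (n + 1) j n erefl erefl (shift_eqD 1 e) e).
  by rewrite scalerA sgn_sq scale1r.
have [t [tl ta td]] : null_homotopic (DGHom vl vd va).
  by have := @proj_below_shift _ 1 _ pA; rewrite addrK => pA1; exact: pA1.
exists (fun i j e p => t i j e p.1 + s i j e p.2); split.
- by move=> i j e c' x y; rewrite /= tl sl scalerDr addrACA.
- move=> i j n j' n' hj hn e e' a p.
  have := ta _ _ _ _ _ hj hn e e' a p.1; rewrite /= mulr1 => ->.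
  by rewrite (sa _ _ _ _ _ hj hn e e') linearD scalerDr.
- move=> i j l hl hj [x y]; case: l / hl.
  rewrite cone_diffE /= hE (_ : h _ (0, y) = comp_hom h (cone_in f) _ y) //.
  rewrite (sd i j _ erefl hj) -(subrK (s (i + 1) i erefl (f (i + 1) x)) (h _ (x, 0))).
  have /= := td i j _ erefl hj x; rewrite /v => ->.
  rewrite sgn1 scaleN1r linearD /= (linear_funD (sl _ _ _)).
  exact: addr_shuffle.
Qed.

(** A square that commutes up to a homotopy [s] induces a map of cones, which has [s]
    as its off-diagonal entry, and the five lemma shows that it is a quasi-isomorphism
    if the vertical maps are. *)
Lemma cone_map A A' B B' (f : dghom A B) (f' : dghom A' B') (qA : dghom A' A)
    (qB : dghom B' B) : quasi_iso qA -> quasi_iso qB ->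
  homotopic (comp_hom qB f') (comp_hom f qA) ->
  exists m : dghom (cone_dgmod f') (cone_dgmod f), quasi_iso m.
Proof.
move=> qqA qqB [s [sl sa sd]].
pose m n (p : cone_dgmod f' n) : cone_dgmod f n :=
  (qA (n + 1) p.1, qB n p.2 + s (n + 1) n erefl p.1).
have ml n : linear (m n).
  by move=> c x y; congr (_, _); rewrite /= ?linearP // sl scalerDr addrACA.
have sE i (x : A' (i + 1)) :
    qB (i + 1) (f' (i + 1) x) =
    f (i + 1) (qA (i + 1) x) + (diff erefl (s (i + 1) i erefl x) +
    s (i + 1 + 1) (i + 1) erefl (diff erefl x)).
  by rewrite -(sd (i + 1) i _ erefl erefl) sub_homE /= [RHS]addrC subrK.
have md i j (e : i + 1 = j) p : m j (diff e p) = diff e (m i p).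
  case: j / e; case: p => x y; rewrite !cone_diffE /m /=.
  rewrite !(eq_irrelevance (shift_eq1 1 _) erefl) !linearN /= hom_diff.
  congr (_, _); rewrite (linear_funN (sl _ _ _)) !linearD /= !hom_diff.
  rewrite sE; exact: addr_shuffle2.
have ma i j n (e : i + j = n) a p : m n (act e a p) = act e a (m j p).
  case: p => x y; rewrite /m /= /cone_act /=; congr (_, _).
    by rewrite linearZ /= hom_act.
  rewrite linearD /= hom_act (linear_funZ (sl _ _ _)).
  rewrite (sa i (j + 1) (n + 1) j n erefl erefl (shift_eqD 1 e) e).
  by rewrite scalerA sgn_sq scale1r.
exists (DGHom ml md ma) => n.
have [l e] : exists l, l + 1 = n by exists (n - 1); rewrite subrK.
case: n / e; split.
  move=> [x y] /cone_cocycle [/= cx fxy] /boundaryE /(_ _ erefl) [[al be]].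
  rewrite cone_diffE (eq_irrelevance (shift_eq1 1 _) erefl) => -[/= qx qy].
  have /boundaryE /(_ _ erefl) [x' dx'] : boundary x.
    by apply: (qqA _).1 => //; rewrite -qx -linearN; exact: boundary_diff.
  have [|z0 cz0 /boundaryE /(_ _ erefl) [ga dga]] := (qqA _).2 (al + qA _ x').
    by rewrite /cocycle linearD /= -hom_diff dx' -qx addrN.
  have bqy : boundary (qB _ (y + f' _ x' - f' _ z0)).
    have b1 : boundary (qB _ y + s _ _ erefl x - f _ al).
      by rewrite -qy addrAC subrr add0r; exact: boundary_diff.
    have b2 : boundary (qB _ (f' _ x') - f _ (qA _ x') - s _ _ erefl x).
      by rewrite sE dx' addrDK2; exact: boundary_diff.
    have b3 : boundary (f _ al + f _ (qA _ x') - f _ (qA _ z0)).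
      by rewrite -linearD -linearB /= -dga hom_diff; exact: boundary_diff.
    have b4 : boundary (qB _ (f' _ z0) - f _ (qA _ z0)).
      rewrite sE cz0 (linear_fun0 (sl _ _ _)) addr0 addrAC subrr add0r.
      exact: boundary_diff.
    rewrite linearB linearD /=.
    have := boundaryB (boundaryD (boundaryD b1 b2) b3) b4.
    congr boundary; exact: addr_chase1.
  have /boundaryE /(_ _ erefl) [be' dbe'] : boundary (y + f' _ x' - f' _ z0).
    apply: (qqB _).1 => //; rewrite /cocycle linearB linearD /= -!hom_diff.
    by rewrite dx' cz0 linear0 subr0 [LHS]addrC.
  exists l, erefl, (z0 - x', be'); rewrite cone_diffE /=.
  rewrite (eq_irrelevance (shift_eq1 1 _) erefl); congr (_, _).
    by rewrite linearB /= cz0 sub0r opprK.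
  by rewrite dbe' linearB /=; exact: addr_chase2.
move=> [a b] /cone_cocycle [/= ca fab].
have [x cx /boundaryE /(_ _ erefl) [a' da']] := (qqA _).2 a ca.
have bfx : boundary (f' _ x).
  apply: (qqB _).1; first exact: hom_cocycle.
  rewrite sE cx (linear_fun0 (sl _ _ _)) addr0; apply: boundaryD; last exact: boundary_diff.
  have -> : qA _ x = a - diff erefl a' by rewrite da' opprB [RHS]addrC subrK.
  have fa : f _ a = - diff erefl b by apply/eqP; rewrite -addr_eq0; apply/eqP.
  rewrite linearB /= hom_diff fa.
  by apply: boundaryB; [apply: boundaryN|]; exact: boundary_diff.
have [y0 dy0] := boundaryE bfx erefl.
have [|y1 cy1 /boundaryE /(_ _ erefl) [be dbe]] :=
  (qqB _).2 (b + f _ a' + qB _ y0 - s _ _ erefl x).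
- have fa : f _ a = - diff erefl b by apply/eqP; rewrite -addr_eq0; apply/eqP.
  rewrite /cocycle linearB !linearD /= -!hom_diff da' dy0 linearB /= sE fa.
  rewrite cx (linear_fun0 (sl _ _ _)). exact: addr_chase3.
- exists (x, y1 - y0).
    rewrite /cocycle cone_diffE /= (eq_irrelevance (shift_eq1 1 _) erefl) cx oppr0.
    by rewrite linearB /= cy1 dy0 sub0r addrN.
  exists l, erefl, (- a', be); rewrite cone_diffE /=.
  rewrite (eq_irrelevance (shift_eq1 1 _) erefl) linearN /= opprK da'.
  by congr (_, _); rewrite dbe !linearN /= !linearB /=; exact: addr_chase4.
Qed.
End ProjectiveBelow.

(** * Countable direct sums *)
Section DirectSums.
Variables (k : fieldType) (R : dgalg k) (G : dgmod R).

Section Degree.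
Variable n : int.

Definition finitely_supported (x : nat -> G n) : Prop :=
  exists b : nat, forall m, (b <= m)%N -> x m = 0.

Lemma finitely_supported0 : finitely_supported 0.
Proof. by exists 0%N. Qed.

Lemma finitely_supportedP c x y : finitely_supported x -> finitely_supported y ->
  finitely_supported (c *: x + y).
Proof.
move=> [b xb] [b' yb']; exists (maxn b b') => m; rewrite geq_max => /andP[bm bm'].
by rewrite -[LHS]/(c *: x m + y m) xb // yb' // scaler0 addr0.
Qed.

Definition finite_families := Subspace finitely_supported0 finitely_supportedP.

End Degree.

Definition dsum_gr n : lmodType k := sub_lmod (finite_families n).

Definition component n (m : nat) (x : dsum_gr n) : G n := sub_val x m.

Lemma component_linear n m : linear (@component n m).
Proof. by move=> c x y; rewrite /component sub_val_linear. Qed.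

HB.instance Definition _ n m :=
  GRing.isLinear.Build k (dsum_gr n) (G n) *:%R (@component n m) (@component_linear n m).

Lemma component_ext n (x y : dsum_gr n) : (forall m, component m x = component m y) -> x = y.
Proof. by move=> e; apply: sub_val_inj; apply: funext => m; exact: e. Qed.

Lemma component_supp n (x : dsum_gr n) : exists b : nat, forall m, (b <= m)%N -> component m x = 0.
Proof. exact: sub_valP x. Qed.

Definition dsum_of n (x : nat -> G n) (fx : finitely_supported x) : dsum_gr n :=
  @to_sub k (nat -> G n) (finite_families n) x fx.

Lemma component_dsum_of n x (fx : @finitely_supported n x) m : component m (dsum_of fx) = x m.
Proof. by []. Qed.

Lemma finitely_supported_map i j (f : G i -> G j) (x : dsum_gr i) :
  f 0 = 0 -> finitely_supported (fun m => f (component m x)).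
Proof. by move=> f0; have [b xb] := component_supp x; exists b => m bm; rewrite xb. Qed.

Definition dsum_diff i j (h : i + 1 = j) (x : dsum_gr i) : dsum_gr j :=
  dsum_of (finitely_supported_map x (linear0 (diff h))).

Definition dsum_complex : complex k.
Proof.
refine (@Complex k dsum_gr dsum_diff _ _).
- by move=> i j h c x y; apply: component_ext => m; rewrite linearP /= ?component_dsum_of !linearP.
- move=> i j l h h' x; apply: component_ext => m.
  by rewrite [RHS]linear0; exact: diff_diff.
Defined.

Definition dsum_act i j n (h : i + j = n) (a : R i) (x : dsum_gr j) : dsum_gr n :=
  dsum_of (finitely_supported_map x (linear0 (act h a))).

Definition dsum_dgmod : dgmod R.
Proof.
refine (@DGMod k R dsum_complex dsum_act _ _ _ _ _).
- move=> i j n h x c a b; apply: component_ext => m.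
  by rewrite linearP /= ?component_dsum_of act_linearl.
- by move=> i j n h a c x y; apply: component_ext => m; rewrite linearP /= ?component_dsum_of !linearP.
- move=> i j l ij jl n h1 h2 h3 h4 a b x; apply: component_ext => m.
  by rewrite !component_dsum_of; exact: act_assoc.
- by move=> i h x; apply: component_ext => m; exact: act_1.
- move=> i j n i' j' n' hi hj hn h h1 h2 a x; apply: component_ext => m.
  rewrite linearD linearZ /= ?component_dsum_of; exact: act_leibniz.
Defined.

Fact inj_supp n (m : nat) (x : G n) :
  finitely_supported (fun l => if l == m then x else 0).
Proof. by exists m.+1 => l ml; rewrite gtn_eqF. Qed.

Definition dsum_inj (m : nat) : dghom G dsum_dgmod.
Proof.
refine (@DGHom k R G dsum_dgmod (fun n x => dsum_of (inj_supp m x)) _ _ _).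
- move=> n c x y; apply: component_ext => l; rewrite linearP /= ?component_dsum_of.
  by case: eqP; rewrite // scaler0 addr0.
- by move=> i j h x; apply: component_ext => l; rewrite !component_dsum_of /=; case: eqP; rewrite ?linear0.
- by move=> i j n h a x; apply: component_ext => l; rewrite !component_dsum_of /=; case: eqP; rewrite ?linear0.
Defined.

Lemma dsum_decompose n (x : dsum_dgmod n) b : (forall m, (b <= m)%N -> component m x = 0) ->
  x = \sum_(m < b) dsum_inj m n (component m x).
Proof.
move=> xb; apply: component_ext => l; rewrite linear_sum /=.
have [bl|lb] := leqP b l.
  by rewrite xb // big1 // => m _; rewrite gtn_eqF // (leq_trans _ bl).
rewrite (bigD1 (Ordinal lb)) //= eqxx big1 ?addr0 // => m /eqP ml.
by case: eqP => // lm; case: ml; apply: val_inj.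
Qed.

(** Primitives are chosen in all components, with value zero wherever the component is
    zero, to keep the support finite. *)
Lemma dsum_boundary n (x : dsum_dgmod n) : (forall m, boundary (component m x)) -> boundary x.
Proof.
move=> bx; have h : n - 1 + 1 = n by rewrite subrK.
have /choice [y yE] m : exists y : G (n - 1),
    diff h y = component m x /\ (component m x = 0 -> y = 0).
  have [x0|x0] := pselect (component m x = 0).
    by exists 0; rewrite linear0 x0.
  by have [y dy] := boundaryE (bx m) h; exists y; split.
have fy : finitely_supported y.
  by have [b xb] := component_supp x; exists b => m bm; apply: (yE m).2; exact: xb.
exists (n - 1), h, (dsum_of fy); apply: component_ext => m.
exact: (yE m).1.
Qed.

Lemma dsum_cocycle n (x : dsum_dgmod n) : cocycle x <-> forall m, cocycle (component m x).
Proof.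
split=> [cx m|cx]; last by apply: component_ext => m; rewrite component_dsum_of linear0; exact: cx.
by rewrite /cocycle -[LHS]/(component m (diff erefl x)) cx linear0.
Qed.

End DirectSums.
Arguments component {k R G n} m x.

Section DirectSumMaps.
Variables (k : fieldType) (R : dgalg k).
Implicit Types F G M N : dgmod R.

Fact dsum_map_supp F G (f : dghom F G) n (x : dsum_gr F n) :
  finitely_supported (fun m => f n (component m x)).
Proof. by have [b xb] := component_supp x; exists b => m bm; rewrite xb ?linear0. Qed.

Definition dsum_map F G (f : dghom F G) : dghom (dsum_dgmod F) (dsum_dgmod G).
Proof.
refine (@DGHom k R (dsum_dgmod F) (dsum_dgmod G)
          (fun n x => dsum_of (dsum_map_supp f x)) _ _ _).
- by move=> n c x y; apply: component_ext => m; rewrite linearP /= ?component_dsum_of !linearP.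
- by move=> i j h x; apply: component_ext => m; exact: hom_diff.
- by move=> i j n h a x; apply: component_ext => m; exact: hom_act.
Defined.

Lemma dsum_map_quasi_iso F G (f : dghom F G) : quasi_iso f -> quasi_iso (dsum_map f).
Proof.
move=> qf n; have [fi fs] := qf n; split=> [z /dsum_cocycle cz bz|w /dsum_cocycle cw].
  apply: dsum_boundary => m; apply: fi; first exact: cz.
  have h : n - 1 + 1 = n by rewrite subrK.
  have [y dy] := boundaryE bz h; exists (n - 1), h, (component m y).
  exact: (congr1 (component m) dy).
have /choice [z zE] m : exists z : F n,
    [/\ cocycle z, boundary (component m w - f n z) & component m w = 0 -> z = 0].
  have [w0|w0] := pselect (component m w = 0).
    exists 0; split=> //; first exact: cocycle0.
    by rewrite w0 linear0 subr0; exact: boundary0.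
  by have [z cz bz] := fs _ (cw m); exists z.
have fz : finitely_supported z.
  have [b wb] := component_supp w; exists b => m bm; case: (zE m) => _ _; apply; exact: wb.
exists (dsum_of fz); first by apply/dsum_cocycle => m; case: (zE m).
by apply: dsum_boundary => m; rewrite linearB; case: (zE m).
Qed.

(** The null-homotopies on the summands, chosen independently, add up; the sum has
    finitely many terms on each element. *)
Lemma proj_below_dsum c F : proj_below c F -> proj_below c (dsum_dgmod F).
Proof.
move=> pF N f vN.
have /choice [s sE] (m : nat) : exists s : forall i j : int, j + 1 = i -> F i -> N j,
   [/\ forall i j (h : j + 1 = i), linear (s i j h),
       forall i j n j' n' (hj : j' + 1 = j) (hn : n' + 1 = n)
          (h : i + j = n) (h' : i + j' = n') (a : R i) (x : F j),
          s n n' hn (act h a x) = sgn k i *: act h' a (s j j' hj x)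
     & forall i j l (hl : i + 1 = l) (hj : j + 1 = i) (x : F i),
         f i (dsum_inj F m i x) = diff hj (s i j hj x) + s l i hl (diff hl x)].
  by have [s [? ? ?]] := pF N (comp_hom f (dsum_inj F m)) vN; exists s; split.
have s0 m i j h : s m i j h 0 = 0 by case: (sE m) => sl _ _; exact: linear_fun0 (sl _ _ _).
pose bd i (x : dsum_dgmod F i) : nat := projT1 (cid (component_supp x)).
pose S i j (h : j + 1 = i) (x : dsum_dgmod F i) : N j :=
  \sum_(m < bd i x) s m i j h (component m x).
(* The number of terms of the sum depends on the chosen bound of the support; the value
   does not. *)
have bigE (V : zmodType) (u : nat -> V) b b' : (forall m, (b <= m)%N -> u m = 0) ->
    (b <= b')%N -> \sum_(m < b') u m = \sum_(m < b) u m.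
  move=> u0 bb'; rewrite [RHS](big_ord_widen _ u bb') [RHS]big_mkcond /=.
  by apply: eq_bigr => m _; case: ltnP => // /u0.
have SE i j (h : j + 1 = i) (x : dsum_dgmod F i) b :
    (forall m, (b <= m)%N -> component m x = 0) ->
    S i j h x = \sum_(m < b) s m i j h (component m x).
  move=> xb; rewrite /S; have xbd : forall m, (bd i x <= m)%N -> component m x = 0.
    by rewrite /bd; case: cid.
  rewrite -(bigE _ (fun m => s m i j h (component m x)) (bd i x) (maxn b (bd i x))) ?leq_maxr //.
    by rewrite (bigE _ (fun m => s m i j h (component m x)) b) ?leq_maxl // => m bm; rewrite xb // s0.
  by move=> m bm; rewrite xbd // s0.
have bound2 i j (x : dsum_dgmod F i) (y : dsum_dgmod F j) :
    exists b : nat, (forall m, (b <= m)%N -> component m x = 0) /\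
      (forall m, (b <= m)%N -> component m y = 0).
  have [b xb] := component_supp x; have [b' yb] := component_supp y; exists (maxn b b').
  by split=> m; rewrite geq_max => /andP[? ?]; [exact: xb|exact: yb].
exists S; split.
- move=> i j h c' x y; have [b [xb yb]] := bound2 _ _ x y.
  rewrite (SE _ _ h x b) // (SE _ _ h y b) // (SE _ _ h _ b); last first.
    by move=> m bm; rewrite linearP /= xb // yb // scaler0 addr0.
  rewrite scaler_sumr -big_split; apply: eq_bigr => m _.
  by rewrite component_linear; case: (sE m) => -> .
- move=> i j n j' n' hj hn h h' a x; have [b xb] := component_supp x.
  rewrite (SE _ _ hj x b) // (SE _ _ hn _ b); last first.
    by move=> m bm; rewrite component_dsum_of xb // linear0.
  rewrite linear_sum scaler_sumr; apply: eq_bigr => m _ /=.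
  by case: (sE m) => _ sa _; rewrite ?component_dsum_of (sa _ _ _ _ _ hj hn h h').
- move=> i j l hl hj x; have [b xb] := component_supp x.
  rewrite (SE _ _ hj x b) // (SE _ _ hl _ b); last first.
    by move=> m bm; rewrite component_dsum_of xb // linear0.
  rewrite linear_sum -big_split {1}(dsum_decompose xb) linear_sum.
  by apply: eq_bigr => m _; case: (sE m) => _ _ sd; exact: sd.
Qed.

End DirectSumMaps.

(** * Resolutions of compact DG modules *)
Section Compact.
Variables (k : fieldType) (R : dgalg k).
Implicit Types F G M N X Y Z : dgmod R.

Lemma diff_one : diff erefl (Defs.one R) = 0.
Proof.
have := mul_leibniz (erefl (0 + 1)) (erefl (0 + 1)) (erefl (0 + 1))
  (addr0 0) (addr0 (0 + 1)) (addrA 0 0 1) (Defs.one R) (Defs.one R).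
rewrite !mul_1r mul_1l /sgn expr0z scale1r => /eqP.
by rewrite -subr_eq subrr eq_sym => /eqP.
Qed.

Lemma hom_regularE N (f : dghom (regular_dgmod R) N) i (a : R i) :
  f i a = act (addr0 i) a (f 0 (Defs.one R)).
Proof. by rewrite -(hom_act f) /= mul_1r. Qed.

(** A homomorphism from [R] is determined by the image of the unit, which is a cocycle,
    hence the coboundary of some [y] if [H^0] of the target is zero; up to sign,
    multiplication by [y] is a null-homotopy. *)
Lemma proj_below_regular : proj_below 0 (regular_dgmod R).
Proof.
move=> N f vN; have cw : cocycle (f 0 (Defs.one R)).
  by apply: hom_cocycle; exact: diff_one.
have [//|y dy] := boundaryE (vN 0 _ _ cw) (addNr 1).
have hj (i j : int) : j + 1 = i -> i + -1 = j by move=> <-; rewrite addrK.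
exists (fun i j h a => sgn k i *: act (hj i j h) a y); split.
- by move=> i j h c a b; rewrite act_linearl scalerDr !scalerA mulrC.
- move=> i j n j' n' hj' hn h h' a b; rewrite /=.
  rewrite (act_assoc h (hj n n' hn) (hj j j' hj') h') linearZ /= !scalerA -sgnD.
  by rewrite h.
- move=> i j l hl hj' a; rewrite hom_regularE linearZ /=; case: l / hl.
  rewrite (act_leibniz erefl (addNr 1) hj' (hj _ _ hj') (hj _ _ erefl) (addr0 i)) dy.
  rewrite scalerDr scalerA sgn_sq scale1r sgnD sgn1 mulrN1 scaleNr.
  by rewrite [RHS]addrAC subrr add0r.
Qed.

Lemma proj_below_zero : proj_below 0 (zero_dgmod R).
Proof.
move=> N f _; apply: null_homotopic_eq (null_zero _ _) => i x /=.
by rewrite [x]thinmx0 linear0.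
Qed.

Lemma proj_below_sum c F G :
  proj_below c F -> proj_below c G -> proj_below c (sum_dgmod F G).
Proof.
move=> pF pG N f vN.
pose fl i (x : F i) : N i := f i (x, 0); pose fr i (y : G i) : N i := f i (0, y).
have fE i x y : f i (x, y) = fl i x + fr i y.
  have -> : ((x, y) : sum_dgmod F G i) = 1 *: (x, 0) + (0, y).
    by congr (_, _); rewrite /= scale1r ?addr0 ?add0r.
  by rewrite (hom_linear f) scale1r.
have fll i : linear (fl i).
  move=> c' x y; rewrite /fl -(hom_linear f); congr (f _ _).
  by congr (_, _); rewrite /= scaler0 addr0.
have frl i : linear (fr i).
  move=> c' x y; rewrite /fr -(hom_linear f); congr (f _ _).
  by congr (_, _); rewrite /= scaler0 addr0.
have fld i j (h : i + 1 = j) x : fl j (diff h x) = diff h (fl i x).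
  by rewrite /fl -hom_diff /= linear0.
have frd i j (h : i + 1 = j) x : fr j (diff h x) = diff h (fr i x).
  by rewrite /fr -hom_diff /= linear0.
have fla i j n (h : i + j = n) a x : fl n (act h a x) = act h a (fl j x).
  by rewrite /fl -hom_act /= linear0.
have fra i j n (h : i + j = n) a x : fr n (act h a x) = act h a (fr j x).
  by rewrite /fr -hom_act /= linear0.
have [s [sl sa sd]] := pF N (DGHom fll fld fla) vN.
have [t [tl ta td]] := pG N (DGHom frl frd fra) vN.
exists (fun i j h x => s i j h x.1 + t i j h x.2); split.
- by move=> i j h c' x y; rewrite /= sl tl scalerDr addrACA.
- move=> i j n j' n' hj hn h h' a x /=.
  by rewrite (sa _ _ _ _ _ hj hn h h') (ta _ _ _ _ _ hj hn h h') linearD scalerDr.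
- move=> i j l hl hj [x y]; rewrite fE linearD /=.
  have /= -> := sd i j l hl hj x; have /= -> := td i j l hl hj y.
  by rewrite addrACA.
Qed.

Definition sum_map M M' N N' (f : dghom M M') (g : dghom N N') :
  dghom (sum_dgmod M N) (sum_dgmod M' N').
Proof.
refine (@DGHom k R (sum_dgmod M N) (sum_dgmod M' N')
          (fun i x => (f i x.1, g i x.2)) _ _ _).
- by move=> i c x y; congr (_, _); rewrite /= linearP.
- by move=> i j h x; congr (_, _); rewrite /= hom_diff.
- by move=> i j n h a x; congr (_, _); rewrite /= hom_act.
Defined.

Lemma sum_cocycle M N n (x : sum_dgmod M N n) :
  cocycle x <-> cocycle x.1 /\ cocycle x.2.
Proof. by split=> [[]//|[c1 c2]]; congr (_, _). Qed.

Lemma sum_boundary M N n (x : sum_dgmod M N n) :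
  boundary x <-> boundary x.1 /\ boundary x.2.
Proof.
have h : n - 1 + 1 = n by rewrite subrK.
split=> [/boundaryE /(_ _ h) [y <-]|[/boundaryE /(_ _ h) [y dy] /boundaryE /(_ _ h) [z dz]]].
  by split; exact: boundary_diff.
by exists (n - 1), h, (y, z); rewrite /= dy dz; case: (x).
Qed.

Lemma sum_map_quasi_iso M M' N N' (f : dghom M M') (g : dghom N N') :
  quasi_iso f -> quasi_iso g -> quasi_iso (sum_map f g).
Proof.
move=> qf qg n; split=> [z /sum_cocycle [c1 c2] /sum_boundary [b1 b2]|w /sum_cocycle [c1 c2]].
  by apply/sum_boundary; split; [apply: (qf n).1|apply: (qg n).1].
have [x cx bx] := (qf n).2 _ c1; have [y cy by_] := (qg n).2 _ c2.
by exists (x, y); [apply/sum_cocycle|apply/sum_boundary].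
Qed.

(** The existence of a resolution and the bound on it are carried together through the
    generation of compact modules. *)
Definition resolved c M := exists2 F, proj_below c F & exists f : dghom F M, quasi_iso f.

Lemma resolved_mono c c' M : c <= c' -> resolved c M -> resolved c' M.
Proof. by move=> cc [F pF rF]; exists F => //; exact: proj_below_mono pF. Qed.

Lemma resolved_Diso c M N : Diso M N -> resolved c M -> resolved c N.
Proof.
move=> [L [f [g [qf qg]]]] [F pF [q qq]]; exists F => //.
have [h qh] := resolution_lift (proj_below_Kproj pF) qf qq.
by exists (comp_hom g h); exact: quasi_iso_comp.
Qed.

Lemma Diso_sym M N : Diso M N -> Diso N M.
Proof. by move=> [L [f [g [qf qg]]]]; exists L, g, f. Qed.

Lemma Diso_quasi_iso M N (f : dghom M N) : quasi_iso f -> Diso M N.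
Proof. by move=> qf; exists M, (id_hom M), f; split=> //; exact: quasi_iso_id. Qed.

Lemma resolved_shift c s M : resolved c M -> resolved (c - s) (shift_dgmod s M).
Proof.
move=> [F pF [q qq]]; exists (shift_dgmod s F); first exact: proj_below_shift.
by exists (shift_hom s q); exact: shift_hom_quasi_iso.
Qed.

Lemma resolved_cone c M N (f : dghom M N) :
  resolved (c + 1) M -> resolved c N -> resolved c (cone_dgmod f).
Proof.
move=> [F pF [q qq]] [G pG [p qp]].
have [g pg] := lift_quasi_iso (comp_hom f q) (proj_below_Kproj pF) qp.
exists (cone_dgmod g); first exact: proj_below_cone.
exact: cone_map qq qp pg.
Qed.

Lemma component_linearD G n m (x y : dsum_dgmod G n) : component m (x + y) = component m x + component m y.
Proof. exact: linear_funD (@component_linear _ _ G n m) _ _. Qed.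

Lemma component_linearN G n m (x : dsum_dgmod G n) : component m (- x) = - component m x.
Proof. exact: linear_funN (@component_linear _ _ G n m) _. Qed.

(** The Eilenberg swindle: with [T] the sum of countably many copies of [M + N],
    regrouping shows that [T] is isomorphic to [M + T], so that [M] is quasi-isomorphic to
    the cone of a map [T -> T]. A resolution of [M + N] gives one of [T], hence one of
    that cone. *)
Section Swindle.
Variables M N : dgmod R.
Local Notation T := (dsum_dgmod (sum_dgmod M N)).

(** The shift of all copies of [M] by one place: it is injective, and its cokernel is the
    first copy of [M]. *)
Definition swindle_fun n (x : T n) (m : nat) : sum_dgmod M N n :=
  (if m is m'.+1 then (component m' x).1 else 0, (component m x).2).

Fact swindle_supp n (x : T n) : finitely_supported (swindle_fun x).
Proof.
have [b xb] := component_supp x; exists b.+1 => -[//|m] bm; rewrite /swindle_fun.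
by rewrite (xb m.+1) ?(xb m) // (leq_trans _ bm).
Qed.

Definition swindle : dghom T T.
Proof.
refine (@DGHom k R T T (fun n x => dsum_of (swindle_supp x)) _ _ _).
- move=> n c x y; apply: component_ext => m.
  rewrite component_linear !component_dsum_of /swindle_fun component_linear.
  by case: m => [|m]; congr (_, _); rewrite /= ?component_linear ?scaler0 ?addr0.
- by move=> i j h x; apply: component_ext => -[|m]; congr (_, _); rewrite /= ?linear0.
- by move=> i j n h a x; apply: component_ext => -[|m]; congr (_, _); rewrite /= ?linear0.
Defined.

Definition swindle_proj : dghom (cone_dgmod swindle) M.
Proof.
refine (@DGHom k R (cone_dgmod swindle) M (fun n x => (component 0 (x.2 : T n)).1) _ _ _).
- move=> n c x y; exact: (congr1 fst (component_linear 0 c (x.2 : T n) (y.2 : T n))).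
- move=> i j h [x y]; rewrite cone_diffE; case: j / h.
  exact: add0r.
- by move=> i j n h a [x y].
Defined.

Lemma swindle_proj_quasi_iso : quasi_iso swindle_proj.
Proof.
move=> n; have [l e] : exists l, l + 1 = n by exists (n - 1); rewrite subrK.
case: n / e; split.
  move=> [x y] /cone_cocycle [cx xy] /boundaryE /(_ _ erefl) [mu dmu].
  pose u0 m : sum_dgmod M N (l + 1) := ((component m.+1 y).1, (component m y).2).
  have fu : finitely_supported u0.
    have [b yb] := component_supp y; exists b => m bm; rewrite /u0.
    by rewrite (yb m.+1) ?(yb m) // ltnW.
  have xyE m : swindle_fun x m + diff erefl (component m y) = 0.
    have := congr1 (@component k R (sum_dgmod M N) (l + 1 + 1) m) xy.
    by rewrite component_linearD (linear_fun0 (@component_linear _ _ _ _ m)).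
  exists l, erefl, (dsum_of fu, dsum_inj (sum_dgmod M N) 0 l (mu, 0)).
  rewrite cone_diffE /=; congr (_, _).
    apply: (@component_ext k R (sum_dgmod M N)) => m.
    have e1 := congr1 fst (xyE m.+1); have e2 := congr1 snd (xyE m).
    rewrite component_linearN (eq_irrelevance (shift_eq1 1 _) erefl) component_dsum_of.
    rewrite [RHS]surjective_pairing.
    congr (_, _); rewrite /=; apply/eqP; rewrite eq_sym -addr_eq0; apply/eqP.
      exact: e1.
    exact: e2.
  - apply: (@component_ext k R (sum_dgmod M N)) => m.
    rewrite component_linearD !component_dsum_of [RHS]surjective_pairing.
    case: m => [|m]; congr (_, _); rewrite /= ?linear0 ?addr0 ?add0r //.
move=> w cw; exists (0, dsum_inj (sum_dgmod M N) 0 (l + 1) (w, 0)).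
  rewrite /cocycle cone_diffE -[RHS]/(0, 0); congr (_, _).
    by rewrite -[X in - X]/(diff _ 0) linear0 oppr0.
  rewrite -[X in _ + X = _]/(diff _ (dsum_inj (sum_dgmod M N) 0 (l + 1) (w, 0))) -hom_diff.
  have -> : diff erefl ((w, 0) : sum_dgmod M N (l + 1)) = 0.
    by congr (_, _); [exact: cw | exact: linear0].
  by rewrite (linear0 (dsum_inj _ 0 _)) addr0; exact: linear0.
by rewrite /= subrr; exact: boundary0.
Qed.

End Swindle.

Lemma resolved_summand c M N : resolved c (sum_dgmod M N) -> resolved c M.
Proof.
move=> [F pF [q qq]].
have rT : resolved c (dsum_dgmod (sum_dgmod M N)).
  by exists (dsum_dgmod F); [exact: proj_below_dsum|exists (dsum_map q); exact: dsum_map_quasi_iso].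
apply: resolved_Diso (Diso_quasi_iso (swindle_proj_quasi_iso M N)) _.
by apply: resolved_cone => //; apply: resolved_mono rT; lia.
Qed.

Lemma resolved_sum c M N : resolved c M -> resolved c N -> resolved c (sum_dgmod M N).
Proof.
move=> [F pF [q qq]] [G pG [p qp]]; exists (sum_dgmod F G); first exact: proj_below_sum.
by exists (sum_map q p); exact: sum_map_quasi_iso.
Qed.

Lemma resolved_self c F : proj_below c F -> resolved c F.
Proof. by move=> pF; exists F => //; exists (id_hom F); exact: quasi_iso_id. Qed.

Lemma compact_resolved M : Dcompact M -> exists c, resolved c M.
Proof.
elim=> {M} [|M N MN _ [c rM]|s M _ [c rM]||M N _ [c rM] _ [c' rN]|X Y Z [A [B [f [XA YB Zf]]]] _ [c rX] _ [c' rY]|M N _ [c rMN]].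
- by exists 0; apply: resolved_self; exact: proj_below_regular.
- by exists c; exact: resolved_Diso MN rM.
- by exists (c - s); exact: resolved_shift.
- by exists 0; apply: resolved_self; exact: proj_below_zero.
- exists (Num.max c c'); apply: resolved_sum.
    by apply: resolved_mono rM; lia.
  by apply: resolved_mono rN; lia.
- exists (Num.max c c'); apply: resolved_Diso (Diso_sym Zf) _; apply: resolved_cone.
    by apply: resolved_mono (resolved_Diso XA rX); lia.
  by apply: resolved_mono (resolved_Diso YB rY); lia.
- by exists c; exact: resolved_summand rMN.
Qed.

Definition bounded_below M := exists b, forall n, n < b -> H_vanish M n.

Lemma bounded_below_quasi_iso M N (f : dghom M N) : quasi_iso f ->
  bounded_below M <-> bounded_below N.
Proof.
by move=> qf; split=> -[b vb]; exists b => n nb; apply/(quasi_iso_vanish n qf); exact: vb.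
Qed.

Lemma bounded_below_Diso M N : Diso M N -> bounded_below M -> bounded_below N.
Proof.
by move=> [L [f [g [qf qg]]]] /(bounded_below_quasi_iso qf) /(bounded_below_quasi_iso qg).
Qed.

(** As R lives in non-negative degrees, modules finitely built from R have cohomology that is
    bounded below. *)
Lemma compact_bounded_below M : (forall j, j < 0 -> forall a : R j, a = 0) ->
  Dcompact M -> bounded_below M.
Proof.
move=> R_neg; elim=> {M} [|M N MN _ bM|s M _ [b bM]||M N _ [b bM] _ [b' bN]|X Y Z [A [B [f [XA YB Zf]]]] _ bX _ bY|M N _ [b bMN]].
- by exists 0 => n n0 z _; rewrite (R_neg n n0 z); exact: boundary0.
- exact: bounded_below_Diso MN bM.
- by exists (b - s) => n nb; apply: shift_vanish; apply: bM; lia.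
- by exists 0 => n _ z _; rewrite [z]thinmx0; exact: boundary0.
- exists (Num.min b b') => n; rewrite lt_min => /andP[nb nb'] z /sum_cocycle [c1 c2].
  by apply/sum_boundary; split; [exact: bM|exact: bN].
- apply: bounded_below_Diso (Diso_sym Zf) _.
  have [b bA] := bounded_below_Diso XA bX; have [b' bB] := bounded_below_Diso YB bY.
  exists (Num.min (b - 1) b') => n; rewrite lt_min => /andP[nb nb']; apply: cone_vanish.
    by move=> z cz _; apply: bA => //; lia.
  by move=> w cw; exists 0; [exact: cocycle0|rewrite linear0 subr0; exact: bB].
- exists b => n nb z cz; have [] := bMN n nb (z, 0) _ => //.
    by apply/sum_cocycle; split=> //; exact: cocycle0.
  by move=> m [h [y yE]]; exists m, h, y.1; rewrite -[RHS]/((z, 0 : N n).1) -yE.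
Qed.

End Compact.

(** * DG submodules *)
Section SubModules.
Variables (k : fieldType) (R : dgalg k) (X : dgmod R).
Variable S : forall n, subspace (X n).
Hypothesis S_diff : forall i j (h : i + 1 = j) (x : X i), S i x -> S j (diff h x).
Hypothesis S_act : forall i j n (h : i + j = n) (a : R i) (x : X j),
  S j x -> S n (act h a x).

Definition subdg_gr n : lmodType k := sub_lmod (S n).

Definition subdg_complex : complex k.
Proof.
refine (@Complex k subdg_gr
  (fun i j h x => to_sub (S_diff h (sub_valP (x : subdg_gr i)))) _ _).
- move=> i j h c x y; apply: sub_val_inj; rewrite [RHS]sub_val_linear.
  exact: etrans (congr1 (diff h) (sub_val_linear c x y)) (diff_linear h c _ _).
- move=> i j l h h' x; apply: sub_val_inj; rewrite sub_val0; exact: diff_diff.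
Defined.

Definition subdg : dgmod R.
Proof.
refine (@DGMod k R subdg_complex
  (fun i j n h a x => to_sub (S_act h a (sub_valP (x : subdg_gr j)))) _ _ _ _ _).
- move=> i j n h x c a b; apply: sub_val_inj; rewrite [RHS]sub_val_linear.
  exact: act_linearl.
- move=> i j n h a c x y; apply: sub_val_inj; rewrite [RHS]sub_val_linear.
  exact: etrans (congr1 (act h a) (sub_val_linear c x y)) (act_linearr h a c _ _).
- by move=> i j l ij jl n h1 h2 h3 h4 a b x; apply: sub_val_inj; exact: act_assoc.
- by move=> i h x; apply: sub_val_inj; exact: act_1.
- move=> i j n i' j' n' hi hj hn h h1 h2 a x; apply: sub_val_inj.
  rewrite [RHS](linear_funD (@sub_val_linear _ _ _)) (linear_funZ (@sub_val_linear _ _ _)).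
  exact: act_leibniz.
Defined.

Definition subdg_incl : dghom subdg X.
Proof.
refine (@DGHom k R subdg X (fun n (x : subdg_gr n) => sub_val x) _ _ _) => //.
Defined.

End SubModules.

(** * Modules on which R acts through k *)
Section TrivialModules.
Variables (k : fieldType) (R : dgalg k) (scR : simply_connected R).
Implicit Types F M N X Y : dgmod R.

(** Unlike [recast], this needs no proof that the degrees agree. The action of R on
    a trivial module can be written uniformly with it, since an element of positive
    degree acts as zero anyway. *)
Definition totcast (A : int -> lmodType k) i j (x : A i) : A j :=
  if i =P j is ReflectT e then recast e x else 0.

Lemma totcastE (A : int -> lmodType k) i (x : A i) : totcast i x = x.
Proof. by rewrite /totcast; case: eqP => // e; rewrite recast_id. Qed.

Lemma totcast_out (A : int -> lmodType k) i j (x : A i) : i <> j -> totcast j x = 0.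
Proof. by rewrite /totcast; case: eqP. Qed.

Lemma totcast_linear (A : int -> lmodType k) i j : linear (@totcast A i j).
Proof.
by move=> c x y; rewrite /totcast; case: eqP => [e|_]; rewrite ?linearP // scaler0 addr0.
Qed.

HB.instance Definition _ (A : int -> lmodType k) i j :=
  GRing.isLinear.Build k (A i) (A j) *:%R (@totcast A i j) (@totcast_linear A i j).

Lemma aug_eq0 i (a : R i) : i <> 0 -> aug scR a = 0.
Proof. by move=> /eqP; exact: aug_out. Qed.

Lemma aug_one : aug scR (Defs.one R) = 1.
Proof. by apply: (scale_one_inj scR); rewrite /= aug0K scale1r. Qed.

Definition triv_complex (A : int -> lmodType k) : complex k.
Proof.
refine (@Complex k A (fun _ _ _ _ => 0) _ _) => // *.
by move=> c x y; rewrite scaler0 addr0.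
Defined.

Definition triv (A : int -> lmodType k) : dgmod R.
Proof.
refine (@DGMod k R (triv_complex A) (fun i j n h a x => aug scR a *: totcast n x) _ _ _ _ _).
- by move=> i j n h x c a b; rewrite aug_linear scalerDl -scalerA.
- by move=> i j n h a c x y; rewrite linearP scalerDr !scalerA mulrC.
- move=> i j l ij jl n h1 h2 h3 h4 a b x; rewrite aug_mul linearZ scalerA.
  have [i0|i0] := eqVneq i 0; last by rewrite (aug_out _ a) // !mul0r !scale0r.
  have [j0|j0] := eqVneq j 0; last by rewrite (aug_out _ b) // !mulr0 !scale0r.
  have e1 : l = jl by rewrite -h3 j0 add0r.
  have e2 : l = n by rewrite -h2 -h1 i0 j0 !add0r.
  case: jl / e1 {h3} h4 => {}h4; case: n / e2 {h2} h4 => _.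
  by rewrite /= !totcastE.
- by move=> i h x; rewrite aug_one scale1r totcastE.
- move=> i j n i' j' n' hi hj hn h h1 h2 a x.
  by rewrite aug_diff scale0r add0r linear0 !scaler0.
Defined.

Lemma triv_actE A i j n (h : i + j = n) (a : R i) (x : triv A j) :
  act h a x = aug scR a *: totcast n x.
Proof. by []. Qed.

Lemma triv_boundary A n (x : triv A n) : boundary x -> x = 0.
Proof. by move=> [m [h [y <-]]]. Qed.

(** As [R^0 = k] and [R^1 = 0], a homogeneous element of R is zero, a scalar, or of degree
    at least two. *)
Lemma degree_cases i (a : R i) (Q : forall i, R i -> Prop) :
  (forall i, Q i 0) -> (forall c, Q 0 (c *: Defs.one R)) ->
  (forall i (a : R i), 1 < i -> Q i a) -> Q i a.
Proof.
move=> Q0 Qs Qp; case: (ltgtP i 0) => [ilt|igt|i0].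
- by rewrite (sc_neg scR ilt a).
- have [i1|i1] := eqVneq i 1; last by apply: Qp; lia.
  by subst i; rewrite (sc_one scR a).
- by subst i; have [c ->] := deg0_scalar scR a.
Qed.

(** Degree [n] of the submodule [R^{>=2} F], generated by the augmentation ideal. The quotient
    of [F] by it is the tensor product of [k] with [F]. *)
Definition Rplus F n : subspace (F n).
Proof.
refine (@Subspace k (F n) (fun u => forall S : subspace (F n),
  (forall i j (h : i + j = n) (a : R i) (y : F j), 1 < i -> S (act h a y)) -> S u) _ _).
- by move=> S _; exact: subspace0.
- by move=> c x y Sx Sy S SP; apply: subspaceP; [exact: Sx|exact: Sy].
Defined.

Lemma Rplus_act F i j n (h : i + j = n) (a : R i) (y : F j) : 1 < i -> Rplus F n (act h a y).
Proof. by move=> i1 S; exact. Qed.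

Lemma Rplus_kernel F n (V : lmodType k) (f : F n -> V) : linear f ->
  (forall i j (h : i + j = n) (a : R i) (y : F j), 1 < i -> f (act h a y) = 0) ->
  forall u, Rplus F n u -> f u = 0.
Proof. by move=> fl fa u /(_ (kernel fl)); exact. Qed.

Lemma hom_triv_Rplus F A (g : dghom F (triv A)) n u : Rplus F n u -> g n u = 0.
Proof.
apply: Rplus_kernel; first exact: hom_linear.
by move=> i j h a y i1; rewrite hom_act triv_actE aug_eq0 ?scale0r //; lia.
Qed.

(** Homomorphisms from [F] to a trivial module factor through [F / R^{>=2} F], and so do
    homotopies between them: everything takes place in complexes of vector spaces,
    where a chain map into a complex without differential is null-homotopic exactly
    if it kills cocycles. *)
Lemma null_triv F A (g : dghom F (triv A)) : null_homotopic g <->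
  forall n m (h : n + 1 = m) x, Rplus F m (diff h x) -> g n x = 0.
Proof.
split.
  move=> [s [sl sa sd]] n m h x Rdx.
  rewrite (sd n (n - 1) m h (subrK 1 n)) add0r.
  apply: (Rplus_kernel _ _ Rdx); first exact: sl.
  move=> i j h' a y i1; have h'' : i + (j - 1) = n by rewrite addrA h' -h addrK.
  rewrite (sa i j m (j - 1) n (subrK 1 j) h h' h'') triv_actE aug_eq0 ?scale0r ?scaler0 //.
  by lia.
move=> gd.
have ex i j (h : j + 1 = i) : exists f : F i -> A j,
    [/\ linear f, forall u, Rplus F i u -> f u = 0 & forall x, f (diff h x) = g j x].
  apply: (@linear_factor k (A j) (F j) (F i) (diff h) (g j) (Rplus F i)).
  - exact: diff_linear.
  - exact: (hom_linear g).
  - exact: gd.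
pose s i j h := projT1 (cid (ex i j h)).
have sP i j h : [/\ linear (s i j h), forall u, Rplus F i u -> s i j h u = 0
    & forall x, s i j h (diff h x) = g j x].
  by rewrite /s; case: cid.
exists s; split.
- by move=> i j h; case: (sP i j h).
- move=> i j n j' n' hj hn h h' a x.
  have [sl sR _] := sP n n' hn; have [sl' _ _] := sP j j' hj.
  move: h h'; apply: (@degree_cases i a (fun i a => forall (h : i + j = n)
    (h' : i + j' = n'), s n n' hn (act h a x) =
      sgn k i *: @act k R (triv A) _ _ _ h' a (s j j' hj x))).
  + by move=> l h h'; rewrite !act0l (linear_fun0 sl) scaler0.
  + move=> c h h'; have e : j = n by rewrite -h add0r.
    have e' : j' = n' by rewrite -h' add0r.
    case: n / e hn h {sl sR sP} => hn h; case: n' / e' hn h' => hn h'.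
    rewrite (eq_irrelevance hn hj) !actZl !act_1 (linear_funZ sl').
    by rewrite /sgn expr0z scale1r.
  + move=> l b l1 h h'; rewrite sR; last exact: Rplus_act.
    by rewrite triv_actE aug_eq0 ?scale0r ?scaler0 //; lia.
- move=> i j l hl hj x; case: (sP l i hl) => _ _ ->.
  by rewrite /= add0r.
Qed.

(** The cohomology of [F / R^{>=2} F] vanishes in degree [c]: cocycles are killed by every
    functional that kills boundaries. Phrasing it with functionals avoids the quotient. *)
Definition red_vanish F c : Prop := forall l : F c -> k^o, linear l ->
  (forall m (h : m + 1 = c) (y : F m), l (diff h y) = 0) ->
  (forall u, Rplus F c u -> l u = 0) ->
  forall m (h : c + 1 = m) x, Rplus F m (diff h x) -> l x = 0.

Lemma null_of_red_vanish F A (g : dghom F (triv A)) :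
  (forall j, red_vanish F j \/ forall v : A j, v = 0) -> null_homotopic g.
Proof.
move=> MF; apply/null_triv => n m h x Rdx.
have [MFn|//] := MF n.
apply: contrapT => gx0.
have [l [ll _ lx]] := @separating_functional k (A n) (zero_space (A n)) (g n x) gx0.
suff /eqP : l (g n x) = 0 by rewrite lx oner_eq0.
apply: (MFn (fun y => l (g n y)) _ _ _ m h x Rdx).
- by move=> c y z; rewrite (hom_linear g) ll.
- by move=> m' h' y; rewrite (hom_diff g) (linear_fun0 ll).
- by move=> u Ru; rewrite (hom_triv_Rplus g Ru) (linear_fun0 ll).
Qed.

(** A functional that detects a class in degree [c] of [F / R^{>=2} F], multiplied by [v]. *)
Lemma nonnull_of_red_nonzero F (A : int -> lmodType k) c (v : A c) : ~ red_vanish F c -> v <> 0 ->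
  exists g : dghom F (triv A), ~ null_homotopic g.
Proof.
move=> nrF v0.
have [l [ll [ld [lR [m [h [x [Rdx lx]]]]]]]] : exists l : F c -> k^o, linear l /\
    ((forall m (h : m + 1 = c) (y : F m), l (diff h y) = 0) /\
     ((forall u, Rplus F c u -> l u = 0) /\
      exists m (h : c + 1 = m) x, Rplus F m (diff h x) /\ l x <> 0)).
  apply: contrapT => nl; apply: nrF => l ll ld lR m h x Rdx; apply: contrapT => lx.
  by apply: nl; exists l; split=> //; split=> //; split=> //; exists m, h, x.
pose g j (y : F j) : A j := totcast j (l (totcast c y) *: v).
have gl j : linear (g j).
  by move=> e y z; rewrite /g linearP ll scalerDl -scalerA linearP.
have gout j y : j <> c -> g j y = 0 by move=> jc; rewrite /g totcast_out // => e; apply: jc.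
have gd i j (e : i + 1 = j) y : g j (diff e y) = 0.
  have [jc|/eqP jc] := eqVneq j c; last exact: gout.
  by move: e; rewrite jc => e; rewrite /g !totcastE ld scale0r.
have ga i j n (e : i + j = n) (a : R i) (y : F j) :
    g n (act e a y) = aug scR a *: totcast n (g j y).
  move: e; apply: (@degree_cases i a (fun i a => forall e : i + j = n,
    g n (act e a y) = aug scR a *: totcast n (g j y))).
  - by move=> d e; rewrite act0l aug_zero (linear_fun0 (gl n)) scale0r.
  - move=> d e; have e' : j = n by rewrite -e add0r.
    case: n / e' e => e; rewrite actZl act_1 (linear_funZ (gl j)) totcastE.
    congr (_ *: _); rewrite (linear_funZ (@aug_linear _ _ scR 0)) aug_one.
    by rewrite [RHS]mulr1.
  - move=> d b d1 e; rewrite (aug_eq0 b) ?scale0r; last by lia.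
    have [nc|/eqP nc] := eqVneq n c; last exact: gout.
    by move: e; rewrite nc => e; rewrite /g !totcastE lR ?scale0r //; exact: Rplus_act.
have gd' i j (e : i + 1 = j) y : g j (diff e y) = @diff k (triv A) _ _ e (g i y).
  by rewrite gd.
exists (@DGHom k R F (triv A) g gl gd' ga).
move=> /null_triv /(_ _ _ _ _ Rdx) /=; rewrite /g !totcastE => /eqP.
by rewrite scaler_eq0 => /orP[] /eqP.
Qed.

Lemma proj_below_red_vanish c F n : proj_below c F -> c < n -> red_vanish F n.
Proof.
move=> pF cn; apply: contrapT => nrF.
have h : (0 < (n == n))%N by rewrite eqxx.
pose A (j : int) : lmodType k := 'rV[k]_(j == n).
pose v : A n := const_mx 1.
have v0 : v <> 0.
  by move=> /matrixP /(_ 0 (Ordinal h)); rewrite !mxE => /eqP; rewrite oner_eq0.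
have [g ng] := nonnull_of_red_nonzero nrF v0.
apply: ng; apply: pF => i ic z _.
suff -> : z = 0 by exact: boundary0.
apply/matrixP => u l; suff i0 : i = n by lia.
by apply/eqP; case: (i == n) l => // -[].
Qed.

End TrivialModules.

(** * Truncation and the two lowest cohomology groups *)
Section Truncation.
Variables (k : fieldType) (R : dgalg k) (scR : simply_connected R).
Implicit Types F M N X Y : dgmod R.

Lemma boundary_recast (C : complex k) i j (e : i = j) (x : C i) : boundary x -> boundary (recast e x).
Proof. by case: j / e. Qed.

(** Since R acts by non-negative degrees, [X] in degrees above [c], together with a complement
    of the boundaries in degree [c], is a DG submodule. It has the same cohomology as [X] if
    the cohomology of [X] is zero below [c]. *)
Lemma truncate X c : (forall i, i < c -> H_vanish X i) ->
  exists Y (j : dghom Y X), quasi_iso j /\ forall i, i < c -> forall y : Y i, y = 0.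
Proof.
move=> vX.
have [r rl rB] := sub_retraction (boundaries X c).

(* The complement is the kernel of the projection [rv] onto the boundaries. *)
pose rv x : X c := sub_val (r x).
have rvl : linear rv by move=> a x y; rewrite /rv rl sub_val_linear.
have rvB x : boundary (rv x) := sub_valP (r x).
have rvI x : rv (rv x) = rv x by exact: rB (rvB x).
pose P n (x : X n) := (n < c -> x = 0) /\ forall e : n = c, rv (recast e x) = 0.
have P0 n : P n 0 by split=> // e; rewrite linear0 (linear_fun0 rvl).
have PP n a x y : P n x -> P n y -> P n (a *: x + y).
  move=> [x0 xr] [y0 yr]; split=> [nc|e]; first by rewrite x0 // y0 // scaler0 addr0.
  by rewrite linearP rvl xr yr scaler0 addr0.
pose S n := Subspace (P0 n) (@PP n).
have Sgt n (x : X n) : c < n -> S n x.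
  by move=> cn; split=> [|e]; lia.
have Sd i j (h : i + 1 = j) (x : X i) : S i x -> S j (diff h x).
  move=> [x0 _]; have [ic|ic] := ltP i c; last by apply: Sgt; lia.
  by rewrite x0 // linear0; exact: subspace0.
have Sa i j n (h : i + j = n) (a : R i) (x : X j) : S j x -> S n (act h a x).
  move=> Sx; move: h; apply: (degree_cases scR a
    (Q := fun i a => forall h : i + j = n, S n (act h a x))).
  - by move=> d h; rewrite act0l; exact: subspace0.
  - move=> d h; have e : j = n by rewrite -h add0r.
    by case: n / e h => h; rewrite actZl act_1; exact: subspaceZ.
  - move=> d b d1 h; have [jc|jc] := ltP j c; last by apply: Sgt; lia.
    by case: Sx => -> // _; rewrite linear0; exact: subspace0.
exists (subdg Sd Sa), (subdg_incl Sd Sa); split; last first.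
  move=> i ic y; apply: sub_val_inj; have [y0 _] := sub_valP y.
  exact: etrans (y0 ic) (esym (sub_val0 _)).
have Y_boundary n (z : subdg Sd Sa n) : boundary (sub_val z : X n) -> c < n -> boundary z.
  have [m h] : exists m, m + 1 = n by exists (n - 1); rewrite subrK.
  move=> /boundaryE /(_ _ h) [y dy] cn.
  suff [y' Sy' dy'] : exists2 y' : X m, S m y' & diff h y' = sub_val z.
    exists m, h, (to_sub Sy'); apply: sub_val_inj; exact: dy'.
  have [mc|mc] := eqVneq m c; last by exists y => //; apply: Sgt; lia.
  have e : c = m by [].
  exists (y - recast e (rv (recast mc y))).
    split=> [|e']; first by lia.
    rewrite linearB /= recast_recast recast_id (eq_irrelevance e' mc) (linear_funB rvl).
    by rewrite rvI subrr.
  rewrite linearB /= dy (diff_recast _ _ (etrans (congr1 (+%R^~ 1) e) h)).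
  by rewrite (cocycle_diff (boundary_cocycle (rvB _))) subr0.
move=> n; split=> [z cz bz|w cw].
  have [nc|nc] := ltP c n; first exact: Y_boundary.
  suff -> : z = 0 by exact: boundary0.
  apply: sub_val_inj; apply: etrans (esym (sub_val0 _)).
  have [z0 zr] := sub_valP z; have [nc'|nc'] := ltP n c; first exact: z0.
  have e : n = c by lia.
  have := zr e; rewrite /rv rB; last exact: boundary_recast bz.
  by move=> /(congr1 (recast (esym e))); rewrite recastK linear0.
have [nc|nc] := ltP n c.
  exists 0; first exact: cocycle0.
  by rewrite (linear_fun0 (hom_linear (subdg_incl Sd Sa) (i := n))) subr0; exact: vX.
have [nc'|nc'] := ltP c n.
  by exists (to_sub (Sgt n w nc')); [apply: sub_val_inj; exact: cw|rewrite /= subrr; exact: boundary0].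
have e : n = c by lia.
pose w' := w - recast (esym e) (rv (recast e w)).
have Sw' : S n w'.
  split=> [|e']; first by lia.
  rewrite linearB /= (eq_irrelevance e' e) recastK (linear_funB rvl).
  by rewrite rvI subrr.
have bw' : boundary (w - w').
  by rewrite /w' opprB [w + _]addrC subrK; exact: boundary_recast.
exists (to_sub Sw') => //; apply: sub_val_inj; apply: etrans (esym (sub_val0 _)).
by rewrite -[LHS]/(diff erefl w') /w' linearB /= cw (cocycle_diff (boundary_cocycle (boundary_recast _ (rvB _)))) subr0.
Qed.

(** If [X] starts in degree [c], then it maps to a trivial module [A] living in degrees [c]
    and [c + 1], by a map that is bijective on [H^c] and injective on [H^(c+1)]. The target
    is linear over R because elements of degree at least two carry [X] beyond degree
    [c + 1]; this is where [R^1 = 0] enters. Were the degree [c + 1] left out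
    of [A], the group [H^(c+1)(X)] would appear in degree [c] of the cone. *)
Lemma test_module X c : (forall i, i < c -> forall x : X i, x = 0) ->
  exists (A : int -> lmodType k) (p : dghom X (triv scR A)),
    [/\ forall i, i <= c -> H_vanish (cone_dgmod p) i,
        forall i, i <> c -> i <> c + 1 -> forall v : A i, v = 0
      & forall x : X c, cocycle x -> x <> 0 -> exists v : A c, v <> 0].
Proof.
move=> X0.
(* [A] consists of the cocycles in degree [c] and of everything in degree [c + 1]. *)
pose P n (x : X n) := (n = c -> cocycle x) /\ (n <> c -> n <> c + 1 -> x = 0).
have P0 n : P n 0 by split=> // _; exact: cocycle0.
have PP n a x y : P n x -> P n y -> P n (a *: x + y).
  move=> [cx x0] [cy y0]; split=> [nc|n1 n2]; first by apply: cocycleP; [exact: cx|exact: cy].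
  by rewrite x0 // y0 // scaler0 addr0.
pose B n := Subspace (P0 n) (@PP n); pose A n : lmodType k := sub_lmod (B n).
have A0 i : i <> c -> i <> c + 1 -> forall v : A i, v = 0.
  move=> i1 i2 v; apply: sub_val_inj; rewrite [RHS]sub_val0.
  by case: (sub_valP v) => _; apply.
(* In degree [c] a retraction onto the cocycles; in degree [c + 1] the complementary
   projection to one onto the boundaries, whose kernel is exactly the boundaries. *)
have ex n : exists p : X n -> A n, [/\ linear p,
    n = c -> forall x, cocycle x -> sub_val (p x) = x
  & n = c + 1 -> forall x, p x = 0 <-> boundary x].
  have [r rl rB] := sub_retraction (B n).
  have [nc|nc] := pselect (n = c + 1); last first.
    exists r; split=> // nc' x cx; apply: rB; by split=> // nc''; case: nc''.
  have [r' r'l r'B] := sub_retraction (boundaries X n).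
  have Btop x : B n x by split=> ?; lia.
  exists (fun x => r (x - sub_val (r' x))); split.
  - move=> a x y; rewrite r'l sub_val_linear -rl; congr r.
    by rewrite scalerBr opprD addrACA.
  - by move=> nc'; lia.
  - move=> _ x; split=> [/(congr1 sub_val)|bx]; last by rewrite r'B // subrr (linear_fun0 rl).
    rewrite rB // [RHS]sub_val0 => /eqP; rewrite subr_eq0 => /eqP ->.
    exact: (sub_valP (r' x)).
pose p n := projT1 (cid (ex n)).
have pP n : [/\ linear (p n),
    n = c -> forall x, cocycle x -> sub_val (p n x) = x
  & n = c + 1 -> forall x, p n x = 0 <-> boundary x].
  by rewrite /p; case: cid.
have pl n : linear (p n) by case: (pP n).
have p_boundary n x : boundary x -> p n x = 0.
  move=> bx; have [nc|nc] := pselect (n = c + 1).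
    by case: (pP n) => _ _ /(_ nc) /(_ x) [_]; exact.
  have [nc'|nc'] := pselect (n = c); last exact: A0.
  move: bx => [m [h [y <-]]]; have -> : y = 0 by apply: X0; lia.
  by rewrite linear0 (linear_fun0 (pl n)).
have pd i j (h : i + 1 = j) x : p j (diff h x) = @diff k (triv scR A) _ _ h (p i x).
  by apply: p_boundary; exact: boundary_diff.
have pa i j n (h : i + j = n) (a : R i) (x : X j) :
    p n (act h a x) = @act k R (triv scR A) _ _ _ h a (p j x).
  rewrite triv_actE; move: h; apply: (degree_cases scR a
    (Q := fun i a => forall h : i + j = n, p n (act h a x) = aug scR a *: totcast n (p j x))).
  - by move=> d h; rewrite act0l aug_zero (linear_fun0 (pl n)) scale0r.
  - move=> d h; have e : j = n by rewrite -h add0r.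
    case: n / e h => h; rewrite actZl act_1 (linear_funZ (pl j)) totcastE.
    by congr (_ *: _); rewrite (linear_funZ (@aug_linear _ _ scR 0)) aug_one [RHS]mulr1.
  - move=> d b d1 h; rewrite (aug_eq0 scR b) ?scale0r; last by lia.
    have [jc|jc] := ltP j c; last by apply: A0; lia.
    by rewrite (X0 j jc x) linear0 (linear_fun0 (pl n)).
exists A, (@DGHom k R X (triv scR A) p pl pd pa); split=> //.
- move=> i ic; apply: cone_vanish => [z cz /triv_boundary /= pz|w _].
    have [_ p1 p2] := pP (i + 1).
    have [e|e] := pselect (i + 1 = c + 1); first by apply/(p2 e).
    have [e'|e'] := pselect (i + 1 = c).
      by rewrite -(p1 e' z cz) pz sub_val0; exact: boundary0.
    have -> : z = 0 by apply: X0; lia.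
    exact: boundary0.
  have [e|e] := pselect (i = c).
    have cw : cocycle (sub_val w) by have [cw _] := sub_valP w; exact: cw.
    exists (sub_val w) => //=.
    have -> : p i (sub_val w) = w.
      by apply: sub_val_inj; have [_ p1 _] := pP i; exact: p1.
    by rewrite subrr; exact: boundary0.
  exists 0; first exact: cocycle0.
  have -> : w = 0 by apply: A0; lia.
  by rewrite /= (linear_fun0 (pl i)) subr0; exact: boundary0.
- move=> x cx x0; have Bx : B c x by split.
  exists (to_sub Bx) => v0; apply: x0.
  by have := congr1 sub_val v0; rewrite sub_val0.
Qed.

End Truncation.

(** * The top degree of the reduction of a resolution *)
Section Top.
Variables (k : fieldType) (R : dgalg k) (scR : simply_connected R).
Implicit Types F M N X Y : dgmod R.

Lemma proj_below_shift1 c F N : proj_below c F ->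
  (forall i, i < c -> H_vanish N i) ->
  forall u : dghom (shift_dgmod 1 F) N, null_homotopic u.
Proof.
move=> pF vN u; have := @proj_below_shift _ _ _ 1 _ pF.
by apply=> i ic; apply: vN; lia.
Qed.

(** Let [f] go from [F] to a module with cohomology from degree [c] on. Its composite with
    the test map is null-homotopic, in degree [c] by hypothesis and in degree [c + 1] by
    the bound on [F]; and [F] cannot distinguish the target from the test module since
    the cone of the test map has no cohomology up to [c]. *)
Lemma proj_below_pred c F : proj_below c F -> red_vanish F c -> proj_below (c - 1) F.
Proof.
move=> pF MF X f vX; have KF := proj_below_Kproj pF.
have [|Y [j [qj Y0]]] := truncate scR (X := X) (c := c).
  by move=> i ic; apply: vX; lia.
have [g jg] := lift_quasi_iso f KF qj.
apply: (null_homotopic_homotopic (homotopic_sym jg)); apply: null_compl.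
have [A [p [vp A0 _]]] := test_module scR Y0.
apply: (@null_of_null_shift _ _ _ _ _ p).
  apply: null_of_red_vanish => i; have [->|ic] := eqVneq i c; first by left.
  have [ilt|ige] := ltP c i; last by right; apply: A0; lia.
  by left; exact: (proj_below_red_vanish scR pF ilt).
by apply: (proj_below_shift1 pF) => i ic; apply: vp; lia.
Qed.

(** A map from [F] to the test module that is not null-homotopic lifts to [X] up to
    homotopy, since it dies in the cone of the test map. *)
Lemma nonnull_hom c F X : proj_below c F -> ~ red_vanish F c ->
  (forall i, i < c -> H_vanish X i) -> H_nonzero X c ->
  exists f : dghom F X, ~ null_homotopic f.
Proof.
move=> pF nrF vX nX; have KF := proj_below_Kproj pF.
have [Y [j [qj Y0]]] := truncate scR vX.
have [z cz nz] := (quasi_iso_nonzero c qj).2 nX.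
have [A [p [vp A0 Av]]] := test_module scR Y0.
have [|v v0] := Av z cz.
  by move=> z0; apply: nz; rewrite z0; exact: boundary0.
have [g ng] := @nonnull_of_red_nonzero _ _ scR F A c v nrF v0.
have [|f pf] := lift_of_null (p := p) (g := g); first exact: pF.
exists (comp_hom j f) => njf; apply: ng.
apply: (null_homotopic_homotopic (homotopic_sym pf)); apply: null_compl.
exact: null_of_quasi_iso KF qj njf.
Qed.

(** By [proj_below_pred] the bound can be lowered as long as the reduction of [F] has no cohomology
    at the bound. It cannot pass below the cohomology of [F], where the identity of [F] would be
    null-homotopic. *)
Lemma exists_top c F : proj_below c F -> bounded_below F -> ~ acyclic F ->
  exists2 p, proj_below p F & ~ red_vanish F p.
Proof.
move=> pF [b vF] naF; apply: contrapT => ntop; apply: naF; apply: null_id_acyclic.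
have pFn (n : nat) : proj_below (c - n%:Z) F.
  elim: n => [|n IHn]; first by rewrite subr0.
  rewrite (_ : c - n.+1%:Z = c - n%:Z - 1); last by lia.
  apply: proj_below_pred => //; apply: contrapT => nrF.
  by apply: ntop; exists (c - n%:Z).
by have := pFn (absz (c - b + 1)); apply=> i ic; apply: vF; lia.
Qed.

End Top.

(** * Duality between tensor products and homomorphisms *)
Lemma sgn_parity (k : fieldType) (z i j : int) : i = j + 2 * z -> sgn k i = sgn k j.
Proof.
move=> ->; have -> : 2 * z = z + z by ring.
by rewrite !sgnD sgn_sq mulr1.
Qed.

Section DualSpace.
Variables (k : fieldType) (V : lmodType k).

Lemma linear_zero : linear (0 : V -> k^o).
Proof. by move=> c x y; rewrite -[RHS]/(c *: 0 + 0) scaler0 addr0. Qed.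

Lemma linear_comb c (f g : V -> k^o) : linear f -> linear g -> linear (c *: f + g).
Proof.
move=> fl gl d x y; rewrite -[LHS]/(c *: f _ + g _) fl gl.
rewrite -[RHS]/(d *: (c *: f x + g x) + (c *: f y + g y)).
by rewrite !scalerDr !scalerA [d * c]mulrC addrACA.
Qed.

Definition lin_dual : lmodType k :=
  sub_lmod (@Subspace k (V -> k^o) (fun f => linear f) linear_zero linear_comb).

Definition dual_ev (f : lin_dual) : V -> k^o := sub_val f.

Definition to_dual (f : V -> k^o) (fl : linear f) : lin_dual :=
  @to_sub k (V -> k^o) (@Subspace k (V -> k^o) (fun f => linear f) linear_zero linear_comb) f fl.

Lemma dual_ev_linear (f : lin_dual) : linear (dual_ev f).
Proof. exact: sub_valP f. Qed.

Lemma dual_evP c (f g : lin_dual) x : dual_ev (c *: f + g) x = c *: dual_ev f x + dual_ev g x.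
Proof. by rewrite /dual_ev sub_val_linear. Qed.

Lemma dual_ev_ext (f g : lin_dual) : dual_ev f =1 dual_ev g -> f = g.
Proof. by move=> e; apply: sub_val_inj; apply: funext. Qed.

Lemma dual_evD (f g : lin_dual) x : dual_ev (f + g) x = dual_ev f x + dual_ev g x.
Proof. by rewrite -[f]scale1r dual_evP !scale1r. Qed.

Lemma dual_evZ c (f : lin_dual) x : dual_ev (c *: f) x = c *: dual_ev f x.
Proof. by rewrite /dual_ev (linear_funZ (@sub_val_linear _ _ _)). Qed.

Lemma dual_ev0 x : dual_ev 0 x = 0.
Proof. by rewrite /dual_ev sub_val0. Qed.

End DualSpace.

(** [theta] is a homomorphism from [R] to the opposite of [S], so that [S]-modules
    dualize to [R]-modules. The cases of interest are the two identity maps between the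
    components of an algebra and of its opposite, and treating them at once gives
    the results for left and right modules together. *)
Section DualModule.
Variables (k : fieldType) (R S : dgalg k) (theta : forall i, R i -> S i).
Arguments theta {i} _.
Hypothesis theta_linear : forall i, linear (@theta i).
Hypothesis theta_one : theta (Defs.one R) = Defs.one S.
Hypothesis theta_diff : forall i j (h : i + 1 = j) (a : R i),
  theta (diff h a) = diff h (theta a).
Hypothesis theta_mul : forall i j n (h : i + j = n) (h' : j + i = n) (a : R i) (b : R j),
  theta (Defs.mul h a b) = sgn k (i * j) *: Defs.mul h' (theta b) (theta a).
Variables (n : int) (N : dgmod S).

(** With this grading, homomorphisms from [F] to [dual_dgmod] are the functionals on degree
    [n] of the tensor product of [F] with [N] that kill boundaries. The signs below are those that make chain maps
    correspond to functionals killing boundaries, without further signs. *)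
Definition dual_gr (i : int) : lmodType k := lin_dual (N (n - i)).

Fact dual_diff_eq i j : i + 1 = j -> n - j + 1 = n - i.
Proof. by move=> <-; ring. Qed.

Fact dual_act_eq i j m : i + j = m -> i + (n - m) = n - j.
Proof. by move=> <-; ring. Qed.

Definition dual_diff_fun i j (h : i + 1 = j) (f : dual_gr i) (p : N (n - j)) : k^o :=
  sgn k (n - i) *: dual_ev f (diff (dual_diff_eq h) p).

Fact dual_diff_fun_linear i j (h : i + 1 = j) (f : dual_gr i) : linear (dual_diff_fun h f).
Proof.
move=> c x y; rewrite /dual_diff_fun linearP dual_ev_linear scalerDr !scalerA.
by rewrite [sgn k _ * c]mulrC.
Qed.

Definition dual_complex : complex k.
Proof.
refine (@Complex k dual_gr (fun i j h f => to_dual (dual_diff_fun_linear h f)) _ _).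
- move=> i j h c f g; apply: dual_ev_ext => p; rewrite dual_evP.
  rewrite -[LHS]/(dual_diff_fun _ _ _) /dual_diff_fun dual_evP scalerDr !scalerA.
  by rewrite [sgn k _ * c]mulrC.
- move=> i j l h h' f; apply: dual_ev_ext => p; rewrite dual_ev0 -[LHS]/(dual_diff_fun _ _ _).
  rewrite /dual_diff_fun -[X in _ *: X]/(dual_diff_fun _ _ _) /dual_diff_fun.
  by rewrite diff_diff (linear_fun0 (dual_ev_linear f)) !scaler0.
Defined.

Definition dual_act_fun i j m (h : i + j = m) (a : R i) (f : dual_gr j) (p : N (n - m)) : k^o :=
  sgn k (i * (n - m)) *: dual_ev f (act (dual_act_eq h) (theta a) p).

Fact dual_act_fun_linear i j m (h : i + j = m) a f : linear (@dual_act_fun i j m h a f).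
Proof.
move=> c x y; rewrite /dual_act_fun linearP dual_ev_linear scalerDr !scalerA.
by rewrite [sgn k _ * c]mulrC.
Qed.

Definition dual_dgmod : dgmod R.
Proof.
refine (@DGMod k R dual_complex (fun i j m h a f => to_dual (dual_act_fun_linear h a f)) _ _ _ _ _).
- move=> i j m h f c a b; apply: dual_ev_ext => p; rewrite dual_evP.
  rewrite -[LHS]/(dual_act_fun _ _ _ _) /dual_act_fun theta_linear act_linearl dual_ev_linear.
  by rewrite scalerDr !scalerA [sgn k _ * c]mulrC.
- move=> i j m h a c f g; apply: dual_ev_ext => p; rewrite dual_evP.
  rewrite -[LHS]/(dual_act_fun _ _ _ _) /dual_act_fun dual_evP scalerDr !scalerA.
  by rewrite [sgn k _ * c]mulrC.
- move=> i j l ij jl m h1 h2 h3 h4 a b f; apply: dual_ev_ext => p.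
  rewrite -[LHS]/(dual_act_fun _ _ _ _) -[RHS]/(dual_act_fun _ _ _ _) /dual_act_fun.
  rewrite -[X in _ = _ *: X]/(dual_act_fun _ _ _ _) /dual_act_fun.
  have h1' : j + i = ij by rewrite addrC.
  rewrite (theta_mul h1 h1') actZl (linear_funZ (dual_ev_linear f)) !scalerA -!sgnD.
  rewrite (act_assoc h1' _ (dual_act_eq h4) (dual_act_eq h3)).
  congr (_ *: _); apply: (@sgn_parity k 0).
  by rewrite -h1 -h4 -h3; ring.
- move=> i h f; apply: dual_ev_ext => p.
  rewrite -[LHS]/(dual_act_fun _ _ _ _) /dual_act_fun theta_one act_1.
  by rewrite mul0r /sgn expr0z scale1r.
- move=> i j m i' j' m' hi hj hm h h1 h2 a f; apply: dual_ev_ext => p.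
  rewrite -[X in _ = dual_ev X p]addrC dual_evP.
  rewrite -[LHS]/(dual_diff_fun _ _ _) /dual_diff_fun.
  rewrite -[X in _ *: X = _]/(dual_act_fun _ _ _ _) /dual_act_fun.
  rewrite -[X in _ = _ *: X + _]/(dual_act_fun _ _ _ _) /dual_act_fun.
  rewrite -[X in _ = _ + X]/(dual_act_fun _ _ _ _) /dual_act_fun.
  rewrite -[X in _ = _ *: (_ *: X) + _]/(dual_diff_fun _ _ _) /dual_diff_fun.
  rewrite (act_leibniz hi (dual_diff_eq hm) (dual_diff_eq hj) _ (dual_act_eq h1)
    (dual_act_eq h)) theta_diff.
  rewrite (linear_funD (dual_ev_linear f)) (linear_funZ (dual_ev_linear f)).
  set T1 := dual_ev f _; set T2 := dual_ev f _.
  rewrite !scalerDr !scalerA -!sgnD [RHS]addrAC -scalerDl.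
  have -> : sgn k (i + i * (n - m') + (n - j)) = sgn k (i' * (n - m') + 1).
    by apply: (@sgn_parity k i); rewrite -hi -hm -h; ring.
  rewrite [sgn k (_ + 1)]sgnD sgn1 mulrN1 addNr scale0r add0r; congr (_ *: _).
  apply: (@sgn_parity k (- i)).
  by rewrite -hm -h; ring.
Defined.

Lemma dual_diffE i j (h : i + 1 = j) (f : dual_dgmod i) (p : N (n - j)) :
  dual_ev (diff h f : dual_gr j) p = sgn k (n - i) *: dual_ev (f : dual_gr i) (diff (dual_diff_eq h) p).
Proof. by []. Qed.

Lemma dual_actE i j m (h : i + j = m) (a : R i) (f : dual_dgmod j) (p : N (n - m)) :
  dual_ev (act h a f : dual_gr m) p =
  sgn k (i * (n - m)) *: dual_ev (f : dual_gr j) (act (dual_act_eq h) (theta a) p).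
Proof. by []. Qed.

Lemma dual_vanish i : H_vanish N (n - i) -> H_vanish dual_dgmod i.
Proof.
move=> v f cf; have h : i - 1 + 1 = i by rewrite subrK.
have fd p : dual_ev f (diff (dual_diff_eq (erefl (i + 1))) p) = 0.
  have := dual_diffE (erefl (i + 1)) f p; rewrite cf dual_ev0 => /esym/eqP.
  rewrite scaler_eq0 => /orP[|/eqP //]; rewrite /sgn expfz_eq0.
  by rewrite oppr_eq0 oner_eq0 andbF.
have [||x dx|g [gl _ gE]] := @linear_factor k k^o _ _ (diff (dual_diff_eq h)) (dual_ev f)
    (zero_space _).
- exact: diff_linear.
- exact: dual_ev_linear.
- have bx : boundary x by apply: v; exact: diff_cocycle dx.
  by have [y <-] := boundaryE bx (dual_diff_eq (erefl (i + 1))).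
- have -> : f = sgn k (n - (i - 1)) *: diff h (to_dual gl : dual_dgmod (i - 1)).
    apply: dual_ev_ext => p; rewrite /dual_ev (linear_funZ (@sub_val_linear _ _ _)).
    rewrite -[X in _ = _ *: X]/(sgn k (n - (i - 1)) *: g (diff (dual_diff_eq h) p)).
    by rewrite gE scalerA sgn_sq scale1r.
  by apply: boundaryZ; exact: boundary_diff.
Qed.

Lemma dual_nonzero i : H_nonzero N (n - i) -> H_nonzero dual_dgmod i.
Proof.
move=> [z cz nz]; have [g [gl gB gz]] := separating_functional (S := boundaries N (n - i)) nz.
exists (to_dual gl : dual_dgmod i).
  apply: dual_ev_ext => p; rewrite dual_ev0 dual_diffE -[dual_ev _ _]/(g _) gB ?scaler0 //.
  exact: boundary_diff.
move=> [m [h [f fE]]]; have := congr1 (fun f' => dual_ev (f' : dual_gr i) z) fE.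
rewrite dual_diffE (cocycle_diff cz) (linear_fun0 (dual_ev_linear _)) scaler0.
by rewrite -[RHS]/(g z) gz => /esym/eqP; rewrite oner_eq0.
Qed.

(** A common form of the tensor products of [F] with [N] in the two orders, balanced along
    [theta] and universal for maps to [k]. The value [tau x p] stands for the tensor of
    [p] and [x] with [p] on the left: the signs arise when the differential and the
    elements of R pass over [p]. *)
Record pairing (F : dgmod R) (T : complex k)
    (tau : forall i j m : int, i + j = m -> F i -> N j -> T m) : Prop := Pairing {
  tau_linearl : forall i j m (h : i + j = m) p, linear (fun x => tau _ _ _ h x p);
  tau_linearr : forall i j m (h : i + j = m) x, linear (tau _ _ _ h x);
  tau_act : forall i j l ij il m (h1 : i + j = ij) (h2 : i + l = il)
    (h : ij + l = m) (h' : j + il = m) a x p,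
    tau _ _ _ h (act h1 a x) p = sgn k (i * l) *: tau _ _ _ h' x (act h2 (theta a) p);
  tau_diff : forall i j m i' j' m' (hi : i + 1 = i') (hj : j + 1 = j')
    (hm : m + 1 = m') (h : i + j = m) (h1 : i' + j = m') (h2 : i + j' = m') x p,
    diff hm (tau _ _ _ h x p) = tau _ _ _ h2 x (diff hj p) + sgn k j *: tau _ _ _ h1 (diff hi x) p;
  tau_univ : forall m (b : forall i j : int, i + j = m -> F i -> N j -> k^o),
    (forall i j (h : i + j = m) p, linear (fun x => b i j h x p)) ->
    (forall i j (h : i + j = m) x, linear (b i j h x)) ->
    (forall i j l ij il (h1 : i + j = ij) (h2 : i + l = il)
      (h : ij + l = m) (h' : j + il = m) a x p,
      b _ _ h (act h1 a x) p = sgn k (i * l) *: b _ _ h' x (act h2 (theta a) p)) ->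
    exists2 f : T m -> k^o, linear f & forall i j (h : i + j = m) x p,
      f (tau _ _ _ h x p) = b i j h x p;
  tau_ext : forall m (f g : T m -> k^o), linear f -> linear g ->
    (forall i j (h : i + j = m) x p, f (tau _ _ _ h x p) = g (tau _ _ _ h x p)) -> f =1 g }.

Section Pairing.
Variables (F : dgmod R) (T : complex k).
Variable tau : forall i j m : int, i + j = m -> F i -> N j -> T m.
Hypothesis pr : pairing tau.

Fact pair_eq i : i + (n - i) = n. Proof. by ring. Qed.

Fact pair_eq1 i j : j + 1 = i -> i + (n - j) = n + 1. Proof. by move=> <-; ring. Qed.

Lemma hom_of_functional (f : T n -> k^o) : linear f ->
  (forall m (h : m + 1 = n) (y : T m), f (diff h y) = 0) ->
  exists u : dghom F dual_dgmod, forall i x p, dual_ev (u i x : dual_gr i) p = f (tau (pair_eq i) x p).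
Proof.
move=> fl fd.
have ul i x : linear (fun p => f (tau (pair_eq i) x p)).
  by move=> c p q; rewrite (tau_linearr pr) fl.
pose u i (x : F i) : dual_gr i := to_dual (ul i x).
have uE i x p : dual_ev (u i x) p = f (tau (pair_eq i) x p) by [].
have u_linear i : linear (u i).
  by move=> c x y; apply: dual_ev_ext => p; rewrite dual_evP !uE (tau_linearl pr) fl.
have u_diff i j (h : i + 1 = j) x : u j (diff h x) = @diff k dual_dgmod _ _ h (u i x).
  apply: dual_ev_ext => p; rewrite dual_diffE !uE.
  have e : i + (n - j) = n - 1 by rewrite -h; ring.
  have := fd (n - 1) (subrK 1 n) (tau e x p).
  rewrite (tau_diff pr h (dual_diff_eq h) (subrK 1 n) e (pair_eq j) (pair_eq i)).
  rewrite (linear_funD fl) (linear_funZ fl) => /eqP; rewrite addr_eq0 => /eqP ->.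
  rewrite scalerN scalerA -sgnD -scaleNr.
  have -> : sgn k (n - i + (n - j)) = sgn k 1.
    by apply: (@sgn_parity k (n - j)); rewrite -h; ring.
  by rewrite sgn1 opprK scale1r.
have u_act i j m (h : i + j = m) (a : R i) x :
    u m (act h a x) = @act k R dual_dgmod _ _ _ h a (u j x).
  apply: dual_ev_ext => p; rewrite dual_actE !uE.
  by rewrite (tau_act pr h (dual_act_eq h) _ (pair_eq j)) (linear_funZ fl).
by exists (@DGHom k R F dual_dgmod u u_linear u_diff u_act).
Qed.

Lemma functional_of_hom (u : dghom F dual_dgmod) :
  exists f : T n -> k^o, [/\ linear f,
    forall m (h : m + 1 = n) (y : T m), f (diff h y) = 0
  & forall i x p, dual_ev (u i x : dual_gr i) p = f (tau (pair_eq i) x p)].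
Proof.
have e i j : i + j = n -> j = n - i by move=> <-; ring.
pose b i j (h : i + j = n) (x : F i) (p : N j) : k^o :=
  dual_ev (u i x : dual_gr i) (recast (e i j h) p).
have [|||f fl fE] := tau_univ pr (m := n) (b := b).
- by move=> i j h p c x y; rewrite /b (hom_linear u) dual_evP.
- by move=> i j h x c p q; rewrite /b linearP dual_ev_linear.
- move=> i j l ij il h1 h2 h h' a x p; rewrite /b hom_act dual_actE.
  have el := e _ _ h; move: p h h2; rewrite el => p h h2.
  rewrite recast_id; have h3 : i + (n - ij) = n - j by rewrite -h1; ring.
  by rewrite (recast_act _ _ (dual_act_eq h1)).
exists f; split=> //; last by move=> i x p; rewrite fE /b recast_id.
move=> m h y.
have dl : linear (fun y => f (diff h y)) by move=> c x z; rewrite linearP fl.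
apply: (tau_ext pr dl (@linear_zero k (T m))) => i j hij x p.
rewrite -[RHS]/(0 : k^o).
have h1 : (i + 1) + j = n by rewrite -h -hij; ring.
have h2 : i + (j + 1) = n by rewrite -h -hij; ring.
rewrite (tau_diff pr erefl erefl h hij h1 h2) (linear_funD fl) (linear_funZ fl) !fE /b.
rewrite (hom_diff u) dual_diffE (recast_diff _ _ (e _ _ h2)).
rewrite (diff_recast _ _ (e _ _ h2)) scalerA -sgnD -[X in X + _]scale1r -scalerDl.
have -> : sgn k (j + (n - i)) = sgn k 1.
  by apply: (@sgn_parity k j); rewrite -h2; ring.
by rewrite sgn1 addrN scale0r.
Qed.

(** A functional that kills the cocycles in degree [n] factors through the differential, and the
    second factor, read on pure tensors, is a null-homotopy. *)
Lemma null_of_vanish (u : dghom F dual_dgmod) : H_vanish T n -> null_homotopic u.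
Proof.
move=> v; have [f [fl fd fE]] := functional_of_hom u.
have [||y dy|g [gl _ gE]] := @linear_factor k k^o _ _ (diff (erefl (n + 1))) f
    (zero_space (T (n + 1))).
- exact: diff_linear.
- exact: fl.
- by have [m [h [z <-]]] := v y dy.
have sl i j (h : j + 1 = i) x : linear (fun p : N (n - j) =>
    sgn k (n + 1 - i) *: g (tau (pair_eq1 h) x p) : k^o).
  move=> c p q; rewrite (tau_linearr pr) gl scalerDr !scalerA.
  by rewrite [sgn k _ * c]mulrC.
exists (fun i j h x => to_dual (sl i j h x) : dual_dgmod j); split.
- move=> i j h c x y; apply: dual_ev_ext => p; rewrite dual_evP.
  rewrite -[LHS]/(sgn k _ *: g (tau _ _ p)) (tau_linearl pr) gl scalerDr !scalerA.
  by rewrite [sgn k _ * c]mulrC.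
- move=> i j m j' m' hj hm h h' a x; apply: dual_ev_ext => p.
  rewrite /dual_ev (linear_funZ (@sub_val_linear _ _ _)).
  rewrite -[X in _ = _ *: X]/(dual_ev (act h' a (to_dual (sl j j' hj x) : dual_dgmod j') : dual_gr m') p).
  rewrite dual_actE -[X in _ = _ *: (_ *: X)]/(sgn k _ *: g (tau _ _ _)).
  rewrite -[LHS]/(sgn k _ *: g (tau _ _ _)).
  rewrite (tau_act pr h (dual_act_eq h') _ (pair_eq1 hj)) (linear_funZ gl) !scalerA -!sgnD.
  congr (_ *: _); apply: (@sgn_parity k (- i)).
  by rewrite -h; ring.
- move=> i j l hl hj x; apply: dual_ev_ext => p; rewrite fE -gE.
  rewrite (tau_diff pr hl (dual_diff_eq hj) erefl (pair_eq i) (pair_eq1 hl) (pair_eq1 hj)).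
  rewrite (linear_funD gl) (linear_funZ gl) dual_evD dual_diffE.
  rewrite -[X in _ = _ *: X + _]/(sgn k _ *: g (tau _ _ _)).
  rewrite -[X in _ = _ + X]/(sgn k _ *: g (tau _ _ _)) scalerA -sgnD.
  have -> : sgn k (n - j + (n + 1 - i)) = sgn k 0.
    by apply: (@sgn_parity k (n - j)); rewrite -hj; ring.
  have -> : sgn k (n + 1 - l) = sgn k (n - i) by congr (sgn k _); rewrite -hl; ring.
  by rewrite [sgn k 0]expr0z scale1r.
Qed.

(** If a cocycle were not a boundary, a functional would separate it from the boundaries;
    but the null-homotopy of the corresponding homomorphism makes that functional factor
    through the differential. *)
Lemma vanish_of_null : (forall u : dghom F dual_dgmod, null_homotopic u) -> H_vanish T n.
Proof.
move=> nu z cz; apply: contrapT => bz.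
have [f [fl fB fz]] := separating_functional (S := boundaries T n) bz.
have [|u uE] := hom_of_functional fl.
  by move=> m h y; apply: fB; exact: boundary_diff.
have [s [sl sa sd]] := nu u.
have e i j : i + j = n + 1 -> j = n - (i - 1).
  by lia.
pose b i j (h : i + j = n + 1) (x : F i) (p : N j) : k^o :=
  sgn k (n + 1 - i) *: dual_ev (s i (i - 1) (subrK 1 i) x : dual_gr (i - 1)) (recast (e i j h) p).
have [|||g gl gE] := tau_univ pr (m := n + 1) (b := b).
- move=> i j h p c x y; rewrite /b sl dual_evP scalerDr !scalerA.
  by rewrite [sgn k _ * c]mulrC.
- move=> i j h x c p q; rewrite /b linearP dual_ev_linear scalerDr !scalerA.
  by rewrite [sgn k _ * c]mulrC.
- move=> i j l ij il h1 h2 h h' a x p; rewrite /b.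
  have h3 : i + (j - 1) = ij - 1 by rewrite -h1; ring.
  rewrite (sa i j ij (j - 1) (ij - 1) (subrK 1 j) (subrK 1 ij) h1 h3).
  rewrite dual_evZ dual_actE.
  have -> : dual_ev (s j (j - 1) (subrK 1 j) x : dual_gr (j - 1))
      (act (dual_act_eq h3) (theta a) (recast (e ij l h) p)) =
    dual_ev (s j (j - 1) (subrK 1 j) x : dual_gr (j - 1)) (recast (e j il h') (act h2 (theta a) p)).
    have h4 : i + l = n - (j - 1) by rewrite h2 -(e _ _ h').
    by rewrite (recast_act _ _ h4) (act_recast _ _ h4).
  rewrite !scalerA -!sgnD; congr (_ *: _); apply: (@sgn_parity k 0).
  have -> : n - (ij - 1) = l by rewrite -(e _ _ h).
  by rewrite -h1; ring.
have sE i j (h : j + 1 = i) x (p : N (n - j)) (e' : n - j = n - (i - 1)) :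
    dual_ev (s i (i - 1) (subrK 1 i) x : dual_gr (i - 1)) (recast e' p) = dual_ev (s i j h x : dual_gr j) p.
  have ej : j = i - 1 by rewrite -h addrK.
  case: _ / (esym ej) h p e' => h p e'.
  by rewrite recast_id (eq_irrelevance h (subrK 1 i)).
have dl : linear (fun y : T n => g (diff (erefl (n + 1)) y)).
  by move=> c x y; rewrite linearP gl.
have fg : f =1 fun y => g (diff (erefl (n + 1)) y).
  apply: (tau_ext pr fl dl) => i j h x p.
  have ej : j = n - i by rewrite -h; ring.
  case: _ / (esym ej) p h => p h; rewrite (eq_irrelevance h (pair_eq i)) -uE.
  rewrite (sd i (i - 1) (i + 1) erefl (subrK 1 i)) dual_evD dual_diffE.
  rewrite (tau_diff pr erefl (dual_diff_eq (subrK 1 i)) erefl (pair_eq i)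
    (pair_eq1 erefl) (pair_eq1 (subrK 1 i))) (linear_funD gl) (linear_funZ gl) !gE /b.
  rewrite (sE i (i - 1) (subrK 1 i)) (sE (i + 1) i erefl) scalerA -sgnD.
  have -> : sgn k (n - (i - 1)) = sgn k (n + 1 - i) by congr (sgn k _); ring.
  have -> : sgn k (n - i + (n + 1 - (i + 1))) = sgn k 0.
    by apply: (@sgn_parity k (n - i)); ring.
  by rewrite [sgn k 0]expr0z scale1r.
move: fz; rewrite fg cz (linear_fun0 gl) => /esym/eqP.
by rewrite oner_eq0.
Qed.

End Pairing.

End DualModule.

(** * The tensor product as a pairing in either factor *)
Section TensorPairings.
Variables (k : fieldType) (R : dgalg k) (P : dgmod R^op) (M : dgmod R).

Lemma tens_ext_linear n (f g : tens P M n -> k^o) : linear f -> linear g ->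
  (forall i j (h : i + j = n) p m, f (ptens h p m) = g (ptens h p m)) -> f =1 g.
Proof.
move=> fl gl fg; elim/tens_ind=> [|i j h p m x IHx].
  by rewrite (linear_fun0 fl) (linear_fun0 gl).
by rewrite (linear_funD fl) (linear_funD gl) fg IHx.
Qed.

Definition left_theta i (a : R i) : (R^op) i := a.
Definition right_theta i (a : (R^op) i) : R i := a.

Fact flip_eq (i j n : int) : i + j = n -> j + i = n.
Proof. by rewrite addrC. Qed.

Definition left_tau i j n (h : i + j = n) (m : M i) (p : P j) : tens_complex P M n :=
  ptens (flip_eq h) p m.

(** The Koszul sign of exchanging the factors turns the left factor into one that satisfies
    the axioms of a pairing with the same signs as the right factor. *)
Definition right_tau i j n (h : i + j = n) (p : P i) (m : M j) : tens_complex P M n :=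
  sgn k (i * j) *: ptens h p m.

Lemma left_pairing : pairing left_theta left_tau.
Proof.
split.
- by move=> i j m h p c x y; rewrite /left_tau ptensDr ptensZr.
- by move=> i j m h x c p q; rewrite /left_tau ptensDl ptensZl.
- move=> i j l ij il m h1 h2 h h' a x p; rewrite /left_tau.
  have h3 : l + i = il by rewrite addrC.
  rewrite -(ptens_act h3 h1 (flip_eq h')) /ract ptensZl mulrC.
  by rewrite (eq_irrelevance (etrans _ _) h2).
- move=> i j m i' j' m' hi hj hm h h1 h2 x p; rewrite /left_tau.
  exact: tens_diff_ptens.
- move=> n b bl br ba.
  have bb : balanced (fun j i (h : j + i = n) p m => b i j (flip_eq h) m p).
    split=> [j i h m|j i h p|l i j li ij h1 h2 h h' p a m].
    + exact: br.
    + exact: bl.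
    + have h3 : i + l = li by rewrite addrC.
      rewrite (ba i j l ij li h2 h3 (flip_eq h') (flip_eq h)).
      rewrite /ract (linear_funZ (br _ _ _ _)) mulrC; congr (_ *: b _ _ _ _ _).
      by congr (act _ _ _); exact: eq_irrelevance.
  have [f [fl fE] _] := tens_lift bb; exists f => // i j h x p.
  by rewrite fE; congr (b _ _ _ _ _); exact: eq_irrelevance.
- move=> n f g fl gl fg; apply: tens_ext_linear => // i j h p m.
  have := fg j i (flip_eq h) m p; rewrite /left_tau.
  by rewrite (eq_irrelevance (flip_eq _) h).
Qed.

Lemma right_pairing : pairing right_theta right_tau.
Proof.
split.
- by move=> i j n h m c x y; rewrite /right_tau ptensDl ptensZl scalerDr !scalerA mulrC.
- by move=> i j n h p c x y; rewrite /right_tau ptensDr ptensZr scalerDr !scalerA mulrC.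
- move=> i j l ij il n h1 h2 h h' a p m; rewrite /right_tau.
  have h3 : j + i = ij by rewrite addrC.
  rewrite -(ptens_act h3 h2 h) /ract ptensZl.
  rewrite (eq_irrelevance (etrans _ _) h1) !scalerA -!sgnD; congr (_ *: _).
  apply: (@sgn_parity k (- (i * j))).
  by rewrite -h2 -h1; ring.
- move=> i j n i' j' n' hi hj hn h h1 h2 p m; rewrite /right_tau.
  rewrite linearZ /= (tens_diff_ptens hn hi hj h h1 h2) scalerDr !scalerA -!sgnD [LHS]addrC.
  congr (sgn k _ *: _ + _ *: _); first by rewrite -hj; ring.
  apply: (@sgn_parity k (- j)); rewrite -hi; ring.
- move=> n b bl br ba.
  have bb : balanced (fun i j (h : i + j = n) p m => sgn k (i * j) *: b i j h p m).
    split=> [i j h m|i j h p|i l j il lj h1 h2 h h' p a m].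
    + by move=> c x y; rewrite bl scalerDr !scalerA mulrC.
    + by move=> c x y; rewrite br scalerDr !scalerA mulrC.
    + rewrite /ract (linear_funZ (bl _ _ _ _)).
      rewrite (ba _ _ _ _ _ (etrans (addrC l i) h1) h2 h h') !scalerA -!sgnD.
      congr (_ *: _); apply: (@sgn_parity k (l * j)); rewrite -h1 -h2; ring.
  have [f [fl fE] _] := tens_lift bb; exists f => // i j h p m.
  by rewrite /right_tau (linear_funZ fl) fE scalerA sgn_sq scale1r.
- move=> n f g fl gl fg; apply: tens_ext_linear => // i j h p m.
  have := fg i j h p m; rewrite /right_tau (linear_funZ fl) (linear_funZ gl).
  move=> /(congr1 (GRing.scale (sgn k (i * j)))).
  by rewrite !scalerA sgn_sq !scale1r.
Qed.

End TensorPairings.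

(** * The supremum of a tensor product *)
Section PairingSup.
Variables (k : fieldType) (R S : dgalg k) (scR : simply_connected R).
Variable theta : forall i, R i -> S i.
Arguments theta {i} _.
Hypothesis theta_linear : forall i, linear (@theta i).
Hypothesis theta_one : theta (Defs.one R) = Defs.one S.
Hypothesis theta_diff : forall i j (h : i + 1 = j) (a : R i),
  theta (diff h a) = diff h (theta a).
Hypothesis theta_mul : forall i j n (h : i + j = n) (h' : j + i = n) (a : R i) (b : R j),
  theta (Defs.mul h a b) = sgn k (i * j) *: Defs.mul h' (theta b) (theta a).
Variables (N : dgmod S) (F : dgmod R) (T : complex k).
Variable tau : forall i j m : int, i + j = m -> F i -> N j -> T m.
Hypothesis pr : pairing (@theta) tau.

Let D n := dual_dgmod theta_linear theta_one theta_diff theta_mul n N.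

Lemma pairing_acyclic : K_projective F -> acyclic F -> acyclic T.
Proof.
move=> KF aF n; apply/H_vanishP.
apply: (@vanish_of_null _ _ _ _ theta_linear theta_one theta_diff theta_mul _ _ _ _ _ pr) => u.
have nid := KF _ (id_hom F) aF.
by apply: null_homotopic_eq (null_compl u nid).
Qed.

Lemma pairing_vanish c s n : proj_below c F -> (forall m, s < m -> H_vanish N m) ->
  s + c < n -> H_vanish T n.
Proof.
move=> pF vN sn; apply: (@vanish_of_null _ _ _ _ theta_linear theta_one theta_diff theta_mul _ _ _ _ _ pr) => u.
by apply: pF => i ic; apply: dual_vanish; apply: vN; lia.
Qed.

(** The dual of [N] that corresponds to degree [s + c] has its lowest cohomology in degree
    [c], namely the dual of [H^s(N)]. *)
Lemma pairing_nonzero c s : proj_below c F -> ~ red_vanish F c -> H_nonzero N s ->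
  (forall m, s < m -> H_vanish N m) -> H_nonzero T (s + c).
Proof.
move=> pF nrF nN vN.
have [||u nu] := @nonnull_hom _ _ scR c F (D (s + c)) pF nrF.
- by move=> i ic; apply: dual_vanish; apply: vN; lia.
- by apply: dual_nonzero; rewrite addrK.
- apply/H_nonvanishP => v; apply: nu.
  exact: (null_of_vanish pr u v).
Qed.

End PairingSup.

(** * Suprema in the extended integers *)
Section Suprema.
Variable k : fieldType.
Implicit Type C : complex k.

Definition has_top C s := H_nonzero C s /\ forall n, s < n -> H_vanish C n.

Lemma csup_top C s : has_top C s -> csup C = s%:E%E.
Proof.
move=> [nC vC]; rewrite /csup /supremum ifF; last first.
  by apply/negP => /eqP E; have : set0 (s%:E%E : \bar int) by rewrite -E; exists s.
case: xgetP => [x _ [ubx lbx]|/(_ s%:E%E) []].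
  apply/eqP; rewrite eq_le; apply/andP; split; last by apply: ubx; exists s.
  apply: lbx => _ [n nCn <-]; rewrite lee_fin leNgt; apply/negP => sn.
  by move/H_vanishP: (vC n sn).
split=> [_ [n nCn <-]|y uby]; last by apply: uby; exists s.
by rewrite lee_fin leNgt; apply/negP => sn; move/H_vanishP: (vC n sn).
Qed.

Lemma csup_acyclic C : acyclic C -> csup C = -oo%E.
Proof.
move=> aC; rewrite /csup (_ : [set _ | _ in _]%classic = set0) ?supremum0 //.
by rewrite -subset0 => x [n nC _]; exact: aC n nC.
Qed.

Lemma bounded_has_top C n0 b : H_nonzero C n0 -> (forall n, H_nonzero C n -> n <= b) ->
  exists s, has_top C s.
Proof.
move=> n0C bC; have [d bd] : exists d : nat, b <= n0 + d%:Z by exists (absz (b - n0)); lia.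
elim: d n0 n0C bd => [|d IHd] n0 n0C bd.
  by exists n0; split=> // n n0n; apply/H_vanishP => /bC; lia.
have [vC|] := pselect (forall n, n0 < n -> H_vanish C n); first by exists n0.
move=> /existsNP [n /not_implyP [n0n /H_nonvanishP nC]].
by apply: (IHd n) => //; lia.
Qed.

Lemma csup_lty C : (csup C < +oo)%E -> ~ acyclic C -> exists s, has_top C s.
Proof.
move=> sC naC.
have [n0 n0C] : exists n, H_nonzero C n.
  by apply: contrapT => nC; apply: naC => n Cn; apply: nC; exists n.
have [[b bC]|unb] := pselect (exists b, forall n, H_nonzero C n -> n <= b).
  exact: bounded_has_top n0C bC.
exfalso; move: sC; rewrite /csup /supremum ifF; last first.
  by apply/negP => /eqP E; have : set0 (n0%:E%E : \bar int) by rewrite -E; exists n0.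
case: xgetP => [x _ [ubx lbx]|/(_ +oo%E) []].
  case: x ubx lbx => [r|//|] ubx _ _.
    by apply: unb; exists r => n nC; have := ubx n%:E%E; rewrite lee_fin; apply; exists n.
  by suff : (n0%:E <= -oo :> \bar int)%E by []; apply: ubx; exists n0.
split=> [x _|y uby]; first exact: leey.
case: y uby => [r|//|] uby.
  by exfalso; apply: unb; exists r => n nC; have := uby n%:E%E; rewrite lee_fin; apply; exists n.
by suff : (n0%:E <= -oo :> \bar int)%E by []; apply: uby; exists n0.
Qed.

End Suprema.

(** * Resolutions of the given modules *)
Section Resolutions.
Variables (k : fieldType) (R : dgalg k).
Implicit Types M : dgmod R.

Lemma Kproj_resolution_quasi_iso M : exists f : dghom (Kproj_resolution M) M, quasi_iso f.
Proof.
rewrite /Kproj_resolution; case: pselect => [ex|_]; first by case: (cid ex) => F [].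
by exists (id_hom M); exact: quasi_iso_id.
Qed.

Lemma Kproj_resolution_proj M c : resolved c M ->
  K_projective (Kproj_resolution M) /\ proj_below c (Kproj_resolution M).
Proof.
move=> [F pF [q qq]].
have KM : K_projective (Kproj_resolution M).
  rewrite /Kproj_resolution; case: pselect => [ex|[]]; first by case: (cid ex) => G [].
  by exists F; split; [exact: proj_below_Kproj pF|exists q].
have [f qf] := Kproj_resolution_quasi_iso M.
by split=> //; exact: proj_below_transfer KM qf pF qq.
Qed.

Lemma acyclic_quasi_iso M N (f : dghom M N) : quasi_iso f -> acyclic M <-> acyclic N.
Proof.
by move=> qf; split=> aM n /(quasi_iso_nonzero n qf); exact: aM.
Qed.

Lemma has_top_quasi_iso M N (f : dghom M N) s : quasi_iso f -> has_top M s <-> has_top N s.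
Proof.
move=> qf; split=> -[n v]; split; try by apply/(quasi_iso_nonzero s qf).
  by move=> m sm; apply/(quasi_iso_vanish m qf); exact: v.
by move=> m sm; apply/(quasi_iso_vanish m qf); exact: v.
Qed.

Lemma compact_top (scR : simply_connected R) M : Dcompact M -> ~ acyclic M ->
  exists2 c, proj_below c (Kproj_resolution M) & ~ red_vanish (Kproj_resolution M) c.
Proof.
move=> cM naM; have [c rM] := compact_resolved cM.
have [KM pM] := Kproj_resolution_proj rM.
have [f qf] := Kproj_resolution_quasi_iso M.
apply: (exists_top scR pM).
  by apply/(bounded_below_quasi_iso qf); apply: compact_bounded_below cM; exact: sc_neg scR.
by move=> /(acyclic_quasi_iso qf).
Qed.

End Resolutions.

Lemma residue_top (k : fieldType) (R : dgalg k) (scR : simply_connected R) : has_top (residue_dgmod scR) 0.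
Proof.
split=> [|n n0 z _].
  exists (const_mx 1 : residue_gr k 0) => //.
  by move=> [m [h [y /matrixP /(_ 0 (Ordinal (isT : 0 < (0 == 0 :> int))%N))]]];
    rewrite !mxE => /esym/eqP; rewrite oner_eq0.
suff -> : z = 0 by exact: boundary0.
by apply/matrixP => u l; have := ord_deg0 l; lia.
Qed.

(** * Two expressions for the supremum of the derived tensor product *)
Section TensorSup.
Variables (k : fieldType) (R : dgalg k) (scR : simply_connected R).
Variables (P : dgmod R^op) (M : dgmod R).

Fact left_theta_linear i : linear (@left_theta k R i). Proof. by []. Qed.
Fact right_theta_linear i : linear (@right_theta k R i). Proof. by []. Qed.
Fact left_theta_mul i j n (h : i + j = n) (h' : j + i = n) (a : R i) (b : R j) :
  left_theta (Defs.mul h a b) = sgn k (i * j) *: Defs.mul h' (left_theta b) (left_theta a).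
Proof.
rewrite /= /op_mul scalerA [j * i]mulrC sgn_sq scale1r.
by rewrite (eq_irrelevance (etrans _ _) h).
Qed.
Fact right_theta_mul i j n (h : i + j = n) (h' : j + i = n) (a : R^op i) (b : R^op j) :
  right_theta (Defs.mul h a b) = sgn k (i * j) *: Defs.mul h' (right_theta b) (right_theta a).
Proof.
by rewrite /= /op_mul (eq_irrelevance (etrans _ _) h').
Qed.

Lemma tens_top_right c s : proj_below c M -> ~ red_vanish M c -> has_top P s ->
  has_top (tens_complex P M) (s + c).
Proof.
move=> pM nM [nP vP]; split.
  apply: (pairing_nonzero scR left_theta_linear _ _ left_theta_mul
    (left_pairing P M) pM nM nP vP) => //.
move=> n; apply: (pairing_vanish left_theta_linear _ _ left_theta_mul
  (left_pairing P M) pM vP) => //.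
Qed.

Lemma tens_top_left c s : proj_below c P -> ~ red_vanish P c -> has_top M s ->
  has_top (tens_complex P M) (s + c).
Proof.
move=> pP nP [nM vM]; split.
  apply: (pairing_nonzero (op_simply_connected scR) right_theta_linear _ _ right_theta_mul
    (right_pairing P M) pP nP nM vM) => //.
move=> n; apply: (pairing_vanish right_theta_linear _ _ right_theta_mul
  (right_pairing P M) pP vM) => //.
Qed.

Lemma tens_acyclic : K_projective M -> acyclic M -> acyclic (tens_complex P M).
Proof.
by apply: (pairing_acyclic left_theta_linear _ _ left_theta_mul (left_pairing P M)).
Qed.

End TensorSup.

(** Computing the supremum of the derived tensor product of [P] and [M] by [tens_top_left]
    and by [tens_top_right] gives two expressions for the same integer. *)
Theorem theorem4p5 (k : fieldType) (R : dgalg k) (scR : simply_connected R)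
    (P : dgmod R^op)
    (P_compact : Dcompact P)
    (P_nonzero : ~ Diso P (zero_dgmod R^op))
    (supP : (csup P < +oo)%E) :
  let d : \bar int := (pcd_right scR P - csup P)%E in
  forall M : dgmod R, Dcompact M -> (csup M < +oo)%E ->
    pcd scR M = (csup M + d)%E.
Proof.
move=> d M M_compact supM.
have naP : ~ acyclic P by move=> /acyclic_Diso_zero.
have [s sP] := csup_lty supP naP.
have [p pP nP] := compact_top (op_simply_connected scR) P_compact naP.
have [fP qP] := Kproj_resolution_quasi_iso P.
have [fM qM] := Kproj_resolution_quasi_iso M.
have sP' := (has_top_quasi_iso s qP).2 sP.
have res_top (S : dgalg k) (scS : simply_connected S) :
    has_top (Kproj_resolution (residue_dgmod scS)) 0.
  have [f qf] := Kproj_resolution_quasi_iso (residue_dgmod scS).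
  by apply/(has_top_quasi_iso 0 qf); exact: residue_top.
have pcdP : pcd_right scR P = p%:E%E.
  rewrite /pcd_right /Ltens (csup_top (tens_top_left scR pP nP (res_top R scR))).
  by rewrite add0r.
rewrite /d pcdP (csup_top sP).
have [aM|naM] := pselect (acyclic M).
  have [c rM] := compact_resolved M_compact.
  have [KM _] := Kproj_resolution_proj rM.
  have aM' := (acyclic_quasi_iso qM).2 aM.
  by rewrite (csup_acyclic aM) /pcd /Ltens (csup_acyclic (@tens_acyclic k R _ _ KM aM')).
have [t sM] := csup_lty supM naM.
have [c pM nM] := compact_top scR M_compact naM.
have sM' := (has_top_quasi_iso t qM).2 sM.
have pcdM : pcd scR M = c%:E%E.
  rewrite /pcd /Ltens (csup_top (tens_top_right scR pM nM (res_top _ (op_simply_connected scR)))).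
  by rewrite add0r.
rewrite pcdM (csup_top sM) -EFinB -EFinD; congr (_%:E)%E.
have := csup_top (tens_top_right scR pM nM sP').
rewrite (csup_top (tens_top_left scR pP nP sM')) => -[].
lia.
Qed.
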